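(* Let $\varphi(s)=s+\psi(s)\in\mathcal G_{>0}$ be univalent (on $\mathbb C_0$), with $\psi$ not constant. Let $u$ be the K\''onigs map of $\varphi$ and let $\Omega=\{w\in\mathbb C_0: w+\overline{u(\mathbb C_0)}\subset u(\mathbb C_0)\}$. Assume that $u\in\mathcal G_{>0}$, that $\Omega$ is open and that $\Omega$ contains $(0,+\infty)$. Then $C_\varphi$, acting on $\mathcal H^2$, has a minimal commutant.
   Context: For $\theta\in\mathbb R$, $\mathbb C_\theta=\{s:\mathrm{Re}\,s>\theta\}$. $\mathcal G_{>0}$ is the set of maps $\varphi(s)=c_0s+\psi(s)$ where $c_0\ge1$ is an integer (the characteristic), $\psi$ is a Dirichlet series $\sum_{n\geq 1}c_nn^{-s}$ converging uniformly in $\mathbb C_\varepsilon$ for every $\varepsilon>0$, and either $\psi\equiv i\tau$ for some $\tau\in\mathbb R$ or $\psi(\mathbb C_0)\subset\mathbb C_0$; such $\varphi$ is a self-map of $\mathbb C_0$. $\mathcal{GH}_{>0}$ is the set of holomorphic $u:\mathbb C_0\to\mathbb C$ of the form $u(s)=d_0s+\theta(s)$ with $d_0$ a positive integer (the characteristic) and $\theta$ a Dirichlet series converging uniformly on each $\mathbb C_\varepsilon$, $\varepsilon>0$. For $\varphi$ with characteristic $1$ and $\psi$ not constant, the K\''onigs map of $\varphi$ is the map $u\in\mathcal{GH}_{>0}$ with characteristic $1$, unique up to an additive constant, such that $u\circ\varphi=u+c_1$; $u\in\mathcal G_{>0}$ means that the additive constant is chosen so that this holds ($\Omega$ does not depend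 on this constant). $\mathcal H^2$ is the Hilbert space of Dirichlet series $f(s)=\sum_{n\ge1}a_nn^{-s}$ with $\|f\|=(\sum|a_n|^2)^{1/2}<\infty$ (analytic on $\mathbb C_{1/2}$), and $C_\varphi f=f\circ\varphi$ is bounded on $\mathcal H^2$. For a bounded operator $A$ on a Hilbert space $H$, $\{A\}'=\{T\in\mathcal B(H):TA=AT\}$, $\mathrm{alg}(A)=\{p(A):p\text{ a polynomial}\}$, and $A$ has a minimal commutant if $\overline{\mathrm{alg}(A)}^{\sigma}=\{A\}'$, where $\sigma$ denotes the weak operator topology. *)

(* Defs.v *)
From HB Require Import structures.
From mathcomp Require Import all_boot all_order all_algebra.
From mathcomp Require Import all_classical all_reals all_analysis.
From mathcomp Require Import complex.

Set Implicit Arguments.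
Unset Strict Implicit.
Unset Printing Implicit Defensive.

Import Order.TTheory GRing.Theory Num.Theory.
Import numFieldNormedType.Exports.

Local Open Scope classical_set_scope.
Local Open Scope ring_scope.
Local Open Scope complex_scope.

(* [R[i]] carries no topology of its own in the library; the regular module    *)
(* [R[i]^o] does, with scalar field [R[i]], so that [derivable _ s 1] below is  *)
(* complex differentiability.                                                  *)
Notation Cplx R := (R[i]^o).

Section BoundedOperators.
Context {K : numFieldType} {H : normedModType K}.

Record bounded_op := BoundedOp {
  op_fun :> {linear H -> H};
  op_bounded : exists M : K, forall x, `|op_fun x| <= M * `|x| }.

HB.instance Definition _ := gen_eqMixin bounded_op.
HB.instance Definition _ := gen_choiceMixin bounded_op.

Definition commutant (A : bounded_op) : set bounded_op :=
  [set T | forall x, T (A x) = A (T x)].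

Definition op_alg (A : bounded_op) : set bounded_op :=
  [set T | exists p : {poly K},
     forall x, T x = \sum_(i < size p) p`_i *: iter i A x].

(* The weak operator topology of an inner product [dot]: the coarsest one      *)
(* making every matrix coefficient [T |-> dot (T x) y] continuous.             *)
Definition matrix_coef (dot : H -> H -> K) (T : bounded_op) :
  {ptws H * H -> K^o} := fun xy => dot (T xy.1) xy.2.

Definition wot (dot : H -> H -> K) : topologicalType :=
  initial_topology (matrix_coef dot).

Definition minimal_commutant (dot : H -> H -> K) (A : bounded_op) : Prop :=
  closure (op_alg A : set (wot dot)) = commutant A.

End BoundedOperators.

Arguments bounded_op {K} H.

Section Dirichlet.
Context {R : realType}.
Local Notation C := (Cplx R).

Definition half_plane (t : R) : set C := [set s | t < complex.Re s].

Definition cexp (z : C) : C :=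
  (expR (complex.Re z) * cos (complex.Im z)) +i*
  (expR (complex.Re z) * sin (complex.Im z)).

Definition dirichlet_term (n : nat) (s : C) : C := cexp (- ((ln n%:R)%:C * s)).

(* Coefficient sequences are shifted: [a k] is the coefficient of (k+1)^(-s).  *)
Definition dirichlet_sum (a : nat -> C) (N : nat) (s : C) : C :=
  \sum_(k < N) a k * dirichlet_term k.+1 s.

Definition dirichlet_series (a : nat -> C) (s : C) : C :=
  limn (fun N => dirichlet_sum a N s).

Definition unif_dirichlet (c : nat -> C) (psi : C -> C) : Prop :=
  forall e : R, 0 < e ->
    {uniform half_plane e, dirichlet_sum c @ \oo --> psi}.

Definition holomorphic (f : C -> C) : Prop :=
  forall s, half_plane 0 s -> derivable f s 1.

Definition univalent (f : C -> C) : Prop :=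
  holomorphic f /\ {in half_plane 0 &, injective f}.

Definition nonconstant (f : C -> C) : Prop :=
  ~ exists w, forall s, half_plane 0 s -> f s = w.

(* Maps of the half-plane are total functions on [C] of which only the values  *)
(* on [half_plane 0] matter.                                                   *)
Definition GordonHedenmalm (d : nat) (c : nat -> C) (psi phi : C -> C) : Prop :=
  [/\ (1 <= d)%N,
      forall s, half_plane 0 s -> phi s = d%:R * s + psi s,
      unif_dirichlet c psi
    & (exists tau : R, forall s, half_plane 0 s -> psi s = tau *i) \/
      (forall s, half_plane 0 s -> half_plane 0 (psi s))].

Definition G_pos : set (C -> C) :=
  [set phi | exists d c psi, GordonHedenmalm d c psi phi].

Definition GH_pos (d : nat) : set (C -> C) :=
  [set u | [/\ (0 < d)%N, holomorphic u &
     exists c theta, unif_dirichlet c theta /\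
       forall s, half_plane 0 s -> u s = d%:R * s + theta s]].

(* [c1] is the constant coefficient of the Dirichlet series of [phi s - s].    *)
Definition koenigs_map (c1 : C) (phi u : C -> C) : Prop :=
  GH_pos 1 u /\ forall s, half_plane 0 s -> u (phi s) = u s + c1.

Definition koenigs_shifts (u : C -> C) : set C :=
  [set w | half_plane 0 w /\
     [set w + z | z in closure (u @` half_plane 0)] `<=` u @` half_plane 0].

End Dirichlet.

Section HardyDirichlet.
Context {R : realType}.
Local Notation C := (Cplx R).

Definition sqnorm (a : nat -> C) : \bar R :=
  (\sum_(k <oo) (complex.Re `|a k| ^+ 2)%:E)%E.

Definition square_summable : {pred nat -> C} :=
  [pred a | (sqnorm a < +oo)%E].

Record H2 := HardyDirichlet {
  coefs :> nat -> C;
  coefsP : coefs \in square_summable }.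

HB.instance Definition _ := [isSub for coefs].
HB.instance Definition _ := [Choice of H2 by <:].

Let modulus (a : nat -> C) (k : nat) : R := complex.Re `|a k|.

Let modulusE (z : C) : `|z| = (complex.Re `|z|)%:C.
Proof. by rewrite RRe_real ?normr_real. Qed.

Let modulus_ge0 a k : 0 <= modulus a k.
Proof. by rewrite -lecR /modulus -modulusE normr_ge0. Qed.

Let l2 (f : nat -> R) : \bar R := 'N[counting]_(2%:E) [EFin \o f].

Lemma sqnorm_ge0 a : (0 <= sqnorm a)%E.
Proof. by apply: nneseries_ge0 => k _ _; rewrite lee_fin sqr_ge0. Qed.

Lemma l2E a : l2 (modulus a) = (sqnorm a `^ 2^-1)%E.
Proof.
rewrite /l2 Lnorm_counting//; congr (_ `^ _)%E.
apply: eq_eseriesr => k _ /=.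
by rewrite ger0_norm ?modulus_ge0// powR_mulrn ?modulus_ge0.
Qed.

Lemma l2_sqrt a : (sqnorm a < +oo)%E ->
  l2 (modulus a) = (Num.sqrt (fine (sqnorm a)))%:E.
Proof.
move=> aoo; rewrite l2E -[in LHS](@fineK _ (sqnorm a)).
  by rewrite poweR_EFin powR12_sqrt// fine_ge0// sqnorm_ge0.
by rewrite ge0_fin_numE// sqnorm_ge0.
Qed.

Lemma l2_triangle a b :
  (l2 (modulus (a + b)%R) <= l2 (modulus a) + l2 (modulus b))%E.
Proof.
apply: (@le_trans _ _ (l2 (modulus a \+ modulus b))); last first.
  by apply: eminkowski => //; rewrite lee_fin ler1n.
rewrite /l2 !Lnorm_counting//.
have ge0 (f : nat -> R) :
    (0 <= \sum_(k <oo) (`|(EFin \o f) k| `^ 2))%E.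
  by apply: nneseries_ge0 => *; rewrite poweR_ge0.
apply: gt0_ler_poweR; rewrite ?in_itv/= ?leey ?andbT ?ge0//.
apply: lee_nneseries => [k _ _|k _] /=; first by rewrite lee_fin powR_ge0.
rewrite lee_fin ge0_ler_powR ?nnegrE//.
rewrite !ger0_norm ?addr_ge0 ?modulus_ge0//.
by rewrite -lecR rmorphD/= -!modulusE ler_normD.
Qed.

Lemma sqnormZ (l : C) a :
  sqnorm (l *: a) = ((complex.Re `|l| ^+ 2)%:E * sqnorm a)%E.
Proof.
rewrite /sqnorm -nneseriesZl; last by move=> k _; rewrite lee_fin sqr_ge0.
apply: eq_eseriesr => k _; rewrite -EFinM; congr (_%:E).
rewrite -exprMn; congr (_ ^+ 2); apply: complexI.
by rewrite rmorphM/= -!modulusE normrM.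
Qed.

Let square_summableD a b : (sqnorm a < +oo -> sqnorm b < +oo ->
  sqnorm (a + b)%R < +oo)%E.
Proof.
move=> aoo boo; apply: (@lty_poweRy _ _ 2^-1) => //; rewrite -l2E.
by apply: le_lt_trans (l2_triangle a b) _; rewrite !l2_sqrt// -EFinD ltry.
Qed.

Let square_summable_submod_closed : submod_closed square_summable.
Proof.
split=> [|l a b].
  rewrite inE /sqnorm eseries0// => k _ _.
  by rewrite [X in `|X|](_ : _ = 0)// normr0 expr0n.
rewrite !inE => aoo boo; apply: square_summableD => //.
rewrite sqnormZ lte_mul_pinfty ?lee_fin ?sqr_ge0//.
Qed.

HB.instance Definition _ :=
  GRing.isSubmodClosed.Build C (nat -> C) square_summable
    square_summable_submod_closed.
HB.instance Definition _ := [SubChoice_isSubLmodule of H2 by <:].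

Definition H2norm (f : H2) : C := (Num.sqrt (fine (sqnorm f)))%:C.

Let sqnorm_lty (f : H2) : (sqnorm f < +oo)%E. Proof. exact: (coefsP f). Qed.

Let H2normD f g : H2norm (f + g) <= H2norm f + H2norm g.
Proof.
rewrite -rmorphD lecR -lee_fin EFinD -!l2_sqrt ?sqnorm_lty//.
exact: l2_triangle.
Qed.

Let H2normZ (l : C) f : H2norm (l *: f) = `|l| * H2norm f.
Proof.
have f_fin : sqnorm f \is a fin_num.
  by rewrite ge0_fin_numE ?sqnorm_ge0// sqnorm_lty.
have l0 : 0 <= complex.Re `|l| by rewrite -lecR -modulusE normr_ge0.
rewrite /H2norm sqnormZ fineM// sqrtrM ?sqr_ge0// sqrtr_sqr ger0_norm//.
by rewrite rmorphM/= -modulusE.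
Qed.

Let H2norm0_eq0 f : H2norm f = 0 -> f = 0.
Proof.
move=> /complexI f0; have sf0 : sqnorm f = 0%E.
  apply/eqP; rewrite eq_le sqnorm_ge0 andbT.
  rewrite -(@fineK _ (sqnorm f)) ?ge0_fin_numE ?sqnorm_ge0 ?sqnorm_lty//.
  by rewrite lee_fin -sqrtr_eq0 f0.
apply/val_inj/funext => k; apply/eqP; rewrite -normr_eq0 modulusE.
have := @nneseries_lim_ge R (fun k => (modulus f k ^+ 2)%:E) xpredT 0 k.+1.
rewrite -[limn _]/(sqnorm f) sf0 big_nat_recr//= => /(_ _)/= h.
have {h} : ((modulus f k ^+ 2)%:E <= 0)%E.
  apply: le_trans (h _); last by move=> *; rewrite lee_fin sqr_ge0.
  by rewrite leeDr// sume_ge0// => *; rewrite lee_fin sqr_ge0.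
rewrite lee_fin => h; have : modulus f k ^+ 2 == 0 by rewrite eq_le h sqr_ge0.
by rewrite sqrf_eq0 => /eqP /(congr1 (real_complex R)) /eqP.
Qed.

HB.instance Definition _ := Lmodule_isNormed.Build C H2 H2normD H2normZ H2norm0_eq0.

Definition H2dot (f g : H2) : C :=
  limn (fun N => \sum_(k < N) f k * (g k)^* : C).

(* An element of [H2] defines a function on [half_plane 2^-1], which any       *)
(* [phi] in [G_pos] maps into itself; it is determined by that function.       *)
Definition composition_operator (phi : C -> C) (A : bounded_op H2) : Prop :=
  forall f : H2, forall s, half_plane 2^-1 s ->
    dirichlet_series (A f) s = dirichlet_series f (phi s).

End HardyDirichlet.

Arguments H2 : clear implicits.

(* Main.v *)
(* The functions [n ^ (- u)] are eigenvectors of the composition operator [A] with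
   symbol [phi], for the eigenvalues [n ^ (- c1)]; as [0 < Re c1] these are distinct,
   so any [T] commuting with [A] is diagonal on the same functions.  For [w] in Omega
   put [S_w f = f \o u^-1 (u + w)].  It is a contraction of [H2]: by Abel summation
   [|sum_n a_n n ^ (- z)| ^ 2] is at most [sum_n |a_n| ^ 2] plus the real part of a
   combination of the [(n / m) ^ (- z)] with [m < n], and these, composed with
   [u^-1 (u + w)], have mean zero along vertical lines by Cauchy's theorem.

   Suppose that a finite combination of matrix coefficients vanishes on all powers of
   [A].  Far to the right [f \o u^-1] is a Dirichlet series [sum_l b_l l ^ (- s)], so
   that [S_w f = sum_l b_l l ^ (- w) l ^ (- u)] for [Re w] large.  Since [A ^ k] is
   given by this formula with [w = k c1], letting [k] grow isolates the terms of the
   resulting series in [l] one after the other: the combination vanishes term by term,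
   hence also at [T S_t] for large real [t].  By the contraction property its value at
   [T S_w] is a uniform limit of Dirichlet polynomials in [w] on Omega, hence analytic:
   it vanishes for all [t > 0], and at [T] when [t] tends to 0.  By duality in finite
   dimension [T] agrees with a polynomial in [A] on any finite set of matrix
   coefficients. *)

Require Import Defs.
From HB Require Import structures.
From mathcomp Require Import all_boot all_order all_algebra.
From mathcomp Require Import all_classical all_reals all_analysis.
From mathcomp Require Import complex.
From mathcomp Require Import ring lra.

Set Implicit Arguments.
Unset Strict Implicit.
Unset Printing Implicit Defensive.

Import Order.TTheory GRing.Theory Num.Theory.
Import numFieldNormedType.Exports.
Import Normc.

Local Open Scope classical_set_scope.
Local Open Scope ring_scope.
Local Open Scope complex_scope.

Local Notation cm := (@normc _).
Local Notation re := (@complex.Re _).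
Local Notation im := (@complex.Im _).

(** * Complex numbers *)

Section ComplexBasics.
Context {R : realType}.
Local Notation C := R[i].

Lemma cm_ge0 (z : C) : 0 <= cm z.
Proof. by case: z => a b /=; rewrite sqrtr_ge0. Qed.

Lemma cm_sq (z : C) : cm z ^+ 2 = re z ^+ 2 + im z ^+ 2.
Proof. by case: z => a b /=; rewrite sqr_sqrtr// addr_ge0 ?sqr_ge0. Qed.

Lemma cm0 : cm (0 : C) = 0. Proof. exact: normc0. Qed.
Lemma cm1 : cm (1 : C) = 1. Proof. exact: normc1. Qed.

Lemma cm_eq0 (z : C) : (cm z == 0) = (z == 0).
Proof.
apply/eqP/eqP => [/eq0_normc//|->]; exact: cm0.
Qed.

Lemma cm_gt0 (z : C) : (0 < cm z) = (z != 0).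
Proof. by rewrite lt_def cm_ge0 andbT cm_eq0. Qed.

Lemma cmD (x y : C) : cm (x + y) <= cm x + cm y.
Proof. exact: le_normcD. Qed.

Lemma cmN (x : C) : cm (- x) = cm x.
Proof. exact: normcN. Qed.

Lemma cmB (x y : C) : cm (x - y) <= cm x + cm y.
Proof. by rewrite -(cmN y) cmD. Qed.

Lemma cmBC (x y : C) : cm (x - y) = cm (y - x).
Proof. by rewrite -opprB cmN. Qed.

Lemma cm_triB (x y z : C) : cm (x - z) <= cm (x - y) + cm (y - z).
Proof. by apply: le_trans (cmD _ _); rewrite addrA subrK. Qed.

Lemma cm_lB (x y : C) : cm x - cm y <= cm (x - y).
Proof. by rewrite lerBlDr; apply: le_trans (cmD _ _); rewrite subrK. Qed.

Lemma cmM (x y : C) : cm (x * y) = cm x * cm y.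
Proof. exact: normcM. Qed.

Lemma cmV (x : C) : cm x^-1 = (cm x)^-1.
Proof. exact: normcV. Qed.

Lemma cmX (x : C) n : cm (x ^+ n) = cm x ^+ n.
Proof. by elim: n => [|n IH]; rewrite ?expr0 ?cm1// !exprS cmM IH. Qed.

Lemma cm_real (x : R) : cm x%:C = `|x|.
Proof. by rewrite /= expr0n/= addr0 sqrtr_sqr. Qed.

Lemma cm_nat n : cm (n%:R : C) = n%:R.
Proof. by rewrite -(rmorph_nat (real_complex R)) cm_real normr_nat. Qed.

Lemma cm_sum (I : Type) (r : seq I) (P : pred I) (F : I -> C) :
  cm (\sum_(i <- r | P i) F i) <= \sum_(i <- r | P i) cm (F i).
Proof.
elim/big_rec2: _ => [|i y x _ h]; first by rewrite cm0.
by apply: le_trans (cmD _ _) _; rewrite lerD2l.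
Qed.

Lemma reE (z : C) : `|re z| <= cm z.
Proof.
rewrite -sqrtr_sqr -[cm z]ger0_norm ?cm_ge0// -sqrtr_sqr ler_wsqrtr// cm_sq.
by rewrite lerDl sqr_ge0.
Qed.

Lemma imE (z : C) : `|im z| <= cm z.
Proof.
rewrite -sqrtr_sqr -[cm z]ger0_norm ?cm_ge0// -sqrtr_sqr ler_wsqrtr// cm_sq.
by rewrite lerDr sqr_ge0.
Qed.

Lemma re_le (z : C) : re z <= cm z.
Proof. by apply: le_trans (reE z); rewrite ler_norm. Qed.

Lemma re_ge (z : C) : - cm z <= re z.
Proof. by have := reE z; rewrite ler_norml => /andP[]. Qed.

Lemma cm_le (z : C) : cm z <= `|re z| + `|im z|.
Proof.
rewrite -[leLHS]ger0_norm ?cm_ge0// -sqrtr_sqr cm_sq.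
rewrite -[leRHS]ger0_norm ?addr_ge0// -[leRHS]sqrtr_sqr ler_wsqrtr//.
rewrite -(real_normK (num_real (re z))) -(real_normK (num_real (im z))).
have := normr_ge0 (re z); have := normr_ge0 (im z); nra.
Qed.

Lemma reD (x y : C) : re (x + y) = re x + re y.
Proof. by case: x y => [a b] [c d]. Qed.
Lemma reN (x : C) : re (- x) = - re x.
Proof. by case: x => [a b]. Qed.
Lemma reB (x y : C) : re (x - y) = re x - re y.
Proof. by rewrite reD reN. Qed.
Lemma imD (x y : C) : im (x + y) = im x + im y.
Proof. by case: x y => [a b] [c d]. Qed.
Lemma imN (x : C) : im (- x) = - im x.
Proof. by case: x => [a b]. Qed.
Lemma reM (x y : C) : re (x * y) = re x * re y - im x * im y.
Proof. by case: x y => [a b] [c d]. Qed.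
Lemma imM (x y : C) : im (x * y) = re x * im y + im x * re y.
Proof. by case: x y => [a b] [c d]. Qed.
Lemma reMr (x : R) (y : C) : re (x%:C * y) = x * re y.
Proof. by rewrite reM /= mul0r subr0. Qed.
Lemma re_nat n (y : C) : re (n%:R * y) = n%:R * re y.
Proof. by rewrite -(rmorph_nat (real_complex R)) reMr. Qed.

Lemma imMr (x : R) (y : C) : im (x%:C * y) = x * im y.
Proof. by rewrite imM /= mul0r addr0. Qed.
Lemma re_sum (I : Type) (r : seq I) (P : pred I) (F : I -> C) :
  re (\sum_(i <- r | P i) F i) = \sum_(i <- r | P i) re (F i).
Proof. by elim/big_rec2: _ => [|i y x _ <-]//; rewrite reD. Qed.

Lemma complex_ext (x y : C) : re x = re y -> im x = im y -> x = y.
Proof. by case: x y => [a b] [c d] /= -> ->. Qed.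

Lemma cmcj (z : C) : cm (conjc z) = cm z.
Proof. by case: z => a b /=; rewrite sqrrN. Qed.

Lemma cjM (x y : C) : conjc (x * y) = conjc x * conjc y.
Proof. by case: x y => [a b] [c d]; apply: complex_ext => /=; ring. Qed.

Lemma mulcj (z : C) : z * conjc z = (cm z ^+ 2)%:C.
Proof.
rewrite cm_sq; case: z => a b /=; apply/eqP; rewrite eq_complex /=.
by apply/andP; split; apply/eqP; ring.
Qed.

Definition tends (u : nat -> C) (l : C) :=
  forall e : R, 0 < e -> exists N, forall n, (N <= n)%N -> cm (u n - l) <= e.

Lemma cauchy_tends (u : nat -> C) :
  (forall e : R, 0 < e -> exists N, forall n m, (N <= n)%N -> (n <= m)%N ->
     cm (u m - u n) <= e) -> exists l, tends u l.
Proof.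
move=> cu.
have aux (v : nat -> R) : (forall n m, `|v n - v m| <= cm (u n - u m)) ->
    exists l, forall e : R, 0 < e ->
      exists N, forall n, (N <= n)%N -> `|v n - l| <= e.
  move=> vu.
  have cv : cvg (v @ \oo).
    apply/cauchy_cvgP/cauchy_exP => e e0.
    have e20 : 0 < e / 2 by lra.
    have [N hN] := cu _ e20.
    exists (v N); exists N => // n /= Nn.
    rewrite -ball_normE /ball_/=; apply: le_lt_trans (vu _ _) _.
    by rewrite cmBC; apply: le_lt_trans (hN _ _ _ Nn) _ => //; lra.
  exists (lim (v @ \oo)) => e e0.
  have /cvgrPdist_le/(_ e e0)[N _ hN] := cv.
  by exists N => n Nn; rewrite distrC; apply: hN.
have [a ha] := aux (fun n => re (u n)) (fun n m => ltac:(rewrite -reB; exact: reE)).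
have [b hb] := aux (fun n => im (u n)) (fun n m => ltac:(rewrite -imN -imD; exact: imE)).
exists (a +i* b) => e e0.
have e20 : 0 < e / 2 by lra.
have [N hN] := ha _ e20; have [M hM] := hb _ e20.
exists (maxn N M) => n; rewrite geq_max => /andP[Nn Mn].
apply: le_trans (cm_le _) _; rewrite reB imD imN /=.
have := hN _ Nn; have := hM _ Mn; lra.
Qed.

Lemma le_refl_eq (x y : R) : x = y -> x <= y.
Proof. by move->. Qed.

Lemma le_eps (x y : R) : (forall e, 0 < e -> x <= y + e) -> x <= y.
Proof. by move=> h; apply/ler_addgt0Pr => e e0; apply: h. Qed.

Lemma cm_eps0 (z : C) : (forall e, 0 < e -> cm z <= e) -> z = 0.
Proof.
move=> h; apply/eqP; rewrite -cm_eq0 eq_le cm_ge0 andbT.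
by apply: le_eps => e e0; rewrite add0r h.
Qed.

Lemma cm_eps_eq (x y : C) : (forall e, 0 < e -> cm (x - y) <= e) -> x = y.
Proof. by move=> /cm_eps0/eqP; rewrite subr_eq0 => /eqP. Qed.

Lemma tends_unique (u : nat -> C) l l' : tends u l -> tends u l' -> l = l'.
Proof.
move=> h h'; apply: cm_eps_eq => e e0.
have e20 : 0 < e / 2 by lra.
have [N hN] := h _ e20; have [M hM] := h' _ e20.
apply: le_trans (cm_triB _ (u (maxn N M)) _) _.
rewrite (cmBC l).
have := hN _ (leq_maxl N M); have := hM _ (leq_maxr N M); lra.
Qed.

Lemma tends_le (u : nat -> C) l A :
  tends u l -> (exists N, forall n, (N <= n)%N -> cm (u n) <= A) -> cm l <= A.
Proof.
move=> h [N hN]; apply: le_eps => e e0; have [M hM] := h _ e0.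
have := hM _ (leq_maxr N M); have := hN _ (leq_maxl N M).
rewrite cmBC; have := cm_lB l (u (maxn N M)); lra.
Qed.

(** * The complex exponential *)

Definition ex (z : C) : C :=
  (expR (re z) * cos (im z)) +i* (expR (re z) * sin (im z)).

Lemma exD (a b : C) : ex (a + b) = ex a * ex b.
Proof.
apply: complex_ext; rewrite /ex ?reM ?imM /= reD imD expRD ?cosD ?sinD; ring.
Qed.

Lemma ex0 : ex 0 = 1.
Proof. by rewrite /ex /= expR0 cos0 sin0 mulr0 mulr1. Qed.

Lemma ex_neq0 (a : C) : ex a != 0.
Proof.
apply/eqP => a0; have : ex a * ex (- a) = 1 by rewrite -exD subrr ex0.
by rewrite a0 mul0r => /eqP; rewrite eq_sym oner_eq0.
Qed.

Lemma cm_ex (z : C) : cm (ex z) = expR (re z).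
Proof.
rewrite /ex /= !exprMn -mulrDr cos2Dsin2 mulr1 sqrtr_sqr ger0_norm//.
Qed.

Lemma exMn (z : C) n : ex (z *+ n) = ex z ^+ n.
Proof. by elim: n => [|n IH]; rewrite ?mulr0n ?ex0 ?expr0// mulrS exprS exD IH. Qed.

Lemma exX (z : C) n : ex (n%:R * z) = ex z ^+ n.
Proof. by rewrite mulr_natl exMn. Qed.

Lemma expR_sub1 (x : R) : `|x| <= 1/2 -> `|expR x - 1 - x| <= 2 * x ^+ 2.
Proof.
rewrite ler_norml => /andP[x1 x2].
have h1 := expR_ge1Dx x.
have h2 := expR_ge1Dx (- x).
have h3 := expRxMexpNx_1 x.
have h4 := expR_gt0 x.
rewrite ger0_norm; last lra.
have : expR x * (1 - x) <= 1.
  by rewrite -[leRHS]h3 ler_pM2l.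
nra.
Qed.

Lemma sin_le (y : R) : `|sin y - y| <= `|y| * (y ^+ 2 / 2) /\ 0 <= 1 - cos y <= y ^+ 2 / 2.
Proof.
have sin1 (t : R) : 0 <= t -> `|sin t| <= t.
  rewrite le_eqVlt => /predU1P[<-|t0]; first by rewrite sin0 normr0.
  have [|c _] := @MVT R sin cos 0 t t0 (fun x _ => is_derive_sin x).
  - by apply: continuous_subspaceT => x; exact: continuous_sin.
  rewrite sin0 !subr0 => ->; rewrite normrM (gtr0_norm t0).
  by have := cos_max c; nra.
have cos1 (t : R) : 0 <= 1 - cos t <= t ^+ 2 / 2.
  have : cos t = 1 - 2 * sin (t / 2) ^+ 2.
    have -> : cos t = cos ((t / 2) *+ 2) by congr cos; rewrite mulr2n; lra.
    rewrite cos_mulr2n mulr2n cos2sin2; ring.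
  have : sin (t / 2) ^+ 2 <= (t / 2) ^+ 2.
    rewrite -(real_normK (num_real (sin _))) -(real_normK (num_real (t / 2))).
    rewrite lerXn2r ?nnegrE//.
    wlog t0 : t / 0 <= t.
      move=> h; have [/h//|t0] := leP 0 t.
      have := h (- t); rewrite mulNr sinN !normrN; apply; lra.
    rewrite [leRHS]ger0_norm; last lra.
    by apply: sin1; lra.
  move=> h ->; have := sqr_ge0 (sin (t / 2)); lra.
split=> //.
wlog y0 : y / 0 <= y.
  move=> h; have [/h//|y0] := leP 0 y.
  by have := h (- y); rewrite sinN sqrrN normrN -opprD normrN; apply; lra.
move: y0; rewrite le_eqVlt => /predU1P[<-|t0].
  by rewrite sin0 subr0 normr0 mul0r.
have [|c c0] := @MVT R (fun t => sin t - t) (fun t => cos t - 1) 0 y t0 (fun x _ => is_deriveB (is_derive_sin x) (is_derive_id x 1)).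
  apply: continuous_subspaceT => x; apply: continuousB => //.
  exact: continuous_sin.
rewrite sin0 !subr0 => ->; rewrite normrM (gtr0_norm t0) mulrC ler_pM2l//.
have /andP[k1 k2] := cos1 c.
rewrite distrC ger0_norm//; apply: le_trans k2 _.
move: c0; rewrite in_itv/= => /andP[c0 c1]; nra.
Qed.

Lemma ex_sub1 (z : C) : cm z <= 1/2 -> cm (ex z - 1 - z) <= 8 * cm z ^+ 2.
Proof.
case: z => x y z1.
have hx := reE (x +i* y); have hy := imE (x +i* y); have hz := cm_sq (x +i* y).
rewrite [complex.Re _]/= [complex.Im _]/= in hx hy hz.
have x1 : `|x| <= 1/2 by lra.
have y1 : `|y| <= 1/2 by lra.
have /(_ x1) e1 := @expR_sub1 x.
have [s1 /andP[c1 c2]] := sin_le y.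
move: hz; set A : R := normc (x +i* y) => hz.
apply: le_trans (cm_le _) _.
rewrite /ex !reB !imD !imN /=.
have E3 : expR x <= 2.
  move: e1 x1; rewrite !ler_norml => /andP[_ a] /andP[b0 b]; nra.
have E0 := expR_gt0 x.
have F : `|expR x - 1| <= 2 * `|x|.
  have -> : expR x - 1 = (expR x - 1 - x) + x by ring.
  apply: le_trans (ler_normD _ _) _.
  have := normr_ge0 x.
  move: e1; rewrite -(real_normK (num_real x)); nra.
have -> : expR x * cos y - 1 - x = (expR x - 1 - x) - expR x * (1 - cos y) by ring.
have -> : expR x * sin y - 0 - y = expR x * (sin y - y) + (expR x - 1) * y by ring.
have := ler_normB (expR x - 1 - x) (expR x * (1 - cos y)).
have := ler_normD (expR x * (sin y - y)) ((expR x - 1) * y).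
rewrite !normrM (gtr0_norm E0) (ger0_norm c1).
have : expR x * (1 - cos y) <= y ^+ 2 by nra.
have : expR x * `|sin y - y| <= y ^+ 2.
  have : `|sin y - y| <= y ^+ 2 / 2.
    apply: le_trans s1 _; have := normr_ge0 y; have := sqr_ge0 y; nra.
  have := normr_ge0 (sin y - y); nra.
have : `|expR x - 1| * `|y| <= x ^+ 2 + y ^+ 2.
  rewrite -(real_normK (num_real x)) -(real_normK (num_real y)).
  apply: le_trans (ler_wpM2r (normr_ge0 y) F) _.
  have := sqr_ge0 (`|x| - `|y|); nra.
have := sqr_ge0 y; have := sqr_ge0 x; nra.
Qed.

Lemma nat_ge (x : R) : exists n, (0 < n)%N /\ x <= n%:R.
Proof.
exists (Num.bound `|x|).+1; split=> //.
apply: le_trans (ler_norm x) _; apply: (@le_trans _ _ (Num.bound `|x|)%:R).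
  by apply/ltW/archi_boundP.
by rewrite ler_nat.
Qed.

Lemma subX_le (a b : C) M n : cm a <= M -> cm b <= M ->
  cm (a ^+ n.+1 - b ^+ n.+1) <= n.+1%:R * M ^+ n * cm (a - b).
Proof.
move=> aM bM; have M0 : 0 <= M by apply: le_trans aM; exact: cm_ge0.
elim: n => [|n IH]; first by rewrite !expr1 expr0 !mul1r.
have -> : a ^+ n.+2 - b ^+ n.+2 = a * (a ^+ n.+1 - b ^+ n.+1) + (a - b) * b ^+ n.+1.
  by rewrite (exprS a n.+1) (exprS b n.+1); ring.
apply: le_trans (cmD _ _) _; rewrite !cmM cmX.
have h1 : cm b ^+ n.+1 <= M ^+ n.+1 by rewrite lerXn2r ?nnegrE ?cm_ge0.
have h2 := cm_ge0 (a - b); have h3 := cm_ge0 a.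
have h4 : cm a * cm (a ^+ n.+1 - b ^+ n.+1) <= M * (n.+1%:R * M ^+ n * cm (a - b)).
  by apply: ler_pM => //; exact: cm_ge0.
have h5 : cm (a - b) * cm b ^+ n.+1 <= cm (a - b) * M ^+ n.+1 by apply: ler_wpM2l.
apply: le_trans (lerD h4 h5) _; rewrite exprS -[n.+2]addn1 natrD.
by apply: le_refl_eq; ring.
Qed.

Lemma ex_poly (M : R) (e : R) : 0 < e -> exists m, (0 < m)%N /\
  forall z : C, cm z <= M -> cm (ex z - (1 + z / m%:R) ^+ m) <= e.
Proof.
move=> e0.
have [M0|M0] := ltP M 0.
  by exists 1%N; split=> // z zM; have := cm_ge0 z; lra.
set D := 2 * M + 8 * M ^+ 2 * expR M / e.
have [m [m0 Dm]] := nat_ge D; exists m; split=> // z zM.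
have mR : 0 < m%:R :> R by rewrite ltr0n.
have K0 : 0 <= 8 * M ^+ 2 * expR M / e.
  by apply: divr_ge0; [rewrite !mulr_ge0 ?sqr_ge0 ?expR_ge0|exact: ltW].
have cz : cm (z / m%:R) <= M / m%:R.
  by rewrite cmM cmV cm_nat ler_pM2r ?invr_gt0.
have Mm : M / m%:R <= 1 / 2.
  by rewrite ler_pdivrMr//; move: Dm; rewrite /D; lra.
have b1 : cm (1 + z / m%:R) <= expR (M / m%:R).
  apply: le_trans (cmD _ _) _; rewrite cm1.
  by apply: le_trans (expR_ge1Dx _); rewrite lerD2l.
have a1 : cm (ex (z / m%:R)) <= expR (M / m%:R).
  by rewrite cm_ex ler_expR; apply: le_trans cz; exact: re_le.
have -> : ex z = ex (z / m%:R) ^+ m.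
  rewrite -exX mulrC divfK// -(rmorph_nat (real_complex R)).
  by rewrite -cm_eq0 cm_real normr_nat gt_eqF.
case: m m0 mR K0 cz Mm b1 a1 Dm => // m _ mR K0 cz Mm b1 a1 Dm.
apply: le_trans (subX_le m a1 b1) _.
have h1 : cm (ex (z / m.+1%:R) - (1 + z / m.+1%:R)) <= 8 * (M / m.+1%:R) ^+ 2.
  rewrite opprD addrA; apply: le_trans (ex_sub1 _) _; first exact: le_trans cz _.
  by rewrite ler_pM2l// lerXn2r ?nnegrE ?cm_ge0// divr_ge0// ltW.
have h2 : expR (M / m.+1%:R) ^+ m <= expR M.
  rewrite -expRM_natl ler_expR mulrA ler_pdivrMr// [_ * M]mulrC.
  by rewrite ler_wpM2l// ler_nat.
have h3 : m.+1%:R * expR (M / m.+1%:R) ^+ m <= m.+1%:R * expR M.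
  by rewrite ler_pM2l.
apply: (@le_trans _ _ (m.+1%:R * expR M * (8 * (M / m.+1%:R) ^+ 2))).
  by apply: ler_pM => //; rewrite ?cm_ge0// mulr_ge0 ?exprn_ge0 ?expR_ge0// ltW.
have -> : m.+1%:R * expR M * (8 * (M / m.+1%:R) ^+ 2) =
   (8 * M ^+ 2 * expR M) / m.+1%:R.
  by field; rewrite gt_eqF.
rewrite ler_pdivrMr// [e * _]mulrC -ler_pdivrMr//.
by move: Dm; rewrite /D; lra.
Qed.

(** * Strict differentiability *)

(* Unlike [derivable], this controls increments between two nearby points, which
   is what the discrete form of Cauchy's theorem and the inversion of an
   injective function need. *)
Definition SD (h : C -> C) (z d : C) := forall e : R, 0 < e ->
  exists r, 0 < r /\ forall a b, cm (a - z) <= r -> cm (b - z) <= r ->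
    cm (h a - h b - d * (a - b)) <= e * cm (a - b).

Lemma SD_ext h h' z d r : 0 < r -> (forall a, cm (a - z) <= r -> h a = h' a) ->
  SD h z d -> SD h' z d.
Proof.
move=> r0 hh' sh e e0; have [s [s0 hs]] := sh e e0.
exists (Num.min r s); split; first by rewrite lt_min r0.
by move=> a b; rewrite !le_min => /andP[a1 a2] /andP[b1 b2]; rewrite -!hh'// hs.
Qed.

Lemma SD_cont h z d : SD h z d -> forall e : R, 0 < e ->
  exists r, 0 < r /\ forall a, cm (a - z) <= r -> cm (h a - h z) <= e.
Proof.
move=> sh e e0; have [r [r0 hr]] := sh 1 ltr01.
set D := 1 + cm d; have D0 : 0 < D by have := cm_ge0 d; rewrite /D; lra.
exists (Num.min r (e / D)); split; first by rewrite lt_min r0 divr_gt0.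
move=> a; rewrite le_min => /andP[a1 a2].
have := hr a z a1; rewrite subrr cm0 => /(_ (ltW r0)).
have := cm_lB (h a - h z) (d * (a - z)); rewrite cmM.
move: a2; rewrite ler_pdivlMr// /D; lra.
Qed.

Lemma SD_lip h z d : SD h z d ->
  exists r, 0 < r /\ forall a b, cm (a - z) <= r -> cm (b - z) <= r ->
     cm (h a - h b) <= (1 + cm d) * cm (a - b).
Proof.
move=> sh; have [r [r0 hr]] := sh 1 ltr01; exists r; split=> // a b ha hb.
have := hr a b ha hb; have := cm_lB (h a - h b) (d * (a - b)); rewrite cmM; lra.
Qed.

Lemma SD_cst c z : SD (fun=> c) z 0.
Proof.
move=> e e0; exists 1; split=> // a b _ _.
by rewrite subrr mul0r subrr cm0 mulr_ge0 ?cm_ge0// ltW.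
Qed.

Lemma SD_id z : SD id z 1.
Proof.
move=> e e0; exists 1; split=> // a b _ _.
by rewrite mul1r subrr cm0 mulr_ge0 ?cm_ge0// ltW.
Qed.

Lemma SD_add h1 h2 z d1 d2 : SD h1 z d1 -> SD h2 z d2 ->
  SD (fun s => h1 s + h2 s) z (d1 + d2).
Proof.
move=> s1 s2 e e0; have e20 : 0 < e / 2 by lra.
have [r [r0 hr]] := s1 _ e20; have [s [s0 hs]] := s2 _ e20.
exists (Num.min r s); split; first by rewrite lt_min r0.
move=> a b; rewrite !le_min => /andP[a1 a2] /andP[b1 b2].
have -> : h1 a + h2 a - (h1 b + h2 b) - (d1 + d2) * (a - b) =
  (h1 a - h1 b - d1 * (a - b)) + (h2 a - h2 b - d2 * (a - b)) by ring.
apply: le_trans (cmD _ _) _.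
have := hr a b a1 b1; have := hs a b a2 b2; lra.
Qed.

Lemma SD_comp f g z d1 d2 : SD g z d2 -> SD f (g z) d1 ->
  SD (fun s => f (g s)) z (d1 * d2).
Proof.
move=> sg sf e e0.
have [l [l0 hl]] := SD_lip sg.
set K1 := 1 + cm d2 + cm d1.
have K0 : 0 < K1 by have := cm_ge0 d1; have := cm_ge0 d2; rewrite /K1; lra.
have e10 : 0 < e / (2 * K1) by rewrite divr_gt0// mulr_gt0.
have [r [r0 hr]] := sf _ e10; have [s [s0 hs]] := sg _ e10.
have [t [t0 ht]] := SD_cont sg r0.
exists (Num.min l (Num.min s t)); split; first by rewrite !lt_min l0 s0.
move=> a b; rewrite !le_min => /and3P[a1 a2 a3] /and3P[b1 b2 b3].
have -> : f (g a) - f (g b) - d1 * d2 * (a - b) =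
  (f (g a) - f (g b) - d1 * (g a - g b)) + d1 * (g a - g b - d2 * (a - b)) by ring.
apply: le_trans (cmD _ _) _; rewrite cmM.
have h1 := hr (g a) (g b) (ht _ a3) (ht _ b3).
have h2 := hl a b a1 b1; have h3 := hs a b a2 b2.
have h4 : cm d1 * cm (g a - g b - d2 * (a - b)) <= cm d1 * (e / (2 * K1) * cm (a - b)).
  by rewrite ler_wpM2l ?cm_ge0.
have h5 : e / (2 * K1) * cm (g a - g b) <= e / (2 * K1) * ((1 + cm d2) * cm (a - b)).
  by rewrite ler_wpM2l// ltW.
apply: le_trans (lerD (le_trans h1 h5) h4) _.
have -> : e / (2 * K1) * ((1 + cm d2) * cm (a - b)) +
  cm d1 * (e / (2 * K1) * cm (a - b)) = e / 2 * cm (a - b).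
  by rewrite /K1; field; rewrite -/K1 gt_eqF.
by rewrite ler_wpM2r ?cm_ge0//; lra.
Qed.

Lemma SD_mul h1 h2 z d1 d2 : SD h1 z d1 -> SD h2 z d2 ->
  SD (fun s => h1 s * h2 s) z (d1 * h2 z + h1 z * d2).
Proof.
move=> s1 s2 e e0.
set K1 := 2 + cm (h1 z) + cm (h2 z) + cm d1 + cm d2.
have c1 := cm_ge0 (h1 z); have c2 := cm_ge0 (h2 z).
have c3 := cm_ge0 d1; have c4 := cm_ge0 d2.
have K0 : 0 < K1 by rewrite /K1; lra.
set e1 := Num.min 1 (e / (2 * K1)).
have e10 : 0 < e1 by rewrite lt_min ltr01 divr_gt0// mulr_gt0.
have e1l : e1 <= 1 by rewrite ge_min lexx.
have e1e : e1 * (2 * K1) <= e by rewrite -ler_pdivlMr ?mulr_gt0// ge_min lexx orbT.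
have [r [r0 hr]] := s1 _ e10; have [s [s0 hs]] := s2 _ e10.
have [t [t0 ht]] := SD_cont s1 e10; have [p [p0 hp]] := SD_cont s2 e10.
exists (Num.min (Num.min r s) (Num.min t p)); split; first by rewrite !lt_min r0 s0 t0.
move=> a b; rewrite !le_min.
move=> /andP[/andP[a1 a2] /andP[a3 a4]] /andP[/andP[b1 b2] /andP[b3 b4]].
have -> : h1 a * h2 a - h1 b * h2 b - (d1 * h2 z + h1 z * d2) * (a - b) =
  (h1 a - h1 b - d1 * (a - b)) * h2 a + d1 * (a - b) * (h2 a - h2 z) +
  (h1 b * (h2 a - h2 b - d2 * (a - b)) + (h1 b - h1 z) * (d2 * (a - b))) by ring.
apply: le_trans (cmD _ _) _.
apply: le_trans (lerD (cmD _ _) (cmD _ _)) _; rewrite !cmM.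
have k1 := hr a b a1 b1; have k2 := hs a b a2 b2.
have k3 := hp a a4; have k4 := ht b b3.
have k5 : cm (h2 a) <= cm (h2 z) + 1 by have := cm_lB (h2 a) (h2 z); lra.
have k6 : cm (h1 b) <= cm (h1 z) + 1 by have := cm_lB (h1 b) (h1 z); lra.
set D := cm (a - b) in k1 k2 *.
have D0 : 0 <= D := cm_ge0 _.
have l1 : cm (h1 a - h1 b - d1 * (a - b)) * cm (h2 a) <= e1 * D * (cm (h2 z) + 1).
  by apply: ler_pM; rewrite ?cm_ge0.
have l2 : cm d1 * D * cm (h2 a - h2 z) <= cm d1 * D * e1.
  by apply: ler_wpM2l => //; rewrite mulr_ge0.
have l3 : cm (h1 b) * cm (h2 a - h2 b - d2 * (a - b)) <= (cm (h1 z) + 1) * (e1 * D).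
  by apply: ler_pM; rewrite ?cm_ge0.
have l4 : cm (h1 b - h1 z) * (cm d2 * D) <= e1 * (cm d2 * D).
  by apply: ler_wpM2r => //; rewrite mulr_ge0.
apply: le_trans (lerD (lerD l1 l2) (lerD l3 l4)) _.
have -> : e1 * D * (cm (h2 z) + 1) + cm d1 * D * e1 +
   ((cm (h1 z) + 1) * (e1 * D) + e1 * (cm d2 * D)) = (e1 * K1) * D.
  by rewrite /K1; ring.
apply: ler_wpM2r => //; have : 0 <= e1 * K1 by rewrite mulr_ge0// ltW.
by move: e1e; lra.
Qed.

Lemma SD_scal c h z d : SD h z d -> SD (fun s => c * h s) z (c * d).
Proof.
by move=> /(SD_mul (SD_cst c z)); rewrite mul0r add0r.
Qed.

Lemma SD_opp h z d : SD h z d -> SD (fun s => - h s) z (- d).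
Proof.
move=> sh; have := SD_scal (-1) sh; rewrite mulN1r.
by apply: (SD_ext (r := 1)) => // a _; rewrite mulN1r.
Qed.

Lemma SD_sum n (F : nat -> C -> C) z : (forall k, exists d, SD (F k) z d) ->
  exists d, SD (fun s => \sum_(k < n) F k s) z d.
Proof.
move=> h; elim: n => [|n [d hd]].
  exists 0; apply: SD_ext ltr01 _ (SD_cst 0 z) => a _; by rewrite big_ord0.
have [d' hd'] := h n; exists (d + d').
by apply: SD_ext ltr01 _ (SD_add hd hd') => a _; rewrite big_ord_recr.
Qed.

Lemma SD_ex z : SD ex z (ex z).
Proof.
suff h0 : SD ex 0 1.
  have -> : ex z = ex z * (1 * 1) by rewrite !mulr1.
  apply: SD_ext ltr01 _ (SD_scal (ex z) (SD_comp (g := fun s => s - z) (f := ex)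
     (d1 := 1) (d2 := 1) _ _)).
  - by move=> a _; rewrite -exD addrC subrK.
  - by have := SD_add (SD_id z) (SD_cst (- z) z); rewrite addr0.
  - by rewrite subrr.
move=> e e0; set r := Num.min (1/8) (e / 48).
have r0 : 0 < r by rewrite lt_min; apply/andP; split; lra.
have rl : r <= 1/8 by rewrite ge_min lexx.
have re : r * 48 <= e by rewrite -ler_pdivlMr// ge_min lexx orbT.
exists r; split=> // a b; rewrite !subr0 mul1r => ar br.
have ab : cm (a - b) <= 2 * r by apply: le_trans (cmB _ _) _; lra.
have b2 : cm (ex b) <= 2.
  have := @ex_sub1 b; have : cm b <= 1/2 by lra.
  move=> h1 /(_ h1) h2; have := cm_lB (ex b - 1) b; have := cm_lB (ex b) 1.
  rewrite cm1; have := cm_ge0 b; nra.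
have b1 : cm (ex b - 1) <= 2 * r.
  have := @ex_sub1 b; have : cm b <= 1/2 by lra.
  move=> h1 /(_ h1) h2; have := cm_lB (ex b - 1) b.
  have := cm_ge0 b; nra.
have -> : ex a - ex b - (a - b) =
   ex b * (ex (a - b) - 1 - (a - b)) + (ex b - 1) * (a - b).
  by rewrite -{1}(subrK b a) exD; ring.
apply: le_trans (cmD _ _) _; rewrite !cmM.
have h := @ex_sub1 (a - b); have {h} : cm (ex (a - b) - 1 - (a - b)) <= 8 * cm (a - b) ^+ 2.
  by apply: h; lra.
set D := cm (a - b) in ab *; set E := cm (ex (a - b) - 1 - (a - b)) => h.
have D0 : 0 <= D := cm_ge0 _; have E0 : 0 <= E := cm_ge0 _.
have : cm (ex b) * E <= 2 * (8 * D ^+ 2) by apply: ler_pM; rewrite ?cm_ge0.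
have : cm (ex b - 1) * D <= 2 * r * D by apply: ler_wpM2r.
nra.
Qed.

End ComplexBasics.

(** * Mean values along vertical lines *)

Section NullMeans.
Context {R : realType}.
Local Notation C := R[i].

Lemma rect_uniform (x0 x1 y0 y1 : R) (Q : R -> C -> Prop) :
  (forall r r' z, r' <= r -> Q r z -> Q r' z) ->
  (forall x y, x0 <= x <= x1 -> y0 <= y <= y1 ->
     exists r, 0 < r /\ forall z, cm (z - x +i* y) <= r -> Q r z) ->
  exists r, 0 < r /\ forall x y, x0 <= x <= x1 -> y0 <= y <= y1 -> Q r (x +i* y).
Proof.
move=> mQ lQ.
have := compact_setX (@segment_compact R x0 x1) (@segment_compact R y0 y1).
move=> /compact_near_coveringP/(_ R (0^'+)
  (fun r xy => Q r (xy.1 +i* xy.2)) _) [|r /= r0 hr].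
  move=> [x y] /= [xi yi]; rewrite !in_itv/= in xi yi.
  have [r [r0 hr]] := lQ x y xi yi.
  have r20 : 0 < r / 2 by lra.
  exists ([set u | `|x - u.1| < r / 2 /\ `|y - u.2| < r / 2],
          [set t | t <= r]).
    split => /=; last exact: nbhs_right_le.
    exists ([set u | `|x - u| < r / 2], [set u | `|y - u| < r / 2]) => //=.
    by split; apply/nbhs_ballP; exists (r / 2).
  move=> [[a b] t] /= [[h1 h2] tr]; apply: (mQ r) => //; apply: hr.
  apply: le_trans (cm_le _) _; rewrite reB imD imN /=.
  rewrite distrC in h1; rewrite distrC in h2; lra.
exists (r / 2); split; first lra.
move=> x y xi yi; apply: (hr (r / 2) _ _ (x, y)) => /=.
- by rewrite sub0r normrN gtr0_norm; lra.
- lra.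
- by split; rewrite /= in_itv.
Qed.

Definition avg (h : C -> C) (x T : R) (J : nat) : C :=
  (J%:R)^-1 * \sum_(j < J) h (x +i* (T / J%:R * j%:R)).

Definition null (x : R) (h : C -> C) := forall e : R, 0 < e ->
  exists T0 : R, forall T, T0 <= T -> exists J0, forall J, (J0 <= J)%N ->
    (0 < J)%N -> cm (avg h x T J) <= e.

Lemma avgD h1 h2 x T J :
  avg (fun s => h1 s + h2 s) x T J = avg h1 x T J + avg h2 x T J.
Proof. by rewrite /avg big_split mulrDr. Qed.

Lemma avgZ c h x T J : avg (fun s => c * h s) x T J = c * avg h x T J.
Proof. by rewrite /avg -mulr_sumr mulrCA. Qed.

Lemma null_ext x h h' : (forall s, re s = x -> h s = h' s) -> null x h -> null x h'.
Proof.
move=> hh nh e e0; have [T0 hT] := nh e e0; exists T0 => T TT.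
have [J0 hJ] := hT T TT; exists J0 => J JJ J1.
suff -> : avg h' x T J = avg h x T J by exact: hJ.
by rewrite /avg; congr (_ * _); apply: eq_bigr => j _; rewrite hh.
Qed.

Lemma null_add x h1 h2 : null x h1 -> null x h2 -> null x (fun s => h1 s + h2 s).
Proof.
move=> n1 n2 e e0; have e20 : 0 < e / 2 by lra.
have [T1 hT1] := n1 _ e20; have [T2 hT2] := n2 _ e20.
exists (Num.max T1 T2) => T; rewrite ge_max => /andP[/hT1[J1 hJ1] /hT2[J2 hJ2]].
exists (maxn J1 J2) => J; rewrite geq_max => /andP[j1 j2] J0.
rewrite avgD; apply: le_trans (cmD _ _) _.
have := hJ1 J j1 J0; have := hJ2 J j2 J0; lra.
Qed.

Lemma null_0 x : null x (fun=> 0).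
Proof.
move=> e e0; exists 0 => T _; exists 0%N => J _ _.
by rewrite /avg big1// mulr0 cm0 ltW.
Qed.

Lemma null_scal x c h : null x h -> null x (fun s => c * h s).
Proof.
move=> nh e e0; have c0 := cm_ge0 c.
have K0 : 0 < 1 + cm c by lra.
have [T0 hT] := nh (e / (1 + cm c)) (divr_gt0 e0 K0); exists T0 => T TT.
have [J0 hJ] := hT T TT; exists J0 => J JJ J1; rewrite avgZ cmM.
have := hJ J JJ J1; rewrite ler_pdivlMr// => h1.
have := cm_ge0 (avg h x T J); nra.
Qed.

Lemma null_sum x n (F : nat -> C -> C) : (forall k, (k < n)%N -> null x (F k)) ->
  null x (fun s => \sum_(k < n) F k s).
Proof.
elim: n => [|n IH] h.
  by apply: null_ext (null_0 x) => s _; rewrite big_ord0.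
apply: (@null_ext x (fun s => \sum_(k < n) F k s + F n s)).
  by move=> s _; rewrite big_ord_recr.
by apply: null_add; [apply: IH => k kn; apply: h; rewrite ltnS ltnW|exact: h].
Qed.

Lemma null_ineq x (A B : R) q : null x q ->
  (forall s, re s = x -> B <= A + re (q s)) -> B <= A.
Proof.
move=> nq h; apply: le_eps => e e0.
have [T0 hT] := nq e e0; have [J0 hJ] := hT T0 (lexx _).
have := hJ J0.+1 (leqnSn _) isT; set J := J0.+1 => h1.
have J1 : 0 < J%:R :> R by rewrite ltr0n.
suff : B <= A + re (avg q x T0 J) by have := re_le (avg q x T0 J); lra.
rewrite /avg -(rmorph_nat (real_complex R)) -fmorphV reMr re_sum.
rewrite -(ler_pM2l J1) mulrDr mulVKf ?gt_eqF//.
have -> : J%:R * B = \sum_(j < J) B by rewrite sumr_const card_ord mulr_natl.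
have -> : J%:R * A = \sum_(j < J) A by rewrite sumr_const card_ord mulr_natl.
by rewrite -big_split; apply: ler_sum => j _; apply: h.
Qed.

(* The discrete Cauchy-Riemann estimate at scale [p]. *)
Let CR (h : C -> C) (e r : R) (z : C) := forall p, 0 < p -> p <= r ->
  cm (h (z + p%:C) - h z + 'i * (h (z + 'i * p%:C) - h z)) <= e * p.

Let SD_CR h z d (e : R) : SD h z d -> 0 < e ->
  exists r, 0 < r /\ forall z', cm (z' - z) <= r -> CR h e r z'.
Proof.
move=> sh e0; have e20 : 0 < e / 2 by lra.
have [r [r0 hr]] := sh _ e20; exists (r / 2); split; first lra.
move=> z' hz p p0 pr.
have cp : cm p%:C = p by rewrite cm_real gtr0_norm.
have ci : cm ('i : C) = 1 by rewrite /= expr0n/= expr1n add0r sqrtr1.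
have near w : cm w = p -> cm (z' + w - z) <= r.
  by move=> wp; rewrite addrAC; apply: le_trans (cmD _ _) _; rewrite wp; lra.
have hz' : cm (z' - z) <= r by lra.
have h1 := hr _ _ (near _ cp) hz'.
have cip : cm ('i * p%:C) = p by rewrite cmM ci mul1r.
have h2 := hr _ _ (near _ cip) hz'.
rewrite [z' + p%:C]addrC addrK in h1; rewrite [z' + 'i * _]addrC addrK in h2.
rewrite cp in h1; rewrite cip in h2.
rewrite [z' + p%:C]addrC [z' + _ * _]addrC.
have ii : 'i * 'i = -1 :> C by rewrite -expr2 sqr_i.
have -> : h (p%:C + z') - h z' + 'i * (h ('i * p%:C + z') - h z') =
  (h (p%:C + z') - h z' - d * p%:C) + 'i * (h ('i * p%:C + z') - h z' - d * ('i * p%:C))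
  + (1 + 'i * 'i) * (d * p%:C) by ring.
rewrite ii subrr mul0r addr0.
apply: le_trans (cmD _ _) _; rewrite cmM ci mul1r; lra.
Qed.

Let CR_avg h x T J e M : (0 < J)%N -> 0 < T ->
  (forall y, 0 <= y <= T -> CR h e (T / J%:R) (x +i* y) /\ cm (h (x +i* y)) <= M) ->
  cm (avg h (x + T / J%:R) T J - avg h x T J) <= T / J%:R * (e + 2 * M / T).
Proof.
move=> J0 T0 H; set p := T / J%:R.
have JR : 0 < J%:R :> R by rewrite ltr0n.
have p0 : 0 < p by rewrite divr_gt0.
have pJ : p * J%:R = T by rewrite /p divfK ?gt_eqF.
pose z j : C := x +i* (p * j%:R).
have yj j : (j <= J)%N -> 0 <= p * j%:R <= T.
  move=> jJ; apply/andP; split; first by apply: mulr_ge0 => //; exact: ltW.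
  by rewrite -[leRHS]pJ ler_pM2l// ler_nat.
have zp j : (x + p) +i* (p * j%:R) = z j + p%:C.
  by apply: complex_ext; rewrite /= ?addr0.
have zi j : z j.+1 = z j + 'i * p%:C.
  apply: complex_ext; rewrite /= -?natr1; ring.
rewrite /avg -/p -mulrBr -sumrB cmM cmV cm_nat.
have -> : \sum_(j < J) (h ((x + p) +i* (p * j%:R)) - h (x +i* (p * j%:R))) =
  \sum_(j < J) (h (z j + p%:C) - h (z j) + 'i * (h (z j + 'i * p%:C) - h (z j)))
  - 'i * (h (z J) - h (z 0%N)).
  rewrite [in RHS]big_split/= -mulr_sumr.
  have -> : \sum_(j < J) (h (z j + 'i * p%:C) - h (z j)) = h (z J) - h (z 0%N).
    elim: (J) => [|n IH]; first by rewrite big_ord0 subrr.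
    by rewrite big_ord_recr/= IH -zi; ring.
  by rewrite addrK; apply: eq_bigr => j _; rewrite zp.
have ci : cm ('i : C) = 1 by rewrite /= expr0n/= expr1n add0r sqrtr1.
have k1 : cm ('i * (h (z J) - h (z 0%N))) <= 2 * M.
  rewrite cmM ci mul1r; apply: le_trans (cmB _ _) _.
  have := (H _ (yj J (leqnn _))).2; have := (H _ (yj 0%N (leq0n _))).2.
  rewrite -/(z _); rewrite /z; lra.
have k2 : cm (\sum_(j < J) (h (z j + p%:C) - h (z j) +
    'i * (h (z j + 'i * p%:C) - h (z j)))) <= J%:R * (e * p).
  apply: le_trans (cm_sum _ _ _) _.
  apply: (@le_trans _ _ (\sum_(j < J) (e * p))).
    by apply: ler_sum => j _; apply: (H _ (yj j (ltnW (ltn_ord j)))).1.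
  by rewrite sumr_const card_ord mulr_natl.
rewrite ler_pdivrMl//; apply: le_trans (cmB _ _) _.
apply: le_trans (lerD k2 k1) _.
apply: le_refl_eq.
have -> : J%:R * (p * (e + 2 * M / T)) = (p * J%:R) * (e + 2 * M / T) by ring.
have -> : J%:R * (e * p) = (p * J%:R) * e by ring.
rewrite pJ mulrDr; congr (_ + _).
by field; rewrite gt_eqF.
Qed.

Lemma ex_multiple (L p : R) : 0 <= L -> 0 < p -> exists I, L <= I%:R * p <= L + p.
Proof.
move=> L0 p0; exists (Num.truncn (L / p)).+1.
have /andP[h1 h2] : (Num.truncn (L / p))%:R <= L / p < (Num.truncn (L / p)).+1%:R.
  by apply: truncn_itv; rewrite divr_ge0// ltW.
apply/andP; split; first by rewrite -ler_pdivrMr// ltW.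
by rewrite -natr1 mulrDl mul1r lerD2r -ler_pdivlMr.
Qed.

(* Cauchy's theorem for a rectangle, on a grid: moving the line of averaging to
   the right changes the mean by O(1/T), and the function is small there. *)
Lemma null_decay (x0 x : R) h : x0 < x ->
  (forall s, x0 < re s -> exists d, SD h s d) ->
  (forall X, exists M, forall s, x <= re s <= X -> cm (h s) <= M) ->
  (forall e, 0 < e -> exists X, forall s, X <= re s -> cm (h s) <= e) ->
  null x h.
Proof.
move=> x0x sh bh dh e e0.
have e30 : 0 < e / 3 by lra.
have [X' hX'] := dh _ e30.
pose X := Num.max X' x.
have hX s : X <= re s -> cm (h s) <= e / 3.
  by move=> Xs; apply: hX'; apply: le_trans Xs; rewrite le_max lexx.
have xX : x <= X by rewrite le_max lexx orbT.
have [M' hM'] := bh (X + 1).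
pose M := Num.max M' 0.
have M0 : 0 <= M by rewrite le_max lexx orbT.
have hM s : x <= re s <= X + 1 -> cm (h s) <= M.
  by move=> /hM' k; apply: le_trans k _; rewrite le_max lexx.
pose L1 := X - x + 1.
have L10 : 0 < L1 by rewrite /L1; lra.
exists (6 * M * L1 / e + 1) => T hT.
have T0 : 0 < T.
  apply: lt_le_trans hT; have : 0 <= 6 * M * L1 / e.
    by apply: divr_ge0; rewrite ?mulr_ge0// ltW.
  lra.
have MT : L1 * (2 * M / T) <= e / 3.
  rewrite mulrA ler_pdivrMr//.
  have : 6 * M * L1 / e <= T by lra.
  by rewrite ler_pdivrMr//; lra.
pose e1 := e / (3 * L1).
have e10 : 0 < e1 by rewrite divr_gt0// mulr_gt0.
have [||r [r0 hr]] := @rect_uniform x (X + 1) 0 T (CR h e1).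
- by move=> r r' z rr hz p p0 pr; apply: hz => //; exact: le_trans rr.
- move=> a b /andP[a1 a2] _.
  have [|d hd] := sh (a +i* b); first exact: lt_le_trans a1.
  exact: SD_CR hd e10.
pose m := Num.min r 1.
have m0 : 0 < m by rewrite lt_min r0 ltr01.
have [J0 [J00 hJ0]] := nat_ge (T / m).
exists J0 => J JJ Jp.
have JR : 0 < J%:R :> R by rewrite ltr0n.
pose p := T / J%:R; have p0 : 0 < p by rewrite divr_gt0.
have pm : p <= m.
  rewrite /p ler_pdivrMr// mulrC -ler_pdivrMr//.
  by apply: le_trans hJ0 _; rewrite ler_nat.
move: pm; rewrite le_min => /andP[pr p1].
have [I /andP[I1 I2]] := ex_multiple (L := X - x) (p := p) ltac:(lra) p0.
have step i : (i <= I)%N ->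
   cm (avg h (x + i%:R * p) T J - avg h x T J) <= i%:R * (p * (e1 + 2 * M / T)).
  elim: i => [_|i IH iI]; first by rewrite mul0r addr0 subrr cm0 mul0r.
  apply: le_trans (cm_triB _ (avg h (x + i%:R * p) T J) _) _.
  rewrite -natr1 mulrDl mul1r addrA.
  rewrite [leRHS]mulrDl mul1r [leRHS]addrC; apply: lerD; last by apply: IH; rewrite ltnW.
  apply: CR_avg => // y y1.
  have ip : i%:R * p + p <= X - x + p.
    by apply: le_trans I2; rewrite -[X in _ + X]mul1r -mulrDl natr1 ler_pM2r// ler_nat.
  have ip0 : 0 <= i%:R * p by rewrite mulr_ge0// ltW.
  split; last by apply: hM; rewrite /=; lra.
  move=> q q0 qp; apply: (hr (x + i%:R * p) y) => //; first lra.
  exact: le_trans pr.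
have := step I (leqnn _); have := cm_lB (avg h x T J) (avg h (x + I%:R * p) T J).
rewrite [cm (_ - _)]cmBC.
have far : cm (avg h (x + I%:R * p) T J) <= e / 3.
  rewrite /avg cmM cmV cm_nat ler_pdivrMl//.
  apply: le_trans (cm_sum _ _ _) _.
  apply: (@le_trans _ _ (\sum_(j < J) (e / 3))).
    by apply: ler_sum => j _; apply: hX; rewrite /=; lra.
  by rewrite sumr_const card_ord mulr_natl.
have k : I%:R * (p * (e1 + 2 * M / T)) <= e / 3 + e / 3.
  rewrite mulrA; apply: (@le_trans _ _ (L1 * (e1 + 2 * M / T))).
    apply: ler_wpM2r; last by rewrite /L1; lra.
    apply: addr_ge0; first exact: ltW.
    by apply: divr_ge0; [exact: mulr_ge0|exact: ltW].
  rewrite mulrDr; apply: lerD => //; rewrite /e1.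
  by apply: le_refl_eq; field; rewrite gt_eqF.
lra.
Qed.

End NullMeans.

(** * Bessel's inequality for general exponential series *)

Section Bessel.
Context {R : realType}.
Local Notation C := R[i].

Definition bstrip (x : R) (f : C -> C) :=
  forall X, exists M, forall s, x <= re s <= X -> cm (f s) <= M.

Lemma bstrip_add x f g : bstrip x f -> bstrip x g -> bstrip x (fun s => f s + g s).
Proof.
move=> bf bg X; have [M hM] := bf X; have [N hN] := bg X; exists (M + N) => s sX.
by apply: le_trans (cmD _ _) _; apply: lerD; [exact: hM|exact: hN].
Qed.

Lemma bstrip_mul x f g : bstrip x f -> bstrip x g -> bstrip x (fun s => f s * g s).
Proof.
move=> bf bg X; have [M hM] := bf X; have [N hN] := bg X; exists (M * N) => s sX.
by rewrite cmM; apply: ler_pM; rewrite ?cm_ge0//; [exact: hM|exact: hN].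
Qed.

Lemma bstrip_cst x c : bstrip x (fun=> c).
Proof. by move=> X; exists (cm c). Qed.

Lemma bstrip_ex x (l : R) : bstrip x (fun s => ex (l%:C * s)).
Proof.
move=> X; exists (expR (`|l| * (`|x| + `|X|))) => s /andP[h1 h2].
rewrite cm_ex reMr ler_expR; apply: le_trans (ler_norm _) _.
rewrite normrM ler_wpM2l// ler_norml.
have := ler_norm X; have := lerNnormlW (lexx (`|x|)).
have := normr_ge0 x; have := normr_ge0 X; lra.
Qed.

Lemma bstrip_sum x n (F : nat -> C -> C) : (forall k, bstrip x (F k)) ->
  bstrip x (fun s => \sum_(k < n) F k s).
Proof.
move=> h; elim: n => [|n IH] X.
  by exists 0 => s _; rewrite big_ord0 cm0.
have [M hM] := bstrip_add IH (h n) X; exists M => s /hM.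
by rewrite big_ord_recr.
Qed.

Lemma expR_small (d e : R) : 0 < d -> 0 < e ->
  exists X, forall x, X <= x -> expR (- (d * x)) <= e.
Proof.
move=> d0 e0; exists (e^-1 / d) => x; rewrite ler_pdivrMr// => hx.
rewrite expRN -[leRHS]invrK lef_pV2 ?posrE ?expR_gt0 ?invr_gt0//.
have := expR_ge1Dx (d * x); lra.
Qed.

Variable lam : nat -> R.
Hypothesis lam_incr : forall j k, (j < k)%N -> lam j < lam k.

Definition ebase k (s : C) : C := ex (- ((lam k)%:C * s)).

Lemma cm_ebase k s : cm (ebase k s) = expR (- (lam k * re s)).
Proof. by rewrite /ebase cm_ex reN reMr. Qed.

Lemma SD_linear (l c z : C) : SD (fun s => l * s + c) z l.
Proof.
have := SD_add (SD_scal l (SD_id z)) (SD_cst c z).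
by rewrite mulr1 addr0.
Qed.

Lemma SD_exl (l z : C) : exists d, SD (fun s => ex (l * s)) z d.
Proof.
exists (ex (l * z) * l).
apply: (@SD_ext _ (fun s => ex (l * s + 0)) _ _ _ 1) => //.
  by move=> a _; rewrite addr0.
apply: (SD_comp (g := fun s => l * s + 0)); first exact: SD_linear.
by rewrite addr0; exact: SD_ex.
Qed.

Lemma SD_ebase k z : exists d, SD (ebase k) z d.
Proof.
have [d hd] := SD_exl (- (lam k)%:C) z; exists d.
by apply: SD_ext ltr01 _ hd => a _; rewrite /ebase mulNr.
Qed.

Lemma SD_epol (p : nat -> C) n z : exists d, SD (fun s => \sum_(k < n) p k * ebase k s) z d.
Proof.
apply: (SD_sum n (F := fun k s => p k * ebase k s)) => k.
by have [d hd] := SD_ebase k z; exists (p k * d); apply: SD_scal.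
Qed.

Let bessel_id (h : C) (y : nat -> C) K :
  cm (h - \sum_(k < K) y k) ^+ 2 = cm h ^+ 2 -
    \sum_(k < K) (cm (y k) ^+ 2 + 2 * re (conjc (y k) * (h - \sum_(j < k.+1) y j))).
Proof.
elim: K => [|K IH]; first by rewrite !big_ord0 !subr0.
rewrite [in RHS]big_ord_recr/= opprD addrA -IH big_ord_recr/=.
have -> : h - (\sum_(i < K) y i + y K) = (h - \sum_(i < K) y i) - y K by ring.
rewrite !cm_sq; case: (h - _) => a b; case: (y K) => c d /=; ring.
Qed.

Lemma bessel (x0 x : R) (h : C -> C) (g : nat -> C) K (A : R) (q : C -> C) : x0 < x ->
  (forall s, x0 < re s -> exists d, SD h s d) ->
  (exists M, forall s, x <= re s -> cm (h s) <= M) ->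
  (forall k, (k < K)%N -> forall e, 0 < e -> exists X, forall s, X <= re s ->
     cm (h s - \sum_(j < k.+1) g j * ebase j s) <= e * expR (- (lam k * re s))) ->
  null x q -> (forall s, re s = x -> cm (h s) ^+ 2 <= A + re (q s)) ->
  \sum_(k < K) cm (g k) ^+ 2 * expR (- (2 * lam k * x)) <= A.
Proof.
move=> x0x sh [M hM] dh nq hq.
pose r k (s : C) := ex ((lam k)%:C * s) * (h s - \sum_(j < k.+1) g j * ebase j s).
have nr k : (k < K)%N -> null x (r k).
  move=> kK; apply: (null_decay x0x).
  - move=> s /sh[d hd]; have [d1 h1] := SD_exl (lam k)%:C s.
    have [d2 h2] := SD_epol g k.+1 s.
    eexists; apply: SD_mul h1 _; apply: SD_add hd _; exact: SD_opp h2.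
  - apply: bstrip_mul; first exact: bstrip_ex.
    apply: bstrip_add; first by move=> X; exists M => s /andP[xs _]; exact: hM.
    move=> X; have [] := @bstrip_sum x k.+1 (fun j s => g j * ebase j s) _ X.
      move=> j; apply: bstrip_mul; first exact: bstrip_cst.
      move=> Y; have [N hN] := bstrip_ex x (- lam j) Y; exists N => s /hN.
      by rewrite /ebase rmorphN mulNr.
    by move=> N hN; exists N => s /hN; rewrite cmN.
  - move=> e e0; have [X hX] := dh k kK e e0; exists X => s /hX.
    rewrite /r cmM cm_ex reMr => h1.
    apply: le_trans (ler_wpM2l (expR_ge0 _) h1) _.
    by rewrite mulrCA expRxMexpNx_1 mulr1.
pose w k : C := (-2 * expR (- (2 * lam k * x)))%:C * conjc (g k).
have nq' : null x (fun s => q s + \sum_(k < K) w k * r k s).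
  apply: null_add => //; apply: (null_sum (F := fun k s => w k * r k s)) => k kK.
  by apply: null_scal; exact: nr.
apply: (null_ineq nq') => s sx.
have := bessel_id (h s) (fun k => g k * ebase k s) K.
have := sqr_ge0 (cm (h s - \sum_(k < K) g k * ebase k s)); have := hq s sx.
rewrite reD re_sum big_split/=.
have -> : \sum_(i < K) cm (g i * ebase i s) ^+ 2 =
  \sum_(k < K) cm (g k) ^+ 2 * expR (- (2 * lam k * x)).
  apply: eq_bigr => k _; rewrite cmM exprMn cm_ebase sx; congr (_ * _).
  by rewrite -expRM_natl; congr expR; ring.
have -> : \sum_(i < K) 2 * re (conjc (g i * ebase i s) *
     (h s - \sum_(j < i.+1) g j * ebase j s)) = - \sum_(i < K) re (w i * r i s).
  rewrite -sumrN; apply: eq_bigr => k _.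
  have cb : conjc (ebase k s) = (expR (- (2 * lam k * x)))%:C * ex ((lam k)%:C * s).
    apply: (mulfI (ex_neq0 (- ((lam k)%:C * s)))).
    rewrite -/(ebase k s) mulcj cm_ebase sx mulrCA -exD addNr ex0 mulr1.
    by rewrite -expRM_natl; congr (_%:C); congr expR; ring.
  rewrite cjM cb /w /r.
  rewrite [(-2 * _)%:C]rmorphM rmorphN /=.
  set E := (expR _)%:C; set P := _ - \sum_(_ < _) _; set X := ex _.
  have -> : (- 2%:C) * E * conjc (g k) * (X * P) =
     (-2)%:C * (conjc (g k) * (E * X) * P) by rewrite rmorphN; ring.
  by rewrite reMr; ring.
lra.
Qed.

Lemma epol_decay (p : nat -> C) k N : (k < N)%N -> forall e, 0 < e ->
  exists X, forall s, X <= re s ->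
   cm (\sum_(j < N) p j * ebase j s - \sum_(j < k.+1) p j * ebase j s)
     <= e * expR (- (lam k * re s)).
Proof.
elim: N => // N IH kN e e0.
have [kN'|] := ltnP k N; last first.
  move=> Nk; have -> : N = k by apply/eqP; rewrite eqn_leq Nk -ltnS.
  by exists 0 => s _; rewrite subrr cm0 mulr_ge0 ?expR_ge0// ltW.
have e20 : 0 < e / 2 by lra.
have [X hX] := IH kN' _ e20.
have d0 : 0 < lam N - lam k by rewrite subr_gt0 lam_incr.
have c0 := cm_ge0 (p N).
have K0 : 0 < 2 * (1 + cm (p N)) by lra.
have [Y hY] := expR_small d0 (divr_gt0 e0 K0).
exists (Num.max X Y) => s; rewrite ge_max => /andP[Xs Ys].
rewrite big_ord_recr/= addrAC; apply: le_trans (cmD _ _) _.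
have h1 := hX s Xs; have := hY _ Ys; rewrite ler_pdivlMr// => h2.
rewrite cmM cm_ebase.
have -> : expR (- (lam N * re s)) = expR (- ((lam N - lam k) * re s)) * expR (- (lam k * re s)).
  by rewrite -expRD; congr expR; ring.
have E0 := expR_ge0 (- ((lam N - lam k) * re s)).
have : cm (p N) * expR (- ((lam N - lam k) * re s)) <= e / 2 by nra.
have := expR_ge0 (- (lam k * re s)); rewrite mulrA; nra.
Qed.

Lemma epol_coef (x0 M : R) N (p : nat -> C) :
  (forall s, x0 < re s -> cm (\sum_(j < N) p j * ebase j s) <= M) ->
  forall k, (k < N)%N -> cm (p k) <= expR (lam k * (x0 + 1)) * M.
Proof.
move=> hM k kN.
have M0 : 0 <= M.
  apply: le_trans (hM (x0 + 1)%:C _); first exact: cm_ge0.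
  by rewrite /= ltrDl.
have : \sum_(k < N) cm (p k) ^+ 2 * expR (- (2 * lam k * (x0 + 1))) <= M ^+ 2.
  apply: (@bessel x0 _ (fun s => \sum_(j < N) p j * ebase j s) _ _ _ (fun=> 0)).
  - by rewrite ltrDl.
  - by move=> s _; exact: SD_epol.
  - by exists M => s xs; apply: hM; apply: lt_le_trans xs; rewrite ltrDl.
  - by move=> k' kN'; exact: epol_decay.
  - exact: null_0.
  - move=> s xs; rewrite addr0 lerXn2r ?nnegrE ?cm_ge0//; apply: hM.
    by rewrite xs ltrDl.
rewrite (bigD1 (Ordinal kN))//= => h.
have : cm (p k) ^+ 2 * expR (- (2 * lam k * (x0 + 1))) <= M ^+ 2.
  apply: le_trans h; rewrite lerDl sumr_ge0// => i _.
  by rewrite mulr_ge0 ?sqr_ge0 ?expR_ge0.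
have -> : expR (- (2 * lam k * (x0 + 1))) = (expR (lam k * (x0 + 1)))^-1 ^+ 2.
  by rewrite -expRN -expRM_natl; congr expR; ring.
rewrite -exprMn ler_sqr ?nnegrE//; last first.
  by rewrite mulr_ge0 ?cm_ge0// invr_ge0 expR_ge0.
by rewrite ler_pdivrMr ?expR_gt0// mulrC.
Qed.

End Bessel.

(** * Uniform limits of exponential polynomials and their coefficients *)

Lemma sum_vanish {V : nmodType} (F : nat -> V) N M : (forall l, (N <= l)%N -> F l = 0) ->
  (N <= M)%N -> \sum_(l < M) F l = \sum_(l < N) F l.
Proof.
move=> F0; elim: M => [|M IH]; first by rewrite leqn0 => /eqP->.
rewrite leq_eqVlt => /predU1P[->//|NM].
by rewrite big_ord_recr/= IH// F0// addr0.
Qed.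

Section Expansions.
Context {R : realType}.
Local Notation C := R[i].
Variables (D : C -> Prop) (b : nat -> C -> C) (W : nat -> R).

Definition supp (p : nat -> C) N := forall k, (N <= k)%N -> p k = 0.

Definition App (h : C -> C) := forall e : R, 0 < e -> exists N (p : nat -> C),
  forall s, D s -> cm (h s - \sum_(k < N) p k * b k s) <= e.

(* [a] is the coefficient sequence of [h], a uniform limit on [D] of finite
   combinations of the [b k]. *)
Definition Coef (h : C -> C) (a : nat -> C) := forall e : R, 0 < e ->
  exists N p, [/\ supp p N, forall s, D s -> cm (h s - \sum_(k < N) p k * b k s) <= e
    & forall k, cm (a k - p k) <= W k * e].

Lemma supp_sum (p : nat -> C) N M (F : nat -> C) : supp p N -> (N <= M)%N ->
  \sum_(k < M) p k * F k = \sum_(k < N) p k * F k.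
Proof.
by move=> sp; apply: (sum_vanish (F := fun k => p k * F k)) => k /sp->; rewrite mul0r.
Qed.

Lemma supp_trunc (p : nat -> C) N (F : nat -> C) :
  \sum_(k < N) (if (k < N)%N then p k else 0) * F k = \sum_(k < N) p k * F k.
Proof. by apply: eq_bigr => k _; rewrite ltn_ord. Qed.

Lemma App_ext h h' : (forall s, D s -> h s = h' s) -> App h -> App h'.
Proof.
by move=> hh ah e /ah[N [p hp]]; exists N, p => s Ds; rewrite -hh// hp.
Qed.

Lemma App_lim h : (forall e, 0 < e -> exists h', App h' /\
  forall s, D s -> cm (h s - h' s) <= e) -> App h.
Proof.
move=> hl e e0; have e20 : 0 < e / 2 by lra.
have [h' [ah' hh']] := hl _ e20; have [N [p hp]] := ah' _ e20; exists N, p => s Ds.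
apply: le_trans (cm_triB _ (h' s) _) _.
have := hh' s Ds; have := hp s Ds; lra.
Qed.

Lemma App_pol N (p : nat -> C) : App (fun s => \sum_(k < N) p k * b k s).
Proof. by move=> e e0; exists N, p => s Ds; rewrite subrr cm0 ltW. Qed.

Lemma App_scal c h : App h -> App (fun s => c * h s).
Proof.
move=> ah e e0; have c0 := cm_ge0 c; have K0 : 0 < 1 + cm c by lra.
have [N [p hp]] := ah _ (divr_gt0 e0 K0); exists N, (fun k => c * p k) => s Ds.
have -> : \sum_(k < N) c * p k * b k s = c * \sum_(k < N) p k * b k s.
  by rewrite mulr_sumr; apply: eq_bigr => k _; rewrite mulrA.
rewrite -mulrBr cmM; have := hp s Ds; rewrite ler_pdivlMr//.
have := cm_ge0 (h s - \sum_(k < N) p k * b k s); nra.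
Qed.

Lemma App_add h h' : App h -> App h' -> App (fun s => h s + h' s).
Proof.
move=> ah ah' e e0; have e20 : 0 < e / 2 by lra.
have [N [p hp]] := ah _ e20; have [N' [p' hp']] := ah' _ e20.
pose p1 k := if (k < N)%N then p k else 0.
pose p2 k := if (k < N')%N then p' k else 0.
exists (maxn N N'), (fun k => p1 k + p2 k) => s Ds.
have -> : \sum_(k < maxn N N') (p1 k + p2 k) * b k s =
   \sum_(k < N) p k * b k s + \sum_(k < N') p' k * b k s.
  under eq_bigr do rewrite mulrDl.
  rewrite big_split/= (@supp_sum p1 N _ (fun k => b k s)) ?leq_maxl//; last first.
    by move=> k; rewrite leqNgt /p1 => /negbTE->.
  rewrite (@supp_sum p2 N' _ (fun k => b k s)) ?leq_maxr//; last first.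
    by move=> k; rewrite leqNgt /p2 => /negbTE->.
  by rewrite (supp_trunc p N (fun k => b k s)) (supp_trunc p' N' (fun k => b k s)).
rewrite opprD addrACA; apply: le_trans (cmD _ _) _.
have := hp s Ds; have := hp' s Ds; lra.
Qed.

Lemma App_sum N (F : nat -> C -> C) : (forall k, (k < N)%N -> App (F k)) ->
  App (fun s => \sum_(k < N) F k s).
Proof.
elim: N => [|N IH] h.
  apply: (App_ext (h := fun s => \sum_(k < 0) 0 * b k s)); last exact: (App_pol 0 (fun=> 0)).
  by move=> s _; rewrite !big_ord0.
apply: (App_ext (h := fun s => \sum_(k < N) F k s + F N s)).
  by move=> s _; rewrite big_ord_recr.
by apply: App_add; [apply: IH => k kN; apply: h; exact: ltnW|exact: h].
Qed.

Hypothesis W_ge0 : forall k, 0 <= W k.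
Hypothesis D_ne : exists s, D s.
Hypothesis pol_coef : forall N (p : nat -> C) (M : R),
  (forall s, D s -> cm (\sum_(k < N) p k * b k s) <= M) ->
  forall k, (k < N)%N -> cm (p k) <= W k * M.

Lemma supp_coef N p M : supp p N ->
  (forall s, D s -> cm (\sum_(k < N) p k * b k s) <= M) ->
  forall k, cm (p k) <= W k * M.
Proof.
move=> sp hM k; have [kN|Nk] := ltnP k N; first exact: pol_coef hM k kN.
rewrite sp// cm0 mulr_ge0//; have [s Ds] := D_ne.
by apply: le_trans (hM s Ds); exact: cm_ge0.
Qed.

Lemma supp_coefB N p N' p' M : supp p N -> supp p' N' ->
  (forall s, D s -> cm (\sum_(k < N) p k * b k s - \sum_(k < N') p' k * b k s) <= M) ->
  forall k, cm (p k - p' k) <= W k * M.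
Proof.
move=> sp sp' hM; apply: (@supp_coef (maxn N N') (fun k => p k - p' k)).
  by move=> k; rewrite geq_max => /andP[h1 h2]; rewrite sp// sp'// subrr.
move=> s Ds; under eq_bigr do rewrite mulrBl.
rewrite sumrB (supp_sum (fun k => b k s) sp) ?leq_maxl// (supp_sum (fun k => b k s) sp') ?leq_maxr//.
exact: hM.
Qed.

Lemma App_coef h : App h -> exists a, Coef h a.
Proof.
move=> ah.
have /choice[f hf] : forall n : nat, exists Np : nat * (nat -> C), supp Np.2 Np.1 /\
   forall s, D s -> cm (h s - \sum_(k < Np.1) Np.2 k * b k s) <= n.+1%:R^-1.
  move=> n; have [N [p hp]] := ah n.+1%:R^-1 ltac:(by rewrite invr_gt0).
  exists (N, fun k => if (k < N)%N then p k else 0); split=> /= [k|s /hp].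
    by rewrite leqNgt => /negbTE->.
  by rewrite (supp_trunc p N (fun k => b k s)).
have close n m k : cm ((f n).2 k - (f m).2 k) <= W k * (n.+1%:R^-1 + m.+1%:R^-1).
  apply: (supp_coefB (hf n).1 (hf m).1) => s Ds.
  apply: le_trans (cm_triB _ (h s) _) _; apply: lerD.
    by rewrite cmBC; exact: (hf n).2.
  exact: (hf m).2.
have small (e : R) : 0 < e -> exists N, forall n, (N <= n)%N -> n.+1%:R^-1 <= e.
  move=> e0; have [N [N0 hN]] := nat_ge e^-1; exists N => n Nn.
  rewrite -[e]invrK lef_pV2 ?posrE ?invr_gt0//.
  by apply: le_trans hN _; rewrite ler_nat ltnW.
have /choice[a ha] : forall k, exists l, tends (fun n => (f n).2 k) l.
  move=> k; apply: cauchy_tends => e e0.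
  have K0 : 0 < 2 * (W k + 1) by have := W_ge0 k; lra.
  have [N hN] := small _ (divr_gt0 e0 K0); exists N => m n Nm mn.
  have h1 := hN n (leq_trans Nm mn); have h2 := hN m Nm.
  apply: le_trans (close _ _ _) _.
  have h3 : n.+1%:R^-1 + m.+1%:R^-1 <= e / (W k + 1).
    have -> : e / (W k + 1) = e / (2 * (W k + 1)) + e / (2 * (W k + 1)).
      by field; rewrite gt_eqF//; have := W_ge0 k; lra.
    exact: lerD.
  have W0 := W_ge0 k.
  apply: le_trans (ler_wpM2l W0 h3) _.
  rewrite mulrA ler_pdivrMr; last lra.
  nra.
exists a => e e0; have e20 : 0 < e / 2 by lra.
have [n hn] := small _ e20; exists (f n).1, (f n).2; split; first exact: (hf n).1.
  move=> s Ds; apply: le_trans ((hf n).2 s Ds) _.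
  by apply: le_trans (hn n (leqnn _)) _; lra.
move=> k.
apply: (@tends_le _ (fun m => (f m).2 k - (f n).2 k)).
  move=> e' e0'; have [N hN] := ha k e' e0'; exists N => m /hN.
  by rewrite opprB addrA subrK.
exists n => m nm; apply: le_trans (close _ _ _) _.
apply: ler_wpM2l => //; rewrite [e]splitr.
by apply: lerD; apply: hn.
Qed.

Lemma Coef_App h a : Coef h a -> App h.
Proof. by move=> ch e /ch[N [p [_ hp _]]]; exists N, p. Qed.

Lemma Coef_ext h h' a : (forall s, D s -> h s = h' s) -> Coef h a -> Coef h' a.
Proof.
move=> hh ch e /ch[N [p [sp hp ap]]]; exists N, p; split=> // s Ds.
by rewrite -hh// hp.
Qed.

Lemma Coef_bound h a M : Coef h a -> (forall s, D s -> cm (h s) <= M) ->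
  forall k, cm (a k) <= W k * M.
Proof.
move=> ch hM k; apply: le_eps => e e0; have W0 := W_ge0 k.
have K0 : 0 < 2 * (W k + 1) by lra.
have [N [p [sp hp ap]]] := ch _ (divr_gt0 e0 K0); set e1 := e / _ in hp ap.
have h1 : cm (p k) <= W k * (M + e1).
  apply: (supp_coef sp) => s Ds.
  have := hM s Ds; have := hp s Ds; rewrite cmBC.
  have := cm_lB (\sum_(j < N) p j * b j s) (h s); lra.
have := ap k; have := cm_lB (a k) (p k).
have e10 : 0 < e1 by rewrite divr_gt0.
have : W k * e1 * 2 <= e.
  have <- : e1 * (2 * (W k + 1)) = e by rewrite /e1 divfK ?gt_eqF.
  nra.
rewrite mulrDr in h1; lra.
Qed.

Lemma Coef_scal c h a : Coef h a -> Coef (fun s => c * h s) (fun k => c * a k).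
Proof.
move=> ch e e0; have c0 := cm_ge0 c; have K0 : 0 < 1 + cm c by lra.
have [N [p [sp hp ap]]] := ch _ (divr_gt0 e0 K0); set e1 := e / _ in hp ap.
have e10 : 0 <= e1 by rewrite divr_ge0 ?ltW.
have ce : cm c * e1 <= e.
  have -> : e = (1 + cm c) * e1 by rewrite /e1 mulrC divfK ?gt_eqF.
  by rewrite ler_wpM2r//; lra.
exists N, (fun k => c * p k); split=> [k Nk|s Ds|k]; first by rewrite sp// mulr0.
  have -> : \sum_(k < N) c * p k * b k s = c * \sum_(k < N) p k * b k s.
    by rewrite mulr_sumr; apply: eq_bigr => k _; rewrite mulrA.
  by rewrite -mulrBr cmM; apply: le_trans ce; rewrite ler_wpM2l// hp.
rewrite -mulrBr cmM; apply: le_trans (ler_wpM2l c0 (ap k)) _.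
by rewrite mulrCA ler_wpM2l.
Qed.

Lemma Coef_add h a h' a' : Coef h a -> Coef h' a' ->
  Coef (fun s => h s + h' s) (fun k => a k + a' k).
Proof.
move=> ch ch' e e0; have e20 : 0 < e / 2 by lra.
have [N [p [sp hp ap]]] := ch _ e20; have [N' [p' [sp' hp' ap']]] := ch' _ e20.
exists (maxn N N'), (fun k => p k + p' k); split=> [k|s Ds|k].
- by rewrite geq_max => /andP[h1 h2]; rewrite sp// sp'// addr0.
- under eq_bigr do rewrite mulrDl.
  rewrite big_split/= (supp_sum (fun k => b k s) sp) ?leq_maxl// (supp_sum (fun k => b k s) sp') ?leq_maxr//.
  rewrite opprD addrACA; apply: le_trans (cmD _ _) _.
  have := hp s Ds; have := hp' s Ds; lra.
- rewrite opprD addrACA; apply: le_trans (cmD _ _) _.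
  apply: le_trans (lerD (ap k) (ap' k)) _; rewrite -mulrDr.
  by rewrite ler_wpM2l//; lra.
Qed.

Lemma Coef_sub h a h' a' : Coef h a -> Coef h' a' ->
  Coef (fun s => h s - h' s) (fun k => a k - a' k).
Proof.
move=> ch ch'; have := Coef_add ch (Coef_scal (-1) ch').
move=> c1 e /c1[N [p [sp hp ap]]]; exists N, p; split=> // [s /hp|k].
  by rewrite mulN1r.
by have := ap k; rewrite mulN1r.
Qed.

Lemma Coef_sum n (F : nat -> C -> C) (A : nat -> nat -> C) :
  (forall l, (l < n)%N -> Coef (F l) (A l)) ->
  Coef (fun s => \sum_(l < n) F l s) (fun k => \sum_(l < n) A l k).
Proof.
elim: n => [|n IH] h.
  move=> e e0; exists 0%N, (fun=> 0); split=> // [s _|k].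
    by rewrite !big_ord0 subrr cm0 ltW.
  by rewrite big_ord0 subrr cm0; apply: mulr_ge0 => //; exact: ltW.
have h1 := IH (fun l ln => h l (ltnW ln)).
have := Coef_add h1 (h n (leqnn _)).
move=> c1 e /c1[N [p [sp hp ap]]]; exists N, p; split=> // [s /hp|k].
  by rewrite big_ord_recr.
by have := ap k; rewrite big_ord_recr.
Qed.

Lemma Coef_uniq h a a' : Coef h a -> Coef h a' -> forall k, a k = a' k.
Proof.
move=> ch ch' k; have := Coef_bound (Coef_sub ch ch') (M := 0) _ k.
move=> /(_ _)/wrap[] => [s _|]; first by rewrite subrr cm0.
rewrite mulr0 => h0; apply/eqP; rewrite -subr_eq0 -cm_eq0.
by rewrite eq_le cm_ge0 h0.
Qed.

Lemma Coef_pol N (p : nat -> C) : supp p N -> Coef (fun s => \sum_(k < N) p k * b k s) p.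
Proof.
move=> sp e e0; exists N, p; split=> // [s _|k]; rewrite subrr cm0; first exact: ltW.
by apply: mulr_ge0 => //; exact: ltW.
Qed.

(* Domination by a summable sequence [tau] at [s] gives the expansion of [h]
   together with its remainder. *)
Lemma Coef_tail h a M K s (tau : nat -> R) (B T : R) : D s -> Coef h a ->
  0 <= M -> (forall k, cm (a k) <= W k * M) ->
  (forall k, W k * cm (b k s) <= tau k) ->
  (forall n, \sum_(k < n) tau k <= B) ->
  (forall n, \sum_(K <= k < n) tau k <= T) ->
  cm (h s - \sum_(k < K) a k * b k s) <= M * T.
Proof.
move=> Ds ch M0 aM bt tB tT; apply: le_eps => e e0.
have tau0 k : 0 <= tau k.
  by apply: le_trans (bt k); rewrite mulr_ge0// cm_ge0.
have B0 : 0 <= B by have := tB 0%N; rewrite big_ord0.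
have K0 : 0 < 1 + B by lra.
have [N [p [sp hp ap]]] := ch _ (divr_gt0 e0 K0); set e1 := e / _ in hp ap.
have e10 : 0 <= e1 by rewrite divr_ge0// ltW.
have ee : e1 + e1 * B = e by rewrite /e1; field; rewrite gt_eqF.
have -> : \sum_(k < K) a k * b k s =
   \sum_(k < maxn K N) (if (k < K)%N then a k else 0) * b k s.
  rewrite (@supp_sum (fun k => if (k < K)%N then a k else 0) K _ (fun k => b k s)).
  - by rewrite (supp_trunc a K (fun k => b k s)).
  - move=> k.
    by rewrite leqNgt => /negbTE->.
  - exact: leq_maxl.
apply: le_trans (cm_triB _ (\sum_(k < N) p k * b k s) _) _.
have h1 := hp s Ds.
suff : cm (\sum_(k < N) p k * b k s -
  \sum_(k < maxn K N) (if (k < K)%N then a k else 0) * b k s) <= e1 * B + M * T by lra.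
rewrite -(supp_sum (fun k => b k s) sp (leq_maxr K N)) -sumrB.
apply: le_trans (cm_sum _ _ _) _.
apply: (@le_trans _ _ (\sum_(k < maxn K N) (e1 * tau k + (if (k < K)%N then 0 else M * tau k)))).
  apply: ler_sum => k _; rewrite -mulrBl cmM.
  have b0 := cm_ge0 (b k s); have btk := bt k; have Wk := W_ge0 k.
  have pk : cm (p k - a k) <= W k * e1 by rewrite cmBC.
  case: ifP => kK.
    rewrite addr0; apply: le_trans (ler_wpM2r b0 pk) _.
    by rewrite mulrAC mulrC ler_wpM2l.
  have pk2 : cm (p k) <= W k * e1 + W k * M.
    by have := aM k; have := cm_lB (p k) (a k); lra.
  rewrite subr0; apply: le_trans (ler_wpM2r b0 pk2) _.
  have -> : (W k * e1 + W k * M) * cm (b k s) = (e1 + M) * (W k * cm (b k s)) by ring.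
  rewrite -mulrDl.
  by rewrite ler_wpM2l// addr_ge0.
rewrite big_split/= -mulr_sumr; apply: lerD.
  by apply: ler_wpM2l => //; exact: tB.
rewrite -(big_mkord xpredT (fun k => if (k < K)%N then 0 else M * tau k)).
rewrite (@big_cat_nat _ _ _ K)//= ?leq_maxl// big_nat big1 ?add0r; last first.
  by move=> i /andP[_ ->].
rewrite big_nat; under eq_bigr => i /andP[Ki _] do rewrite ltnNge Ki/=.
by rewrite -big_nat -mulr_sumr ler_wpM2l.
Qed.

End Expansions.

Section AppAlgebra.
Context {R : realType}.
Local Notation C := R[i].
Variables (D : C -> Prop) (b : nat -> C -> C).
Hypothesis b_one : forall s, b 0%N s = 1.
Hypothesis b_mul : forall j k, exists m, forall s, b j s * b k s = b m s.
Hypothesis b_bnd : forall k, exists M, forall s, D s -> cm (b k s) <= M.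

Lemma App_base k : App D b (b k).
Proof.
apply: (App_ext _ (App_pol D b k.+1 (fun j => (j == k)%:R))) => s _.
rewrite big_ord_recr/= eqxx mul1r big1 ?add0r// => i _.
by rewrite (ltn_eqF (ltn_ord i)) mul0r.
Qed.

Lemma App_cst c : App D b (fun=> c).
Proof.
by apply: (App_ext _ (App_scal c (App_base 0))) => s _; rewrite b_one mulr1.
Qed.

Lemma App_bounded h : App D b h -> exists M, 0 <= M /\ forall s, D s -> cm (h s) <= M.
Proof.
move=> /(_ 1 ltr01)[N [p hp]].
have [M [M0 hM]] : exists M, 0 <= M /\ forall s, D s -> cm (\sum_(k < N) p k * b k s) <= M.
  elim: (N) => [|n [M [M0 hM]]].
    by exists 0; split=> // s _; rewrite big_ord0 cm0.
  have [B hB] := b_bnd n; exists (M + cm (p n) * `|B|); split.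
    by rewrite addr_ge0// mulr_ge0// cm_ge0.
  move=> s Ds; rewrite big_ord_recr/=; apply: le_trans (cmD _ _) _.
  apply: lerD; first exact: hM.
  rewrite cmM ler_wpM2l ?cm_ge0//; apply: le_trans (hB s Ds) _; exact: ler_norm.
exists (M + 1); split; first lra.
move=> s Ds; have := hM s Ds; have := hp s Ds.
have := cm_lB (h s) (\sum_(k < N) p k * b k s); lra.
Qed.

Lemma App_mul f g : App D b f -> App D b g -> App D b (fun s => f s * g s).
Proof.
move=> af ag; apply: App_lim => e e0.
have [M [M0 hM]] := App_bounded af.
have K0 : 0 < 2 * (M + 1) by lra.
have [N' [q hq]] := ag _ (divr_gt0 e0 K0).
pose Q s := \sum_(k < N') q k * b k s.
have [B [B0 hB]] := App_bounded (App_pol D b N' q).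
have L0 : 0 < 2 * (B + 1) by lra.
have [N [p hp]] := af _ (divr_gt0 e0 L0).
pose P s := \sum_(k < N) p k * b k s.
exists (fun s => P s * Q s); split.
  apply: (App_ext (h := fun s => \sum_(j < N) \sum_(k < N') p j * q k * (b j s * b k s))).
    move=> s _; rewrite /P mulr_suml; apply: eq_bigr => j _.
    by rewrite /Q mulr_sumr; apply: eq_bigr => k _; ring.
  apply: (App_sum (F := fun j s => \sum_(k < N') p j * q k * (b j s * b k s))) => j _.
  apply: (App_sum (F := fun k s => p j * q k * (b j s * b k s))) => k _.
  apply: App_scal; have [m hm] := b_mul j k.
  by apply: (App_ext _ (App_base m)) => s _; rewrite hm.
move=> s Ds.
have -> : f s * g s - P s * Q s = f s * (g s - Q s) + Q s * (f s - P s) by ring.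
apply: le_trans (cmD _ _) _; rewrite !cmM.
have h1 : cm (f s) * cm (g s - Q s) <= M * (e / (2 * (M + 1))).
  by apply: ler_pM; rewrite ?cm_ge0//; [exact: hM|exact: hq].
have h2 : cm (Q s) * cm (f s - P s) <= B * (e / (2 * (B + 1))).
  by apply: ler_pM; rewrite ?cm_ge0//; [exact: hB|exact: hp].
have h3 : M * (e / (2 * (M + 1))) <= e / 2.
  rewrite mulrA ler_pdivrMr//; nra.
have h4 : B * (e / (2 * (B + 1))) <= e / 2.
  rewrite mulrA ler_pdivrMr//; nra.
lra.
Qed.

Lemma App_exp h n : App D b h -> App D b (fun s => h s ^+ n).
Proof.
move=> ah; elim: n => [|n IH].
  by apply: (App_ext _ (App_cst 1)) => s _; rewrite expr0.
by apply: (App_ext _ (App_mul ah IH)) => s _; rewrite exprS.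
Qed.

Lemma App_ex h : App D b h -> App D b (fun s => ex (h s)).
Proof.
move=> ah; have [M [M0 hM]] := App_bounded ah.
apply: App_lim => e e0; have [m [m0 hm]] := ex_poly M e0.
exists (fun s => (1 + h s / m%:R) ^+ m); split; last by move=> s /hM/hm.
apply: App_exp; apply: App_add; first exact: App_cst.
by apply: (App_ext _ (App_scal (m%:R)^-1 ah)) => s _; rewrite mulrC.
Qed.

End AppAlgebra.

(** * Dirichlet series *)

Section DirichletExpansions.
Context {R : realType}.
Local Notation C := R[i].

(* Indices are shifted by one, as in [dirichlet_sum]. *)
Definition lnS (k : nat) : R := ln k.+1%:R.

Lemma lnS_incr j k : (j < k)%N -> lnS j < lnS k.
Proof. by move=> jk; rewrite /lnS ltr_ln ?posrE ?ltr0n// ltr_nat ltnS. Qed.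

Lemma lnS_ge0 k : 0 <= lnS k.
Proof. by rewrite ln_ge0// ler1n. Qed.

Lemma lnS0 : lnS 0 = 0. Proof. by rewrite /lnS ln1. Qed.

Lemma expR_lnS k : expR (lnS k) = k.+1%:R.
Proof. by rewrite /lnS lnK// posrE ltr0n. Qed.

Definition dn := ebase lnS.
Definition HP (x : R) (s : C) := x < re s.
Definition wgt (x : R) k := expR (lnS k * (x + 1)).
Definition DApp x := App (HP x) dn.
Definition DCoef x := Coef (HP x) dn (wgt x).

Lemma dn_one s : dn 0 s = 1.
Proof. by rewrite /dn /ebase lnS0 mul0r oppr0 ex0. Qed.

Lemma dn_mul j k : exists m, forall s, dn j s * dn k s = dn m s.
Proof.
exists (j.+1 * k.+1).-1 => s; rewrite /dn /ebase -exD -opprD -mulrDl -rmorphD.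
by rewrite /lnS -lnM ?posrE ?ltr0n// -natrM.
Qed.

Lemma dnD k s t : dn k (s + t) = dn k s * dn k t.
Proof. by rewrite /dn /ebase mulrDr opprD exD. Qed.

Lemma cm_dn k s : cm (dn k s) = expR (- (lnS k * re s)).
Proof. exact: cm_ebase. Qed.

Lemma dn_bnd x k : exists M, forall s, HP x s -> cm (dn k s) <= M.
Proof.
exists (expR (- (lnS k * x))) => s xs; rewrite cm_dn ler_expR lerN2.
by rewrite ler_wpM2l ?lnS_ge0// ltW.
Qed.

Lemma HP_ne x : exists s, HP x s.
Proof. by exists (x + 1)%:C; rewrite /HP /= ltrDl. Qed.

Lemma wgt_ge0 x k : 0 <= wgt x k. Proof. exact: expR_ge0. Qed.

Lemma dn_coef x N (p : nat -> C) (M : R) :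
  (forall s, HP x s -> cm (\sum_(k < N) p k * dn k s) <= M) ->
  forall k, (k < N)%N -> cm (p k) <= wgt x k * M.
Proof. exact: (epol_coef lnS_incr). Qed.

Lemma DApp_le x y h : x <= y -> DApp x h -> DApp y h.
Proof.
move=> xy ah e /ah[N [p hp]]; exists N, p => s ys; apply: hp.
exact: le_lt_trans ys.
Qed.

Lemma DCoef_le x y h a : x <= y -> DCoef x h a -> DCoef y h a.
Proof.
move=> xy ch e e0; have [N [p [sp hp ap]]] := ch e e0; exists N, p; split=> //.
  by move=> s ys; apply: hp; exact: le_lt_trans ys.
move=> k; apply: le_trans (ap k) _; rewrite ler_pM2r//.
by rewrite /wgt ler_expR ler_wpM2l ?lnS_ge0// lerD2r.
Qed.

Lemma DApp_coef x h : DApp x h -> exists a, DCoef x h a.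
Proof. exact: (App_coef (wgt_ge0 x) (HP_ne x) (@dn_coef x)). Qed.

Lemma DCoef_bound x h a M : DCoef x h a -> (forall s, x < re s -> cm (h s) <= M) ->
  forall k, cm (a k) <= wgt x k * M.
Proof. exact: (Coef_bound (wgt_ge0 x) (HP_ne x) (@dn_coef x)). Qed.

Lemma DCoef_uniq x h a a' : DCoef x h a -> DCoef x h a' -> forall k, a k = a' k.
Proof. exact: (Coef_uniq (wgt_ge0 x) (HP_ne x) (@dn_coef x)). Qed.

Lemma DApp_bounded x h : DApp x h ->
  exists M, 0 <= M /\ forall s, x < re s -> cm (h s) <= M.
Proof. exact: (App_bounded (@dn_bnd x)). Qed.

Lemma DApp_comp x y f g : DApp y f -> DApp x g ->
  (forall s, x < re s -> y < re (s + g s)) -> DApp x (fun s => f (s + g s)).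
Proof.
move=> af ag fg; apply: App_lim => e e0; have [N [p hp]] := af e e0.
exists (fun s => \sum_(k < N) p k * dn k (s + g s)); split; last first.
  by move=> s xs; apply: hp; exact: fg.
apply: (App_sum (F := fun k s => p k * dn k (s + g s))) => k _.
apply: App_scal.
apply: (App_ext (h := fun s => dn k s * ex (- (lnS k)%:C * g s))).
  by move=> s _; rewrite dnD /dn /ebase mulNr.
apply: (App_mul dn_mul (@dn_bnd x)); first exact: App_base.
apply: (App_ex dn_one dn_mul (@dn_bnd x)); exact: App_scal.
Qed.

Lemma sum_invsq n : \sum_(k < n.+1) (k.+1%:R^-1 : R) ^+ 2 <= 2 - n.+1%:R^-1.
Proof.
elim: n => [|n IH]; first by rewrite big_ord_recr big_ord0/= invr1 expr1n add0r; lra.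
rewrite big_ord_recr/=.
have h : (n.+2%:R^-1 : R) ^+ 2 <= n.+1%:R^-1 - n.+2%:R^-1.
  have -> : n.+1%:R^-1 - n.+2%:R^-1 = n.+1%:R^-1 * n.+2%:R^-1 :> R.
    rewrite -[n.+2%:R]natr1; field.
    by have n0 := ler0n R n; apply/andP; split; rewrite gt_eqF//; lra.
  by rewrite expr2 ler_pM2r ?invr_gt0 ?ltr0n// lef_pV2 ?posrE ?ltr0n// ler_nat.
apply: le_trans (lerD IH h) _; apply: le_refl_eq; ring.
Qed.

Lemma sum_invsq_le2 n : \sum_(k < n) (k.+1%:R^-1 : R) ^+ 2 <= 2.
Proof.
case: n => [|n]; first by rewrite big_ord0.
by apply: le_trans (sum_invsq n) _; rewrite lerBlDr lerDl invr_ge0.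
Qed.

Lemma expR_lnS2 k : expR (- (2 * lnS k)) = (k.+1%:R^-1) ^+ 2.
Proof. by rewrite expRN expRM_natl expR_lnS exprVn. Qed.

(* For [x + 3 <= X] the terms [wgt x k * k.+1 ^- X] are at most [k.+1 ^- 2]. *)
Lemma wgt_tail (x X : R) K n : x + 3 <= X ->
  \sum_(K <= k < n) wgt x k * expR (- (lnS k * X)) <= 2 * expR (- (lnS K * (X - x - 3))).
Proof.
move=> xX; pose y := X - x - 3; have y0 : 0 <= y by rewrite /y; lra.
apply: (@le_trans _ _ (\sum_(K <= k < n) (k.+1%:R^-1) ^+ 2 * expR (- (lnS K * y)))).
  rewrite big_nat [leRHS]big_nat; apply: ler_sum => k /andP[Kk _].
  have -> : wgt x k * expR (- (lnS k * X)) = (k.+1%:R^-1) ^+ 2 * expR (- (lnS k * y)).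
    by rewrite /wgt -expR_lnS2 -!expRD /y; congr expR; ring.
  apply: ler_wpM2l; first exact: sqr_ge0.
  rewrite ler_expR lerN2 ler_wpM2r//.
  by move: Kk; rewrite leq_eqVlt => /predU1P[->//|/lnS_incr/ltW].
rewrite -mulr_suml; apply: ler_wpM2r; first exact: expR_ge0.
apply: le_trans (sum_invsq_le2 n); rewrite -(big_mkord xpredT (fun k => (k.+1%:R^-1 : R) ^+ 2)).
have [Kn|nK] := leqP K n.
  by rewrite [leRHS](@big_cat_nat _ _ _ K)//= lerDr sumr_ge0// => i _; rewrite sqr_ge0.
rewrite (big_geq (ltnW nK)); apply: sumr_ge0 => i _; exact: sqr_ge0.
Qed.

Lemma DCoef_tail x h a M K s : DCoef x h a -> 0 <= M ->
  (forall k, cm (a k) <= wgt x k * M) -> x + 3 <= re s ->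
  cm (h s - \sum_(k < K) a k * dn k s) <= M * (2 * expR (- (lnS K * (re s - x - 3)))).
Proof.
move=> ch M0 aM xs.
apply: (@Coef_tail R (HP x) dn (wgt x) (wgt_ge0 x) h a M K s
  (fun k => wgt x k * expR (- (lnS k * re s))) 2) => //.
- by rewrite /HP; apply: lt_le_trans xs; rewrite ltrDl.
- by move=> k; rewrite cm_dn.
- move=> n; rewrite -(big_mkord xpredT (fun k => wgt x k * expR (- (lnS k * re s)))).
  by apply: le_trans (wgt_tail 0 n xs) _; rewrite lnS0 mul0r oppr0 expR0 mulr1.
- by move=> n; exact: wgt_tail.
Qed.

Lemma DCoef_low x h a (L B X : R) : DCoef x h a -> 0 <= L ->
  (forall s, X <= re s -> cm (h s) <= B * expR (- (L * re s))) ->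
  forall k, lnS k < L -> a k = 0.
Proof.
move=> ch L0 hB k kL; apply: cm_eps0 => e e0.
have B0 : 0 <= B.
  have := hB X%:C (lexx _); move/(le_trans (cm_ge0 _)).
  by rewrite pmulr_lge0// expR_gt0.
have K0 : 0 < expR (lnS k) * (B + 1) by rewrite mulr_gt0 ?expR_gt0//; lra.
have d0 : 0 < L - lnS k by rewrite subr_gt0.
have [Y hY] := expR_small d0 (divr_gt0 e0 K0).
pose y := Num.max x (Num.max X Y).
have xy : x <= y by rewrite le_max lexx.
have Xy : X <= y by rewrite !le_max lexx orbT.
have Yy : Y <= y by rewrite !le_max lexx !orbT.
have := DCoef_bound (DCoef_le xy ch) (M := B * expR (- (L * y))) _ k.
move=> H; have {H} : cm (a k) <= wgt y k * (B * expR (- (L * y))).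
  apply: H => s ys; apply: le_trans (hB s (le_trans Xy (ltW ys))) _.
  by rewrite ler_wpM2l// ler_expR lerN2 ler_wpM2l// ltW.
have -> : wgt y k * (B * expR (- (L * y))) =
   expR (lnS k) * B * expR (- ((L - lnS k) * y)).
  have -> : wgt y k = expR (lnS k) * expR (lnS k * y).
    by rewrite /wgt mulrDr mulr1 expRD mulrC.
  have -> : expR (- ((L - lnS k) * y)) = expR (lnS k * y) * expR (- (L * y)).
    by rewrite -expRD; congr expR; ring.
  ring.
move=> h1; apply: le_trans h1 _; have := hY y Yy; rewrite ler_pdivlMr// => h2.
apply: le_trans h2; rewrite [leRHS]mulrC -mulrA mulrA ler_wpM2r ?expR_ge0//.
by rewrite ler_pM2l ?expR_gt0//; lra.
Qed.

Lemma DCoef_series (a : nat -> C) (M : R) h : 0 <= M -> (forall k, cm (a k) <= M) ->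
  (forall s, 2 < re s -> tends (fun N => \sum_(k < N) a k * dn k s) (h s)) ->
  DCoef 2 h a.
Proof.
move=> M0 aM hs e e0.
have [N [N0 hN]] := nat_ge (M / e).
rewrite ler_pdivrMr// in hN.
have NR : 0 < N%:R :> R by rewrite ltr0n.
exists N, (fun k => if (k < N)%N then a k else 0); split.
- by move=> k; rewrite leqNgt => /negbTE->.
- move=> s s2; rewrite (supp_trunc a N (fun k => dn k s)).
  apply: (@tends_le _ (fun n => \sum_(k < n) a k * dn k s - \sum_(k < N) a k * dn k s)).
    move=> e' e0'; have [n0 hn] := hs s s2 e' e0'; exists n0 => n /hn.
    by rewrite opprB addrA subrK.
  exists N => n Nn.
  rewrite -(big_mkord xpredT (fun k => a k * dn k s)).
  rewrite -(big_mkord xpredT (fun k => a k * dn k s)).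
  rewrite [in X in X - _](@big_cat_nat _ _ _ N)//= addrAC subrr add0r.
  apply: le_trans (cm_sum _ _ _) _.
  apply: (@le_trans _ _ (\sum_(N <= k < n) M * ((- k.+1%:R^-1) - (- (k%:R^-1))))).
    rewrite big_nat [leRHS]big_nat; apply: ler_sum => k /andP[Nk _].
    rewrite cmM; apply: ler_pM; rewrite ?cm_ge0// cm_dn.
    have k0 : (0 < k)%N by exact: leq_trans Nk.
    have kR : 0 < k%:R :> R by rewrite ltr0n.
    apply: (@le_trans _ _ (expR (- (2 * lnS k)))).
      by rewrite ler_expR lerN2 mulrC ler_wpM2l ?lnS_ge0// ltW.
    rewrite expR_lnS2.
    have -> : - k.+1%:R^-1 - - k%:R^-1 = k%:R^-1 * k.+1%:R^-1 :> R.
      rewrite -[k.+1%:R]natr1; field.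
      by apply/andP; split; rewrite gt_eqF//; lra.
    by rewrite expr2 ler_pM2r ?invr_gt0 ?ltr0n// lef_pV2 ?posrE ?ltr0n// ler_nat.
  rewrite -mulr_sumr (telescope_sumr (fun k => - (k%:R^-1 : R)))//.
  have : 0 <= n%:R^-1 :> R by rewrite invr_ge0.
  move=> n0; apply: (@le_trans _ _ (M * N%:R^-1)).
    by rewrite ler_wpM2l//; lra.
  by rewrite ler_pdivrMr// mulrC.
- move=> k; case: ifP => kN.
    by rewrite subrr cm0; apply: mulr_ge0; [exact: wgt_ge0|exact: ltW].
  rewrite subr0; apply: le_trans (aM k) _; apply: le_trans hN _.
  rewrite ler_wpM2r//; first exact: ltW.
  apply: (@le_trans _ _ (expR (lnS k))).
    rewrite expR_lnS ler_nat; apply: leqW.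
    by rewrite leqNgt kN.
  by rewrite /wgt ler_expR ler_peMr ?lnS_ge0//; lra.
Qed.

End DirichletExpansions.

(** * Power series *)

Section PowerSeries.
Context {R : realType}.
Local Notation C := R[i].

Definition pw (k : nat) (z : C) : C := z ^+ k.
Definition disc (r : R) (z : C) := cm z < r.

Lemma pw_one z : pw 0 z = 1. Proof. exact: expr0. Qed.

Lemma pw_mul j k : exists m, forall z, pw j z * pw k z = pw m z.
Proof. by exists (j + k)%N => z; rewrite /pw exprD. Qed.

Lemma pw_bnd r k : exists M, forall z, disc r z -> cm (pw k z) <= M.
Proof.
exists (`|r| ^+ k) => z zr; rewrite /pw cmX lerXn2r ?nnegrE ?cm_ge0//.
by apply: ltW; apply: lt_le_trans zr _; exact: ler_norm.
Qed.

Lemma pw_coef (r : R) N (p : nat -> C) (M : R) : 0 < r ->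
  (forall z, disc r z -> cm (\sum_(k < N) p k * pw k z) <= M) ->
  forall k, (k < N)%N -> cm (p k) <= (expR 1 / r) ^+ k * M.
Proof.
move=> r0 hM k kN.
have := @epol_coef R (fun k => k%:R) _ (- ln r) M N p _ k kN.
have -> : expR (k%:R * (- ln r + 1)) = (expR 1 / r) ^+ k.
  by rewrite expRM_natl addrC expRD expRN lnK// posrE.
apply; first by move=> i j; rewrite ltr_nat.
move=> s xs.
have -> : \sum_(j < N) p j * ebase (fun k => k%:R) j s =
   \sum_(j < N) p j * pw j (ex (- s)).
  apply: eq_bigr => j _; congr (_ * _).
  by rewrite /ebase /pw -exX mulrN (rmorph_nat (real_complex R)).
apply: hM; rewrite /disc cm_ex reN -[ltRHS](@lnK _ r) ?posrE// ltr_expR.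
by rewrite ltrNl.
Qed.

(* The radius of convergence is halved so that remainders are geometric. *)
Definition PS (r : R) (h : C -> C) (a : nat -> C) (M : R) :=
  [/\ 0 < r, 0 <= M, forall k, cm (a k) <= M * r^-1 ^+ k &
   forall z, cm z <= r / 2 -> forall K,
     cm (h z - \sum_(k < K) a k * z ^+ k) <= M * 2 * (cm z / r) ^+ K].

Lemma geo_half (t : R) K n : 0 <= t -> t <= 1 / 2 -> \sum_(K <= k < n) t ^+ k <= 2 * t ^+ K.
Proof.
move=> t0 t1.
have [Kn|/ltnW nK] := leqP K n; last by rewrite big_geq// mulr_ge0// exprn_ge0.
suff : \sum_(K <= k < n) t ^+ k <= 2 * (t ^+ K - t ^+ n).
  by move=> h; apply: le_trans h _; have := exprn_ge0 n t0; lra.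
elim: n Kn => [|n IH]; first by rewrite leqn0 => /eqP->; rewrite big_geq// subrr mulr0.
rewrite leq_eqVlt => /predU1P[->|Kn]; first by rewrite big_geq// subrr mulr0.
rewrite big_nat_recr//= exprS; have := IH Kn; have := exprn_ge0 n t0.
nra.
Qed.

Lemma PS_App (r : R) h : 0 < r -> App (disc r) pw h -> exists s a M, PS s h a M.
Proof.
move=> r0 ah; have e0 : 0 < expR 1 :> R := expR_gt0 1.
pose s := r / expR 1; have s0 : 0 < s by rewrite divr_gt0.
have sV : s^-1 = expR 1 / r by rewrite /s invf_div.
have sr : s <= r.
  rewrite /s ler_pdivrMr// ler_peMr ?ltW//.
  by have := expR_ge1Dx (1 : R); lra.
have W0 k : 0 <= s^-1 ^+ k by rewrite exprn_ge0// invr_ge0 ltW.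
have Dne : exists z, disc r z by exists 0; rewrite /disc cm0.
have pc N (p : nat -> C) (M : R) := @pw_coef r N p M r0.
rewrite -sV in pc.
have [a ca] := App_coef W0 Dne pc ah.
have [M [M0 hM]] := App_bounded (@pw_bnd r) ah.
have aM := Coef_bound W0 Dne pc ca hM.
exists s, a, M; split=> // [k|z zs K]; first by rewrite mulrC.
have t0 : 0 <= cm z / s by rewrite divr_ge0 ?cm_ge0// ltW.
have t1 : cm z / s <= 1 / 2 by rewrite ler_pdivrMr//; lra.
rewrite -mulrA; apply: (@Coef_tail R (disc r) pw (fun k => s^-1 ^+ k) W0 h a M K z
  (fun k => (cm z / s) ^+ k) 2) => //.
- rewrite /disc; apply: le_lt_trans zs _; lra.
- by move=> k; rewrite /pw cmX -exprMn mulrC.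
- move=> n; rewrite -(big_mkord xpredT (fun k => (cm z / s) ^+ k)).
  by apply: le_trans (geo_half 0 n t0 t1) _; rewrite expr0 mulr1.
- by move=> n; exact: geo_half.
Qed.

Lemma App_disc (c : C) (r : R) h :
  (forall e : R, 0 < e -> exists N (p : nat -> C), forall z, cm z < r ->
     cm (h (c + z) - \sum_(k < N) p k * dn k (c + z)) <= e) ->
  App (disc r) pw (fun z => h (c + z)).
Proof.
move=> ah; apply: App_lim => e e0; have [N [p hp]] := ah e e0.
exists (fun z => \sum_(k < N) p k * dn k (c + z)); split; last exact: hp.
apply: (App_sum (F := fun k z => p k * dn k (c + z))) => k _; apply: App_scal.
apply: (App_ext (h := fun z => dn k c * ex (- (lnS k)%:C * pw 1 z))).
  by move=> z _; rewrite dnD /pw expr1 {2}/dn /ebase mulNr.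
apply: App_scal; apply: (App_ex pw_one pw_mul (@pw_bnd r)); apply: App_scal.
exact: App_base.
Qed.

Lemma PS_at0 r h a M : PS r h a M -> h 0 = a 0%N.
Proof.
move=> [r0 M0 _ H]; have := H 0; rewrite cm0 => /(_ _ 1%N).
rewrite big_ord_recr big_ord0/= expr0 mulr1 add0r mul0r expr1 mulr0.
move=> h0; apply/eqP; rewrite -subr_eq0 -cm_eq0 eq_le cm_ge0 h0//.
by rewrite divr_ge0// ltW.
Qed.

Lemma geo_small (A e : R) : 0 <= A -> 0 < e ->
  exists N, forall n, (N <= n)%N -> A * 2^-1 ^+ n <= e.
Proof.
move=> A0 e0; have [N [N0 hN]] := nat_ge (A / e); exists N => n Nn.
rewrite exprVn ler_pdivrMr ?exprn_gt0// mulrC -ler_pdivrMr//.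
apply: le_trans hN _; rewrite -natrX ler_nat.
by apply: leq_trans Nn _; exact: ltnW (ltn_expl _ _).
Qed.

Lemma PS_lip r h a M (rho : R) z w : PS r h a M -> rho <= r / 4 ->
  cm z <= rho -> cm w <= rho ->
  cm (h z - h w - a 1%N * (z - w)) <= 8 * M / r ^+ 2 * rho * cm (z - w).
Proof.
move=> [r0 M0 aM H] rr zr wr; apply: le_eps => e e0.
have rho0 : 0 <= rho by apply: le_trans zr; exact: cm_ge0.
have e20 : 0 < e / 2 by lra.
have [K hK] := geo_small (mulr_ge0 M0 (ler0n _ 2)) e20.
pose n := K.+2; pose S z := \sum_(k < n) a k * z ^+ k.
have tl z' : cm z' <= rho -> cm (h z' - S z') <= e / 2.
  move=> zz; apply: le_trans (H z' _ n) _; first lra.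
  apply: le_trans (hK n _); last by rewrite /n; do 2 apply: leqW.
  rewrite ler_wpM2l ?mulr_ge0// lerXn2r ?nnegrE ?invr_ge0//.
    by rewrite divr_ge0 ?cm_ge0// ltW.
  by rewrite ler_pdivrMr//; lra.
have -> : h z - h w - a 1%N * (z - w) =
   (h z - S z) - (h w - S w) + (S z - S w - a 1%N * (z - w)) by ring.
apply: le_trans (cmD _ _) _.
have := cmB (h z - S z) (h w - S w); have := tl z zr; have := tl w wr.
suff : cm (S z - S w - a 1%N * (z - w)) <= 8 * M / r ^+ 2 * rho * cm (z - w) by lra.
have -> : S z - S w - a 1%N * (z - w) =
   \sum_(k < K) a k.+2 * (z ^+ k.+2 - w ^+ k.+2).
  rewrite /S -sumrB /n big_ord_recl big_ord_recl /= /bump /= !expr0 !expr1.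
  rewrite subrr add0r mulrBr addrAC subrr add0r.
  by apply: eq_bigr => i _; rewrite /bump/= !add1n mulrBr.
apply: le_trans (cm_sum _ _ _) _.
have t0 : 0 <= rho / r by rewrite divr_ge0// ltW.
have t1 : rho / r <= 1 / 4 by rewrite ler_pdivrMr//; lra.
have r2 : 0 <= (r ^+ 2)^-1 by rewrite invr_ge0; apply: exprn_ge0; exact: ltW.
have X0 : 0 <= M / r ^+ 2 * rho * cm (z - w) by rewrite !mulr_ge0 ?cm_ge0.
apply: (@le_trans _ _ (\sum_(k < K) M / r ^+ 2 * rho * cm (z - w) * (4 * 2^-1 ^+ k))).
  apply: ler_sum => k _; rewrite cmM.
  have h1 := subX_le k.+1 zr wr.
  apply: le_trans (ler_pM (cm_ge0 _) (cm_ge0 _) (aM _) h1) _.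
  have h2 : k.+2%:R * (rho / r) ^+ k <= 4 * 2^-1 ^+ k.
    have k2 : k.+2%:R <= 4 * 2 ^+ k :> R.
      elim: (k : nat) => [|j IH]; first by rewrite expr0; lra.
      by rewrite exprS -natr1; have := exprn_ege1 j (ler1n R 2 : 1 <= 2); lra.
    have t2 : (rho / r) ^+ k <= (4^-1) ^+ k.
      by rewrite lerXn2r ?nnegrE ?invr_ge0//; lra.
    apply: le_trans (ler_pM (ler0n _ _) (exprn_ge0 _ t0) k2 t2) _.
    apply: le_refl_eq; rewrite -mulrA -exprMn; congr (_ * _ ^+ _); by field.
  have -> : M * r^-1 ^+ k.+2 * (k.+2%:R * rho ^+ k.+1 * cm (z - w)) =
     M / r ^+ 2 * rho * cm (z - w) * (k.+2%:R * (rho / r) ^+ k).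
    by rewrite !exprS exprMn !exprVn; field; rewrite expf_neq0 gt_eqF.
  exact: ler_wpM2l.
rewrite -mulr_sumr -mulr_sumr.
have g : \sum_(k < K) (2^-1 : R) ^+ k <= 2.
  rewrite -(big_mkord xpredT (fun k => (2^-1 : R) ^+ k)).
  by apply: le_trans (@geo_half 2^-1 0 K _ _) _; rewrite ?expr0; lra.
have -> : 8 * M / r ^+ 2 * rho * cm (z - w) = M / r ^+ 2 * rho * cm (z - w) * (4 * 2) by ring.
by apply: ler_wpM2l => //; lra.
Qed.

Lemma PS_SD r h a M : PS r h a M -> SD h 0 (a 1%N).
Proof.
move=> P e e0; have [r0 M0 _ _] := P.
pose K := 8 * M / r ^+ 2; have K0 : 0 <= K.
  by rewrite divr_ge0 ?exprn_ge0 ?mulr_ge0// ltW.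
pose rho := Num.min (r / 4) (e / (K + 1)).
have K1 : 0 < K + 1 by lra.
exists rho; split; first by rewrite lt_min !divr_gt0.
move=> z w; rewrite !subr0 => zr wr.
apply: le_trans (PS_lip P _ zr wr) _; first by rewrite ge_min lexx.
apply: ler_wpM2r; first exact: cm_ge0.
have hh : rho <= e / (K + 1) by rewrite ge_min lexx orbT.
apply: le_trans (ler_wpM2l K0 hh) _; rewrite mulrA ler_pdivrMr//; nra.
Qed.

Lemma SD_shift (h : C -> C) (c d : C) : SD (fun z => h (c + z)) 0 d -> SD h c d.
Proof.
move=> sh e e0; have [r [r0 hr]] := sh e e0; exists r; split=> // a b ar br.
have := hr (a - c) (b - c); rewrite !subr0 => /(_ ar br).
have E x : c + (x - c) = x by ring.
have -> : a - c - (b - c) = a - b by ring.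
by rewrite !E.
Qed.

Lemma PS_shift r h a M m : PS r h a M -> (forall k, (k < m)%N -> a k = 0) ->
  let g z := if z == 0 then a m else h z / z ^+ m in
  PS r g (fun k => a (k + m)%N) (M * r^-1 ^+ m) /\
  forall z, cm z <= r / 2 -> h z = z ^+ m * g z.
Proof.
move=> P am g; have [r0 M0 aM H] := P; have rV : 0 <= r^-1 by rewrite invr_ge0 ltW.
have M1 : 0 <= M * r^-1 ^+ m by rewrite mulr_ge0// exprn_ge0.
split.
  split=> // [k|z zr K].
    by apply: le_trans (aM _) _; rewrite exprD mulrA mulrAC.
  rewrite /g; case: eqP => [->|/eqP z0].
    rewrite cm0 mul0r; case: K => [|K].
      rewrite big_ord0 subr0 expr0 mulr1; have := aM m; lra.
    rewrite big_ord_recl/= expr0 mulr1 add0n big1 ?addr0 ?subrr ?cm0.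
      by rewrite expr0n/= mulr0.
    by move=> i _; rewrite exprS mul0r mulr0.
  have zm : cm z ^+ m != 0 by rewrite expf_neq0// cm_eq0.
  have zm0 : 0 < cm z ^+ m by rewrite exprn_gt0// cm_gt0.
  have -> : h z / z ^+ m - \sum_(k < K) a (k + m)%N * z ^+ k =
     (h z - \sum_(k < m + K) a k * z ^+ k) / z ^+ m.
    have -> : \sum_(k < m + K) a k * z ^+ k = \sum_(k < K) a (k + m)%N * z ^+ (k + m).
      rewrite big_split_ord/= big1 ?add0r => [|i _]; last by rewrite am ?mul0r.
      by apply: eq_bigr => i _; rewrite [(m + i)%N]addnC.
    rewrite mulrBl; congr (_ - _); rewrite mulr_suml; apply: eq_bigr => i _.
    by rewrite exprD mulrA mulfK// expf_neq0.
  rewrite cmM cmV cmX ler_pdivrMr//; apply: le_trans (H z zr _) _.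
  apply: le_refl_eq; rewrite exprD exprMn; ring.
move=> z zr; rewrite /g; case: eqP => [->|/eqP z0].
  rewrite (PS_at0 P); case: m am {g M1} => [|m] am; first by rewrite expr0 mul1r.
  by rewrite am// exprS !mul0r.
by rewrite mulrC divfK// expf_neq0.
Qed.

Lemma PS_coef0 r h a M (d : R) : PS r h a M -> 0 < d ->
  (forall t : R, 0 < t -> t <= d -> h t%:C = 0) -> forall k, a k = 0.
Proof.
move=> [r0 M0 aM H] d0 h0 k; elim/ltn_ind: k => k IH.
apply: cm_eps0 => e e0.
have rV : 0 <= r^-1 by rewrite invr_ge0 ltW.
pose Q := M * 2 * r^-1 ^+ k.+1.
have Q0 : 0 <= Q by rewrite !mulr_ge0// exprn_ge0.
have Q1 : 0 < Q + 1 by lra.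
pose t := Num.min (Num.min d (r / 2)) (e / (Q + 1)).
have t0 : 0 < t by rewrite !lt_min d0 !divr_gt0.
have td : t <= d by rewrite !ge_min lexx.
have tr : t <= r / 2 by rewrite !ge_min lexx orbT.
have te : t <= e / (Q + 1) by rewrite !ge_min lexx !orbT.
have ct : cm t%:C = t by rewrite cm_real gtr0_norm.
have := H t%:C; rewrite ct => /(_ tr k.+1).
rewrite h0// sub0r cmN big_ord_recr/= big1 ?add0r => [|i _]; last first.
  by rewrite IH// mul0r.
rewrite cmM cmX ct exprMn => h1.
have tk : 0 < t ^+ k by rewrite exprn_gt0.
have : cm (a k) <= Q * t.
  rewrite -(ler_pM2r tk); apply: le_trans h1 _; rewrite /Q [t ^+ k.+1]exprS.
  by apply: le_refl_eq; ring.
move=> h2; apply: le_trans h2 _; apply: le_trans (ler_wpM2l Q0 te) _.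
rewrite mulrA ler_pdivrMr//; nra.
Qed.

Lemma PS_zero r h a M : PS r h a M -> (forall k, (0 < k)%N -> a k = 0) ->
  forall z, cm z <= r / 2 -> h z = a 0%N.
Proof.
move=> [r0 M0 aM H] a0 z zr; apply: cm_eps_eq => e e0.
have [K hK] := geo_small (mulr_ge0 M0 (ler0n _ 2)) e0.
have := H z zr K.+1; rewrite big_ord_recl/= expr0 mulr1 big1 ?addr0 => [h1|i _]; last first.
  by rewrite a0// mul0r.
apply: le_trans h1 _; apply: le_trans (hK K.+1 (leqnSn _)).
rewrite ler_wpM2l ?mulr_ge0// lerXn2r ?nnegrE ?invr_ge0//.
  by rewrite divr_ge0 ?cm_ge0// ltW.
by rewrite ler_pdivrMr//; lra.
Qed.

(** * Inverses of injective functions *)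

Lemma newton (f : C -> C) (rho : R) : 0 < rho ->
  (forall a b, cm a <= rho -> cm b <= rho ->
     cm (f a - f b - (a - b)) <= 2^-1 * cm (a - b)) ->
  cm (f 0) <= rho / 2 -> exists k, cm k <= rho /\ f k = 0.
Proof.
move=> rho0 lf f0.
pose x n := iter n (fun y => y - f y) (0 : C).
have xS n : x n.+1 - x n = - f (x n) by rewrite /x iterS; ring.
have key n : cm (x n) <= rho * (1 - 2^-1 ^+ n) /\ cm (f (x n)) <= rho / 2 * 2^-1 ^+ n.
  have x00 : x 0%N = 0 by [].
  elim: n => [|n [h1 h2]]; first by rewrite x00 expr0 subrr mulr0 mulr1 cm0.
  have p0 : 0 <= (2^-1 : R) ^+ n by rewrite exprn_ge0// invr_ge0.
  have b1 : cm (x n.+1) <= rho * (1 - 2^-1 ^+ n.+1).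
    rewrite -[x n.+1](subrK (x n)) xS exprS; apply: le_trans (cmD _ _) _.
    rewrite cmN; lra.
  split=> //.
  have q0 : 0 <= (2^-1 : R) ^+ n.+1 by rewrite exprn_ge0// invr_ge0.
  have := lf (x n.+1) (x n) _ _; rewrite xS opprK subrK cmN => H.
  apply: le_trans (H _ _) _; [nra|nra|rewrite exprS; lra].
have pw_ge0 n : 0 <= (2^-1 : R) ^+ n by rewrite exprn_ge0// invr_ge0.
have diff n m : (n <= m)%N -> cm (x m - x n) <= rho * 2^-1 ^+ n.
  move=> nm; suff : cm (x m - x n) <= rho * (2^-1 ^+ n - 2^-1 ^+ m).
    by have := pw_ge0 m; nra.
  elim: m nm => [|m IH]; first by rewrite leqn0 => /eqP->; rewrite !subrr cm0 mulr0.
  rewrite leq_eqVlt => /predU1P[->|nm]; first by rewrite !subrr cm0 mulr0.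
  apply: le_trans (cm_triB _ (x m) _) _; rewrite xS cmN.
  have := IH nm; have [_] := key m; rewrite exprS; lra.
have [k hk] : exists k, tends x k.
  apply: cauchy_tends => e e0; have [N hN] := geo_small (ltW rho0) e0.
  by exists N => n m Nn nm; apply: le_trans (diff _ _ nm) _; exact: hN.
have kr : cm k <= rho.
  apply: (tends_le hk); exists 0%N => n _; have [h _] := key n.
  by have := pw_ge0 n; nra.
exists k; split=> //; apply: cm_eps0 => e e0.
have e40 : 0 < e / 4 by lra.
have [N hN] := geo_small (ltW rho0) e40; have [N' hN'] := hk _ e40.
pose n := maxn N N'; have Nn : (N <= n)%N := leq_maxl _ _.
have := hN' n (leq_maxr _ _); have := hN n Nn; have [h1 h2] := key n.
have xr : cm (x n) <= rho by apply: le_trans h1 _; have := pw_ge0 n; nra.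
have := lf k (x n) kr xr; rewrite [cm (k - x n)]cmBC => h3 h4 h5.
have -> : f k = (f k - f (x n) - (k - x n)) + f (x n) - (x n - k) by ring.
apply: le_trans (cmB _ _) _.
have := cmD (f k - f (x n) - (k - x n)) (f (x n)); lra.
Qed.

Lemma root_of_unity m : (1 < m)%N -> exists w : C, w ^+ m = 1 /\ w != 1.
Proof.
move=> m1; have m0 : (0 < m)%N by exact: ltnW.
have mR : 0 < m%:R :> R by rewrite ltr0n.
pose t : R := (pi *+ 2) / m%:R; exists (ex (0 +i* t)); split.
  rewrite -exMn.
  have -> : (0 +i* t) *+ m = 0 +i* (pi *+ 2).
    rewrite -mulr_natl -(rmorph_nat (real_complex R)).
    apply: complex_ext; rewrite ?reMr ?imMr /= ?mulr0//.
    by rewrite /t mulrC divfK// gt_eqF.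
  by rewrite /ex /= expR0 cos2pi sin2pi mulr0 mulr1.
apply/negP => /eqP/(congr1 re); rewrite /ex /= expR0 mul1r => h.
have t0 : 0 < t by rewrite divr_gt0// mulrn_wgt0// pi_gt0.
have tp : t <= pi.
  rewrite /t ler_pdivrMr// -[pi *+ 2]mulr_natr ler_wpM2l ?pi_ge0//.
  by rewrite ler_nat.
have := @ltr_cos R 0 t; rewrite !in_itv/= lexx pi_ge0 (ltW t0) tp => /(_ isT isT).
by rewrite cos0 h ltxx t0.
Qed.

Lemma SD_pow1 m : SD (fun k : C => (1 + k) ^+ m) 0 m%:R.
Proof.
elim: m => [|m IH].
  by apply: (SD_ext ltr01 _ (SD_cst 1 0)) => a _; rewrite expr0.
have h1 : SD (fun k : C => 1 + k) 0 (0 + 1) by exact: SD_add (SD_cst 1 0) (SD_id 0).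
rewrite add0r in h1.
have := SD_mul h1 IH; rewrite addr0 expr1n !mul1r => h2.
rewrite -natr1 addrC.
by apply: (SD_ext ltr01 _ h2) => a _; rewrite exprS.
Qed.


(* If [h - a 0] vanished to order [m >= 2] it would be [z ^+ m] times a nearly
   constant factor, so it would agree at points near [xi] and [w * xi] for an
   [m]-th root of unity [w != 1]. *)
Lemma PS_inj r h a M (d : R) : PS r h a M -> 0 < d ->
  (forall z w, cm z <= d -> cm w <= d -> h z = h w -> z = w) -> a 1%N != 0.
Proof.
move=> P d0 hinj; have [r0 M0 aM H] := P; apply/negP => /eqP a10.
have [[k0 k01 ak0]|none] := pselect (exists2 k, (0 < k)%N & a k != 0); last first.
  have a0 k : (0 < k)%N -> a k = 0.
    by move=> k1; apply/eqP/negPn/negP => ak; apply: none; exists k.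
  pose t := Num.min d (r / 2); have t0 : 0 < t by rewrite lt_min d0 divr_gt0.
  have ct : cm t%:C = t by rewrite cm_real gtr0_norm.
  have : t%:C = 0 :> C.
    have E1 : h t%:C = a 0%N.
      by apply: (PS_zero P a0); rewrite ct ge_min lexx orbT.
    have E2 : h 0 = a 0%N := PS_at0 P.
    apply: hinj; [by rewrite ct ge_min lexx|by rewrite cm0; exact: ltW|by rewrite E1 E2].
  by move=> /(congr1 cm); rewrite ct cm0 => tt; rewrite tt ltxx in t0.
have ex0 : exists k, (0 < k)%N && (a k != 0) by exists k0; rewrite k01.
case: (ex_minnP ex0) => m /andP[m0 am] mmin.
have m1 : (1 < m)%N.
  by case: m m0 am {mmin} => [|[|m]]//; rewrite a10 eqxx.
pose h1 z := h z - a 0%N; pose a1 k := if k is 0%N then 0 else a k.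
have P1 : PS r h1 a1 M.
  split=> // [[|k]|z zr [|K]]; first by rewrite cm0 expr0 mulr1.
  - exact: aM.
  - rewrite big_ord0 subr0 expr0 mulr1 /h1.
    have := H z zr 1%N; rewrite big_ord_recr big_ord0/= expr0 mulr1 add0r expr1.
    have : cm z / r <= 1 by rewrite ler_pdivrMr//; lra.
    move=> q1 q2; apply: le_trans q2 _; rewrite ler_piMr// mulr_ge0//.
  - have := H z zr K.+1; rewrite !big_ord_recl/= !expr0 mulr1 mul0r add0r.
    by rewrite /h1 opprD addrA.
have a1m k : (k < m)%N -> a1 k = 0.
  case: k => // k km; apply/eqP/negPn/negP => ak.
  by have := mmin k.+1; rewrite ak/= => /(_ isT); rewrite leqNgt km.
have [] := PS_shift P1 a1m; set g := fun z => _ => Pg hg.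
have g0 : g 0 = a m by rewrite /g eqxx; case: (m) m0.
pose L := (cm (a1 (1 + m)%N) + 8 * (M * r^-1 ^+ m) / r ^+ 2 * (r / 4)) / cm (a m).
have am0 : 0 < cm (a m) by rewrite cm_gt0.
have M1 : 0 <= M * r^-1 ^+ m by rewrite mulr_ge0// exprn_ge0// invr_ge0 ltW.
have L0 : 0 <= L.
  apply: divr_ge0; last exact: ltW.
  apply: addr_ge0; first exact: cm_ge0.
  have r2 : 0 <= (r ^+ 2)^-1 by rewrite invr_ge0; apply: exprn_ge0; exact: ltW.
  have r4 : 0 <= r / 4 by lra.
  by do 3! apply: mulr_ge0 => //.
have gL z w : cm z <= r / 4 -> cm w <= r / 4 -> cm (g z / a m - g w / a m) <= L * cm (z - w).
  move=> zr wr; rewrite -mulrBl cmM cmV /L mulrAC ler_pM2r ?invr_gt0//.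
  have := PS_lip Pg (lexx _) zr wr.
  have := cm_lB (g z - g w) (a1 (1 + m)%N * (z - w)); rewrite cmM; lra.
have [w [wm w1]] := root_of_unity m1.
have cw : cm w = 1.
  apply/eqP; have := congr1 cm wm; rewrite cmX cm1 => /eqP.
  by rewrite pexpr_eq1 ?cm_ge0.
have mR : 0 < m%:R :> R by rewrite ltr0n.
have e10 : 0 < (4^-1 : R) by rewrite invr_gt0.
have [rp [rp0 hrp]] := SD_pow1 m e10.
pose rho := Num.min (Num.min rp 1) (cm (1 - w) / 4).
have w10 : 0 < cm (1 - w) by rewrite cm_gt0 subr_eq0 eq_sym.
have rho0 : 0 < rho by rewrite !lt_min rp0 ltr01 divr_gt0.
have rho1 : rho <= 1 by rewrite !ge_min lexx orbT.
have rhop : rho <= rp by rewrite !ge_min lexx.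
have rhow : rho <= cm (1 - w) / 4 by rewrite ge_min lexx orbT.
pose Q := (2 * (m%:R + 1) + 2 ^+ m) * (L + 1).
have p2 : 1 <= 2 ^+ m :> R by rewrite exprn_ege1// ler1n.
have Q0 : 0 < Q by rewrite mulr_gt0//; lra.
pose x := Num.min (Num.min (r / 8) (d / 2)) (Num.min (4^-1 / Q) (rho / 4 / (L + 1))).
have x0 : 0 < x by rewrite !lt_min !divr_gt0//; lra.
have xr : x <= r / 8 by rewrite !ge_min lexx.
have xd : x <= d / 2 by rewrite !ge_min lexx orbT.
have xQ : Q * x <= 4^-1 by rewrite mulrC -ler_pdivlMr// !ge_min lexx !orbT.
have xL : L * x <= rho / 4.
  have : x * (L + 1) <= rho / 4 by rewrite -ler_pdivlMr ?ge_min ?lexx ?orbT//; lra.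
  by have := ltW x0; nra.
have Lx0 : 0 <= L * x by apply: mulr_ge0 => //; exact: ltW.
have sol (xi : C) : cm xi = x -> exists k, cm k <= rho /\
    h (xi * (1 + k)) = a 0%N + xi ^+ m * a m.
  move=> cxi.
  pose f k := ((1 + k) ^+ m * (g (xi * (1 + k)) / a m) - 1) / m%:R.
  have near k : cm k <= rho -> cm (xi * (1 + k)) <= r / 4.
    move=> kr; rewrite cmM cxi; have := cmD 1 k; rewrite cm1 => q.
    have : x * cm (1 + k) <= r / 8 * 2 by apply: ler_pM; rewrite ?cm_ge0//; lra.
    lra.
  have G1 k k' : cm k <= rho -> cm k' <= rho ->
      cm (g (xi * (1 + k)) / a m - g (xi * (1 + k')) / a m) <= L * x * cm (k - k').
    move=> kr kr'; apply: le_trans (gL _ _ (near _ kr) (near _ kr')) _.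
    have -> : xi * (1 + k) - xi * (1 + k') = xi * (k - k') by ring.
    by rewrite cmM cxi mulrA.
  have G0 k : cm k <= rho -> cm (g (xi * (1 + k)) / a m - 1) <= 2 * L * x.
    move=> kr; have E0 : g 0 / a m = 1 by rewrite g0 divff.
    have z0r : cm 0 <= r / 4 by rewrite cm0; lra.
    rewrite -[X in cm (_ - X)]E0; apply: le_trans (gL _ _ (near _ kr) z0r) _.
    rewrite subr0 cmM cxi; have := cmD 1 k; rewrite cm1 => q.
    have : cm (1 + k) * (L * x) <= 2 * (L * x).
      by apply: ler_wpM2r => //; lra.
    lra.
  have [||k [kr fk]] := @newton f rho rho0.
  - move=> k k' kr kr'.
    have q1 := hrp k k'; rewrite !subr0 in q1.
    have {}q1 := q1 (le_trans kr rhop) (le_trans kr' rhop).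
    have q2 := G1 k k' kr kr'; have q3 := G0 k kr.
    set p := (1 + k) ^+ m in q1; set p' := (1 + k') ^+ m in q1.
    set G := g (xi * (1 + k)) / a m in q2 q3; set G' := g (xi * (1 + k')) / a m in q2.
    have q4 : cm p' <= 2 ^+ m.
      rewrite cmX lerXn2r ?nnegrE ?cm_ge0//.
      by have := cmD 1 k'; rewrite cm1; lra.
    have q5 : cm (p - p') <= (m%:R + 1) * cm (k - k').
      have := cm_lB (p - p') (m%:R * (k - k')); rewrite cmM cm_nat.
      have := cm_ge0 (k - k'); lra.
    have -> : f k - f k' - (k - k') = ((p - p' - m%:R * (k - k')) +
        (p - p') * (G - 1) + p' * (G - G')) / m%:R.
      rewrite /f -/p -/p' -/G -/G'; field.
      by rewrite -cm_eq0 cm_nat gt_eqF.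
    rewrite cmM cmV cm_nat ler_pdivrMr//.
    apply: le_trans (cmD _ _) _; rewrite cmM.
    have q6 : cm (p' ) * cm (G - G') <= 2 ^+ m * (L * x * cm (k - k')).
      by apply: ler_pM; rewrite ?cm_ge0.
    have q7 : cm (p - p') * cm (G - 1) <= (m%:R + 1) * cm (k - k') * (2 * L * x).
      by apply: ler_pM; rewrite ?cm_ge0.
    have := cmD (p - p' - m%:R * (k - k')) ((p - p') * (G - 1)); rewrite cmM => q8.
    have D0 := cm_ge0 (k - k').
    have q9 : (2 * (m%:R + 1) + 2 ^+ m) * (L * x) <= 4^-1.
      apply: le_trans xQ; rewrite /Q -mulrA; apply: ler_wpM2l; first lra.
      by rewrite mulrDl lerDl mul1r; exact: ltW.
    have q10 : ((2 * (m%:R + 1) + 2 ^+ m) * (L * x)) * cm (k - k') <= 4^-1 * cm (k - k').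
      by rewrite ler_wpM2r.
    have q11 : 1 * cm (k - k') <= m%:R * cm (k - k').
      by rewrite ler_wpM2r// ler1n.
    have q12 : 2 ^+ m * (L * x * cm (k - k')) + (m%:R + 1) * cm (k - k') * (2 * L * x) =
       (2 * (m%:R + 1) + 2 ^+ m) * (L * x) * cm (k - k') by ring.
    rewrite mul1r in q11.
    have q13 := lerD q6 q7; rewrite q12 in q13.
    have q14 : 2^-1 * cm (k - k') <= 2^-1 * cm (k - k') * m%:R.
      by rewrite -mulrA ler_pM2l ?invr_gt0// mulrC.
    apply: le_trans q14; apply: le_trans (lerD q8 (lexx _)) _.
    move: q13 q10 q1; clear; lra.
  - rewrite /f addr0 expr1n mul1r cmM cmV cm_nat ler_pdivrMr//.
    have := G0 0; rewrite cm0 addr0 => /(_ (ltW rho0)) q.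
    have : 1 * rho <= m%:R * rho by apply: ler_wpM2r; [exact: ltW|rewrite ler1n].
    lra.
  exists k; split=> //.
  have : (1 + k) ^+ m * (g (xi * (1 + k)) / a m) = 1.
    apply/eqP; rewrite -subr_eq0; apply/eqP.
    have mC : m%:R != 0 :> C by rewrite -cm_eq0 cm_nat gt_eqF.
    by move: fk; rewrite /f => /eqP; rewrite mulf_eq0 invr_eq0 (negbTE mC) orbF => /eqP.
  move=> E; have rr : r / 4 <= r / 2 by lra.
  have hh : h (xi * (1 + k)) - a 0%N = (xi * (1 + k)) ^+ m * g (xi * (1 + k)).
    exact: hg (le_trans (near k kr) rr).
  rewrite -[LHS](subrK (a 0%N)) hh addrC exprMn; congr (_ + _).
  transitivity ((1 + k) ^+ m * (g (xi * (1 + k)) / a m) * (xi ^+ m * a m)).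
    by field.
  by rewrite E mul1r.
have cx : cm x%:C = x by rewrite cm_real gtr0_norm.
have [k [kr hk]] := sol x%:C cx.
have [k' [kr' hk']] := sol (w * x%:C) ltac:(by rewrite cmM cw mul1r).
have small (xi j : C) : cm xi = x -> cm j <= rho -> cm (xi * (1 + j)) <= d.
  move=> cxi jr; rewrite cmM cxi; have := cmD 1 j; rewrite cm1 => q.
  have : x * cm (1 + j) <= d / 2 * 2 by apply: ler_pM; rewrite ?cm_ge0//; lra.
  lra.
have E : x%:C * (1 + k) = w * x%:C * (1 + k').
  apply: hinj; first exact: small; first by apply: small => //; rewrite cmM cw mul1r.
  by rewrite hk hk' exprMn wm mul1r.
have xC : x%:C != 0 :> C by rewrite -cm_eq0 cx gt_eqF.
have : 1 - w = w * k' - k.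
  apply: (mulfI xC); have -> : x%:C * (1 - w) = x%:C * (1 + k) - w * x%:C * (1 + k') + x%:C * (w * k' - k) by ring.
  by rewrite E subrr add0r.
move=> /(congr1 cm) F; have := cmB (w * k') k; rewrite -F cmM cw mul1r; lra.
Qed.

Lemma local_surj (u : C -> C) z0 d (r : R) : SD u z0 d -> d != 0 -> 0 < r ->
  exists eta, 0 < eta /\ forall w, cm (w - u z0) <= eta ->
    exists z, cm (z - z0) <= r /\ u z = w.
Proof.
move=> su d0 r0; have cd : 0 < cm d by rewrite cm_gt0.
have e0 : 0 < cm d / 2 by rewrite divr_gt0.
have [s [s0 hs]] := su _ e0.
pose rho := Num.min r s; have rho0 : 0 < rho by rewrite lt_min r0.
exists (cm d * rho / 2); split; first by rewrite divr_gt0// mulr_gt0.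
move=> w hw; pose f k := (u (z0 + k) - w) / d.
have [||k [kr fk]] := @newton f rho rho0.
- move=> a b ar br.
  have := hs (z0 + a) (z0 + b).
  have E x : z0 + x - z0 = x by ring.
  have -> : z0 + a - (z0 + b) = a - b by ring.
  have rs : rho <= s by rewrite ge_min lexx orbT.
  rewrite !E => /(_ (le_trans ar rs) (le_trans br rs)).
  have -> : f a - f b - (a - b) = (u (z0 + a) - u (z0 + b) - d * (a - b)) / d.
    by rewrite /f; field.
  by rewrite cmM cmV ler_pdivrMr// => h; apply: le_trans h _; lra.
- rewrite /f addr0 cmM cmV ler_pdivrMr// cmBC; lra.
exists (z0 + k); split.
  have -> : z0 + k - z0 = k by ring.
  by apply: le_trans kr _; rewrite ge_min lexx.
apply/eqP; rewrite -subr_eq0; apply/eqP.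
by move: fk => /eqP; rewrite mulf_eq0 invr_eq0 (negbTE d0) orbF => /eqP.
Qed.

Lemma SD_inverse (u V : C -> C) (P : C -> Prop) z0 d (r : R) : SD u z0 d -> d != 0 ->
  0 < r -> (forall z, cm (z - z0) <= r -> P z) -> (forall z, P z -> V (u z) = z) ->
  SD V (u z0) d^-1.
Proof.
move=> su d0 r0 rP VK e e0; have cd : 0 < cm d by rewrite cm_gt0.
pose e1 := Num.min (cm d / 2) (e * cm d ^+ 2 / 2).
have e10 : 0 < e1 by rewrite lt_min !divr_gt0 ?mulr_gt0 ?exprn_gt0.
have e1d : e1 <= cm d / 2 by rewrite ge_min lexx.
have e1e : e1 <= e * cm d ^+ 2 / 2 by rewrite ge_min lexx orbT.
have [s [s0 hs]] := su _ e10.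
have t0 : 0 < Num.min r s by rewrite lt_min r0.
have [eta [eta0 heta]] := local_surj su d0 t0.
exists eta; split=> // a b /heta[z [zr <-]] /heta[z' [zr' <-]].
move: zr zr'; rewrite !le_min => /andP[zr zs] /andP[zr' zs'].
rewrite !VK; try exact: rP.
have h := hs z z' zs zs'.
have -> : z - z' - d^-1 * (u z - u z') = - (d^-1 * (u z - u z' - d * (z - z'))).
  by field.
rewrite cmN cmM cmV ler_pdivrMl//.
have h2 : cm d / 2 * cm (z - z') <= cm (u z - u z').
  have := cm_lB (d * (z - z')) (d * (z - z') - (u z - u z')).
  have -> : d * (z - z') - (d * (z - z') - (u z - u z')) = u z - u z' by ring.
  rewrite cmM [cm (_ - (u z - u z'))]cmBC; have := cm_ge0 (z - z'); nra.
apply: le_trans h _; have D0 := cm_ge0 (z - z').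
apply: (@le_trans _ _ (e * cm d * (cm d / 2 * cm (z - z')))).
  have : e1 * cm (z - z') <= e * cm d ^+ 2 / 2 * cm (z - z') by rewrite ler_wpM2r.
  by rewrite expr2; lra.
have -> : cm d * (e * cm (u z - u z')) = e * cm d * cm (u z - u z') by ring.
by apply: ler_wpM2l => //; apply: mulr_ge0; exact: ltW.
Qed.

End PowerSeries.

Section MoreDirichlet.
Context {R : realType}.
Local Notation C := R[i].

Lemma lnS_large (X : R) : exists K, forall k, (K <= k)%N -> X <= lnS k.
Proof.
have [K [K0 hK]] := nat_ge (expR X); exists K => k Kk.
rewrite -ler_expR expR_lnS; apply: le_trans hK _; rewrite ler_nat.
exact: leq_trans Kk (leqnSn _).
Qed.

Lemma expR_lnS_small (y e : R) : 0 < y -> 0 < e ->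
  exists K, forall k, (K <= k)%N -> expR (- (lnS k * y)) <= e.
Proof.
move=> y0 e0; have [X hX] := expR_small y0 e0; have [K hK] := lnS_large X.
by exists K => k /hK/hX; rewrite mulrC.
Qed.

Lemma DCoef_tends x h (a : nat -> C) s : DCoef x h a -> x + 3 < re s ->
  tends (fun K => \sum_(k < K) a k * dn k s) (h s).
Proof.
move=> ch xs e e0.
have [M [M0 hM]] := DApp_bounded (Coef_App ch).
have aM := DCoef_bound ch hM.
have y0 : 0 < re s - x - 3 by lra.
have K0 : 0 < 2 * (M + 1) by lra.
have [K hK] := expR_lnS_small y0 (divr_gt0 e0 K0).
exists K => k Kk; rewrite cmBC.
apply: le_trans (DCoef_tail _ ch M0 aM (ltW xs)) _.
have := hK k Kk; rewrite ler_pdivlMr//; have := expR_ge0 (- (lnS k * (re s - x - 3))).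
nra.
Qed.

Lemma ex_lip (a b : C) (m : R) : re a <= m -> re b <= m ->
  cm (ex a - ex b) <= 5 * expR m * cm (a - b).
Proof.
have aux z : re z <= 0 -> cm (ex z - 1) <= 5 * cm z.
  move=> z0; have [z1|z1] := leP (cm z) (1/2).
    have := ex_sub1 z1; have := cm_lB (ex z - 1) z; have := cm_ge0 z; nra.
  have : cm (ex z) <= 1 by rewrite cm_ex expR_le1.
  have := cmB (ex z) 1; rewrite cm1; lra.
wlog ab : a b / re a <= re b => [H am bm|am bm].
  by have [/H|/ltW/H] := leP (re a) (re b); [exact|rewrite cmBC (cmBC a); exact].
have -> : ex a - ex b = ex b * (ex (a - b) - 1) by rewrite mulrBr mulr1 -exD [b + _]addrC subrK.
rewrite cmM cm_ex [5 * _]mulrC -mulrA; apply: ler_pM; rewrite ?expR_ge0 ?cm_ge0//.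
  by rewrite ler_expR.
by apply: aux; rewrite reB; lra.
Qed.

Lemma DApp_contract x h : DApp x h ->
  exists x1 : R, x <= x1 /\ forall y, x1 <= y -> forall s t : C, y < re s -> y < re t ->
    cm (h s - h t) <= 2^-1 * cm (s - t).
Proof.
move=> ah; have [a ch] := DApp_coef ah.
have [M [M0 hM]] := DApp_bounded ah; have aM := DCoef_bound ch hM.
have l10 : 0 < lnS 1 :> R by have := @lnS_incr R 0 1 isT; rewrite lnS0.
have K0 : 0 < 20 * (M + 1) by lra.
have [Y hY] := expR_small l10 (divr_gt0 ltr01 K0).
have Y0 : 0 <= Num.max Y 0 by rewrite le_max lexx orbT.
have YY : Y <= Num.max Y 0 by rewrite le_max lexx.
exists (Num.max Y 0 + x + 4); split; first lra.
move=> y1 xy s t xs xt; apply: le_eps => e e0.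
have e20 : 0 < e / 2 by lra.
have [N hN] := @DCoef_tends x h a s ch ltac:(lra) _ e20.
have [N' hN'] := @DCoef_tends x h a t ch ltac:(lra) _ e20.
pose n := maxn N N'; pose S z := \sum_(k < n) a k * dn k z.
have h1 : cm (S s - h s) <= e / 2 := hN n (leq_maxl _ _).
have h2 : cm (S t - h t) <= e / 2 := hN' n (leq_maxr _ _).
suff h3 : cm (S s - S t) <= 2^-1 * cm (s - t).
  have -> : h s - h t = (S s - S t) - (S s - h s) + (S t - h t) by ring.
  apply: le_trans (cmD _ _) _; have := cmB (S s - S t) (S s - h s); lra.
rewrite /S -sumrB; apply: le_trans (cm_sum _ _ _) _.
pose q : R := 5 * M / (20 * (M + 1)).
have q0 : 0 <= q by apply: divr_ge0; [exact: mulr_ge0|exact: ltW].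
apply: (@le_trans _ _ (\sum_(k < n) (k.+1%:R^-1) ^+ 2 * (q * cm (s - t)))).
  apply: ler_sum => k _; rewrite -mulrBr cmM.
  have D0 := cm_ge0 (s - t).
  have [->|k0] := posnP (k : nat).
    by rewrite !dn_one subrr cm0 mulr0; do 2! apply: mulr_ge0 => //; exact: sqr_ge0.
  have r1 z : y1 < re z -> re (- ((lnS k)%:C * z)) <= - (lnS k * y1).
    by move=> xz; rewrite reN reMr lerN2 ler_wpM2l ?lnS_ge0// ltW.
  have := ex_lip (r1 s xs) (r1 t xt).
  have -> : - ((lnS k)%:C * s) - - ((lnS k)%:C * t) = (lnS k)%:C * (t - s) by ring.
  rewrite cmM cm_real ger0_norm ?lnS_ge0// (cmBC t) => h3.
  apply: le_trans (ler_pM (cm_ge0 _) (cm_ge0 _) (aM k) h3) _.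
  have lk : lnS k <= expR (lnS k) :> R.
    by apply: le_trans (expR_ge1Dx _); rewrite lerDr.
  have y0 : 0 <= y1 - x - 4 by lra.
  have ek : expR (- (lnS k * (y1 - x - 4))) <= (20 * (M + 1))^-1.
    have : expR (- (lnS 1 * (y1 - x - 4))) <= (20 * (M + 1))^-1.
      by rewrite -[leRHS]mul1r; apply: hY; lra.
    apply: le_trans; rewrite ler_expR lerN2 ler_wpM2r//.
    by move: k0; rewrite leq_eqVlt => /predU1P[<-//|/(@lnS_incr R)/ltW].
  have E : wgt x k * expR (lnS k) * expR (- (lnS k * y1)) =
     expR (- (2 * lnS k)) * expR (- (lnS k * (y1 - x - 4))).
    by rewrite /wgt -!expRD; congr expR; ring.
  have W0 := wgt_ge0 x k; have X0 := expR_ge0 (- (lnS k * y1)).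
  apply: (@le_trans _ _ (5 * M * (wgt x k * expR (lnS k) * expR (- (lnS k * y1))) * cm (s - t))).
    have -> : wgt x k * M * (5 * expR (- (lnS k * y1)) * (lnS k * cm (s - t))) =
      5 * M * (wgt x k * lnS k * expR (- (lnS k * y1))) * cm (s - t) by ring.
    apply: ler_wpM2r => //; apply: ler_wpM2l; first by rewrite mulr_ge0.
    by apply: ler_wpM2r => //; apply: ler_wpM2l.
  rewrite E expR_lnS2 /q.
  have -> : 5 * M * (k.+1%:R^-1 ^+ 2 * expR (- (lnS k * (y1 - x - 4)))) * cm (s - t) =
    k.+1%:R^-1 ^+ 2 * (5 * M * expR (- (lnS k * (y1 - x - 4))) * cm (s - t)) by ring.
  apply: ler_wpM2l; first exact: sqr_ge0.
  apply: ler_wpM2r => //; apply: ler_wpM2l => //; by rewrite mulr_ge0.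
rewrite -mulr_suml; apply: (@le_trans _ _ (2 * (q * cm (s - t)))).
  by apply: ler_wpM2r; [rewrite mulr_ge0 ?cm_ge0|exact: sum_invsq_le2].
rewrite mulrA; apply: ler_wpM2r; first exact: cm_ge0.
rewrite /q mulrA ler_pdivrMr//; lra.
Qed.

End MoreDirichlet.

(** * The Koenigs map *)

Section Koenigs.
Context {R : realType}.
Local Notation C := R[i].
Variables (u th : C -> C).
Hypothesis th_App : forall x, 0 < x -> DApp x th.
Hypothesis uE : forall s, 0 < re s -> u s = s + th s.

(* The inverse of [u] far to the right, by iterating [t -> - th (s + t)]. *)
Lemma far_inverse : exists (x1 x2 : R) (v : C -> C),
  [/\ 5 <= x1, x1 <= x2, DApp x2 (fun s => v s - s) &
   forall s, x2 < re s -> x1 < re (v s) /\ u (v s) = s].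
Proof.
have a1 := th_App ltr01; have [y [y1 hy]] := DApp_contract a1.
pose x1 := Num.max y 5; have x13 : 5 <= x1 by rewrite le_max lexx orbT.
have yx : y <= x1 by rewrite le_max lexx.
have lip := hy x1 yx.
have [B [B0 hB]] := DApp_bounded a1.
pose x2 := x1 + B.
pose t n s := iter n (fun z => - th (s + z)) (0 : C).
have tB n s : x2 < re s -> cm (t n s) <= B.
  move=> xs; elim: n => [|n IH]; first by rewrite [t _ _]/(0 : C) cm0.
  rewrite [t _ _]/(- th (s + t n s)) cmN; apply: hB; rewrite reD.
  by have := re_ge (t n s); rewrite /x2 in xs; lra.
have tx n s : x2 < re s -> x1 < re (s + t n s).
  by move=> xs; rewrite reD; have := re_ge (t n s); have := tB n s xs; rewrite /x2 in xs; lra.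
have tA n : DApp x2 (t n).
  elim: n => [|n IH]; first exact: (App_cst _ (@dn_one R) 0).
  apply: (App_ext (h := fun s => (-1) * th (s + t n s))).
    by move=> s _; rewrite mulN1r.
  have aT : DApp x2 (fun s => th (s + t n s)).
    by apply: (DApp_comp a1 IH) => s xs; have := tx n s xs => h; apply: lt_trans h; lra.
  exact: (App_scal (-1) aT).
have diff n s : x2 < re s -> cm (t n.+1 s - t n s) <= B * 2^-1 ^+ n.
  move=> xs; elim: n => [|n IH].
    by rewrite expr0 mulr1 [t 0%N s]/(0 : C) subr0; exact: tB.
  rewrite [t n.+2 s]/(- th (s + t n.+1 s)) {2}[t n.+1 s]/(- th (s + t n s)).
  rewrite -opprD cmN; apply: le_trans (lip _ _ (tx _ _ xs) (tx _ _ xs)) _.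
  have -> : s + t n.+1 s - (s + t n s) = t n.+1 s - t n s by ring.
  rewrite exprS; lra.
have diff2 n m s : x2 < re s -> (n <= m)%N -> cm (t m s - t n s) <= B * 2 * 2^-1 ^+ n.
  move=> xs nm; suff : cm (t m s - t n s) <= B * 2 * (2^-1 ^+ n - 2^-1 ^+ m).
    have : 0 <= (2^-1 : R) ^+ m by rewrite exprn_ge0// invr_ge0.
    by nra.
  elim: m nm => [|m IH]; first by rewrite leqn0 => /eqP->; rewrite !subrr cm0 mulr0.
  rewrite leq_eqVlt => /predU1P[->|nm]; first by rewrite !subrr cm0 mulr0.
  apply: le_trans (cm_triB _ (t m s) _) _.
  have := IH nm; have := diff m s xs; rewrite exprS; lra.
have B20 : 0 <= B * 2 by rewrite mulr_ge0.
have /choice[z hz] : forall s, exists l, x2 < re s -> tends (t^~ s) l.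
  move=> s; have [xs|xs] := ltP x2 (re s); last by exists 0.
  have [l hl] : exists l, tends (t^~ s) l.
    apply: cauchy_tends => e e0; have [N hN] := geo_small B20 e0.
    by exists N => n m Nn nm; apply: le_trans (diff2 _ _ _ xs nm) _; exact: hN.
  by exists l.
have zt n s : x2 < re s -> cm (z s - t n s) <= B * 2 * 2^-1 ^+ n.
  move=> xs; apply: (@tends_le _ (fun m => t m s - t n s)).
    move=> e e0; have [N hN] := hz s xs e e0; exists N => m /hN.
    by rewrite opprB addrA subrK.
  by exists n => m nm; exact: diff2.
have zx s : x2 < re s -> x1 < re (s + z s).
  have zB : x2 < re s -> cm (z s) <= B.
    by move=> xs; apply: (tends_le (hz s xs)); exists 0%N => n _; exact: tB.
  by move=> xs; rewrite reD; have := re_ge (z s); have := zB xs; rewrite /x2 in xs; lra.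
exists x1, x2, (fun s => s + z s); split=> //; first by rewrite /x2; lra.
  apply: App_lim => e e0; have [N hN] := geo_small B20 e0.
  exists (t N); split; first exact: tA.
  move=> s xs; have -> : s + z s - s = z s by ring.
  by apply: le_trans (zt N s xs) _; exact: hN.
move=> s xs; split; first exact: zx.
rewrite uE; last by have := zx s xs; lra.
apply: cm_eps_eq => e e0.
have B60 : 0 <= B * 4 by rewrite mulr_ge0.
have [N hN] := geo_small B60 e0.
have -> : s + z s + th (s + z s) - s = (z s - t N.+1 s) + (th (s + z s) - th (s + t N s)).
    have -> : t N.+1 s = - th (s + t N s) by [].
    by move: (th (s + z s)) (th (s + t N s)) => A D; ring.
apply: le_trans (cmD _ _) _.
have h1 := lip _ _ (zx s xs) (tx N s xs).
have E : s + z s - (s + t N s) = z s - t N s by ring.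
rewrite E in h1.
have := zt N s xs; have := zt N.+1 s xs; have := hN N (leqnn _).
rewrite exprS; lra.
Qed.

Lemma u_bounded_shift x : 0 < x -> exists B, 0 <= B /\
  forall s, x < re s -> cm (u s - s) <= B.
Proof.
move=> x0; have [B [B0 hB]] := DApp_bounded (th_App x0); exists B; split=> // s xs.
by rewrite uE; [rewrite addrC addKr; exact: hB|exact: lt_trans xs].
Qed.

Lemma u_PS s : 0 < re s -> exists r a M, PS r (fun z => u (s + z)) a M.
Proof.
move=> s0; have s20 : 0 < re s / 2 by lra.
have near z : disc (re s / 2) z -> re s / 2 < re (s + z).
  by rewrite /disc reD; have := re_ge z; lra.
apply: (PS_App s20); apply: (App_ext (h := fun z => s + pw 1 z + th (s + z))).
  by move=> z /near h; rewrite uE /pw ?expr1//; lra.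
apply: (App_add (h := fun z => s + pw 1 z)).
  apply: (App_add (h := fun=> s) (h' := pw 1)); first exact: (App_cst _ (@pw_one R) s).
  exact: App_base.
apply: App_disc => e e0; have [N [p hp]] := th_App s20 e0; exists N, p => z zr.
by apply: hp; exact: near.
Qed.

Lemma u_SD s : 0 < re s -> exists d, SD u s d.
Proof.
move=> /u_PS[r [a [M P]]]; exists (a 1%N); apply: SD_shift; exact: PS_SD P.
Qed.

Hypothesis u_inj : forall s t, 0 < re s -> 0 < re t -> u s = u t -> s = t.

Lemma u_SD_neq0 s : 0 < re s -> exists d, SD u s d /\ d != 0.
Proof.
move=> s0; have [r [a [M P]]] := u_PS s0; exists (a 1%N); split.
  by apply: SD_shift; exact: PS_SD P.
have s20 : 0 < re s / 2 by lra.
apply: (PS_inj P s20) => z w zr wr /u_inj E.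
apply: (addrI s); apply: E; rewrite reD.
  by have := re_ge z; lra.
by have := re_ge w; lra.
Qed.

Hypothesis u_pos : forall s, 0 < re s -> 0 < re (u s).

Definition eu l s := dn l (u s).

Lemma eu_App x l : 0 < x -> DApp x (eu l).
Proof.
move=> x0; apply: (App_ext (h := fun s => dn l s * ex (- (lnS l)%:C * th s))).
  move=> s xs; rewrite /eu uE; last exact: lt_trans xs.
  by rewrite dnD {2}/dn /ebase mulNr.
apply: (App_mul (@dn_mul R) (@dn_bnd R x)); first exact: (App_base _).
by apply: (App_ex (@dn_one R) (@dn_mul R) (@dn_bnd R x)); apply: App_scal; exact: th_App.
Qed.

Lemma eu_le1 l s : 0 < re s -> cm (eu l s) <= 1.
Proof.
move=> s0; rewrite /eu cm_dn expR_le1 oppr_le0.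
by rewrite mulr_ge0 ?lnS_ge0// ltW// u_pos.
Qed.

Lemma eu_SD l s : 0 < re s -> exists d, SD (eu l) s d.
Proof.
move=> s0; have [d hd] := u_SD s0; have [d' hd'] := @SD_ebase R lnS l (u s).
by exists (d' * d); apply: (SD_comp hd hd').
Qed.

(* Parseval at [sigma > 0], then [sigma -> 0]. *)
Lemma norm_limit (g : nat -> C) K A :
  (forall x, 0 < x -> \sum_(k < K) cm (g k) ^+ 2 * expR (- (2 * lnS k * x)) <= A) ->
  \sum_(k < K) cm (g k) ^+ 2 <= A.
Proof.
move=> H; apply: le_eps => e e0.
pose S := \sum_(k < K) cm (g k) ^+ 2; have S0 : 0 <= S.
  by apply: sumr_ge0 => k _; exact: sqr_ge0.
pose Q := 2 * lnS K * (S + 1); have Q0 : 0 <= Q.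
  by rewrite !mulr_ge0 ?lnS_ge0//; lra.
have Q1 : 0 < Q + 1 by lra.
pose x := e / (Q + 1); have x0 : 0 < x by rewrite divr_gt0.
have qx : Q * x <= e by rewrite /x mulrA ler_pdivrMr//; nra.
apply: le_trans (lerD (H x x0) qx).
have -> : Q * x = \sum_(k < K) cm (g k) ^+ 2 * (2 * lnS K * x) + 2 * lnS K * x.
  by rewrite -mulr_suml -/S /Q; ring.
rewrite addrA -big_split/= -[leLHS]addr0; apply: lerD; last first.
  by apply: mulr_ge0; [rewrite mulr_ge0 ?lnS_ge0|exact: ltW].
apply: ler_sum => k _; rewrite -mulrDr -[leLHS]mulr1.
apply: ler_wpM2l; first exact: sqr_ge0.
have := expR_ge1Dx (- (2 * lnS k * x)).
have : lnS k * x <= lnS K * x.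
  by apply: ler_wpM2r; [exact: ltW|apply: ltW; exact: lnS_incr].
lra.
Qed.

Lemma bessel_half_plane y h (g : nat -> C) (A M : R) (q : C -> C) :
  (forall s, 0 < re s -> exists d, SD h s d) ->
  (forall s, 0 < re s -> cm (h s) <= M) ->
  DCoef y h g ->
  (forall x, 0 < x -> null x q) ->
  (forall s, 0 < re s -> cm (h s) ^+ 2 <= A + re (q s)) ->
  forall K, \sum_(k < K) cm (g k) ^+ 2 <= A.
Proof.
move=> sh hM ch nq hq K; apply: norm_limit => x x0.
apply: (@bessel R lnS 0 x h g K A q) => //.
- by exists M => s xs; apply: hM; exact: lt_le_trans xs.
- move=> k kK e e0.
  have [B [B0 hB]] := DApp_bounded (Coef_App ch).
  have aB := DCoef_bound ch hB.
  have d0 : 0 < lnS k.+1 - lnS k :> R by rewrite subr_gt0 lnS_incr.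
  pose D := B * 2 * expR (lnS k.+1 * (y + 3)).
  have D0 : 0 <= D by rewrite !mulr_ge0 ?expR_ge0.
  have D1 : 0 < D + 1 by lra.
  have [X hX] := expR_small d0 (divr_gt0 e0 D1).
  exists (Num.max X (y + 3)) => s; rewrite ge_max => /andP[Xs ys].
  apply: le_trans (DCoef_tail k.+1 ch B0 aB ys) _.
  have -> : B * (2 * expR (- (lnS k.+1 * (re s - y - 3)))) =
     D * expR (- ((lnS k.+1 - lnS k) * re s)) * expR (- (lnS k * re s)).
    rewrite /D !mulrA -!mulrA; congr (_ * (_ * _)); rewrite -!expRD; congr expR; ring.
  apply: ler_wpM2r; first exact: expR_ge0.
  have := hX _ Xs; rewrite ler_pdivlMr//; have := expR_ge0 (- ((lnS k.+1 - lnS k) * re s)).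
  nra.
- exact: nq.
- by move=> s sx; apply: hq; rewrite sx.
Qed.

Lemma eu_coef : exists E : nat -> nat -> C,
  [/\ forall l y, 1 <= y -> DCoef y (eu l) (E l),
      forall l K, \sum_(k < K) cm (E l k) ^+ 2 <= 1 &
      forall l k, (k < l)%N -> E l k = 0].
Proof.
have /choice[E hE] : forall l, exists a, DCoef 1 (eu l) a.
  by move=> l; apply: DApp_coef; exact: eu_App.
exists E; split.
- by move=> l y y1; exact: DCoef_le (hE l).
- move=> l K; apply: (@bessel_half_plane 1 (eu l) (E l) 1 1 (fun=> 0)) => //.
  + by move=> s s0; exact: eu_SD.
  + by move=> s; exact: eu_le1.
  + by move=> x _; exact: null_0.
  + move=> s s0; rewrite addr0 -(expr1n _ 2) lerXn2r ?nnegrE ?cm_ge0//.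
    exact: eu_le1.
- move=> l k kl.
  have [B [B0 hB]] := u_bounded_shift ltr01.
  apply: (@DCoef_low R 1 (eu l) (E l) (lnS l) (expR (lnS l * B)) 2 (hE l)).
  + exact: lnS_ge0.
  + move=> s s2; rewrite /eu cm_dn -expRD ler_expR.
    have := hB s ltac:(lra); have := re_ge (u s - s); rewrite reB => h1 h2.
    have h3 : re s - B <= re (u s) by lra.
    have := ler_wpM2l (lnS_ge0 l) h3; lra.
  + exact: lnS_incr.
Qed.

Lemma Coef_translate (E : nat -> nat -> C) :
  (forall l y, 1 <= y -> DCoef y (eu l) (E l)) ->
  (forall l k, (k < l)%N -> E l k = 0) ->
  forall x2 g b w y, DCoef x2 g b -> 1 <= y ->
  (forall s, y < re s -> x2 < re (u s + w)) ->
  DCoef y (fun s => g (u s + w)) (fun k => \sum_(l < k.+1) b l * dn l w * E l k).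
Proof.
move=> EC E0 x2 g b w y cg y1 hy.
pose f s := g (u s + w).
have approx e : 0 < e -> exists h' a', [/\ DCoef y h' a',
    forall s, y < re s -> cm (f s - h' s) <= e &
    forall k, cm (a' k - \sum_(l < k.+1) b l * dn l w * E l k) <=
      e * \sum_(l < k.+1) wgt x2 l * cm (dn l w) * cm (E l k)].
  move=> e0; have [N [p [sp hp ap]]] := cg e e0.
  exists (fun s => \sum_(l < N) p l * dn l w * eu l s),
         (fun k => \sum_(l < N) p l * dn l w * E l k); split.
  - apply: (Coef_sum (wgt_ge0 y) (F := fun l s => p l * dn l w * eu l s)
      (A := fun l k => p l * dn l w * E l k)) => l _.
    by apply: (Coef_scal (wgt_ge0 y)); exact: EC.
  - move=> s ys; apply: le_trans (hp _ (hy s ys)); apply: le_refl_eq.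
    congr (cm (_ - _)); apply: eq_bigr => l _.
    by rewrite /eu dnD [dn l (u s) * _]mulrC mulrA.
  - move=> k.
    have -> : \sum_(l < N) p l * dn l w * E l k = \sum_(l < k.+1) p l * dn l w * E l k.
      transitivity (\sum_(l < maxn N k.+1) p l * dn l w * E l k).
        apply/esym/(sum_vanish (F := fun l => p l * dn l w * E l k)); last exact: leq_maxl.
        by move=> l Nl; rewrite sp// !mul0r.
      apply: (sum_vanish (F := fun l => p l * dn l w * E l k)); last exact: leq_maxr.
      by move=> l kl; rewrite E0// mulr0.
    rewrite -sumrB; apply: le_trans (cm_sum _ _ _) _; rewrite mulr_sumr.
    apply: ler_sum => l _; rewrite -!mulrBl !cmM cmBC.
    have -> : e * (wgt x2 l * cm (dn l w) * cm (E l k)) =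
      wgt x2 l * e * cm (dn l w) * cm (E l k) by ring.
    by do 2! (apply: ler_wpM2r; first exact: cm_ge0); exact: ap.
have [a ca] : exists a, DCoef y f a.
  apply: DApp_coef; apply: App_lim => e /approx[h' [a' [ch' fh' _]]].
  by exists h'; split; [exact: Coef_App ch'|exact: fh'].
suff -> : (fun k => \sum_(l < k.+1) b l * dn l w * E l k) = a by [].
apply/funext => k; apply/esym/cm_eps_eq => e e0.
set S := \sum_(l < k.+1) _.
pose Q := \sum_(l < k.+1) wgt x2 l * cm (dn l w) * cm (E l k).
have Q0 : 0 <= Q.
  by apply: sumr_ge0 => l _; rewrite !mulr_ge0 ?cm_ge0 ?wgt_ge0.
have W0 := wgt_ge0 y k.
have T0 : 0 < wgt y k + Q + 1 by lra.
have [h' [a' [ch' fh' aa']]] := approx _ (divr_gt0 e0 T0).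
set e1 := e / _ in fh' aa'.
have h1 : cm (a k - a' k) <= wgt y k * e1.
  exact: (DCoef_bound (Coef_sub (wgt_ge0 y) ca ch') fh').
have := aa' k; rewrite -/S -/Q => h2.
apply: le_trans (cm_triB _ (a' k) _) _.
apply: le_trans (lerD h1 h2) _; rewrite [e1 * Q]mulrC -mulrDl /e1 mulrA.
by rewrite ler_pdivrMr// mulrC ler_pM2l//; lra.
Qed.

End Koenigs.

(** * Translations on the image of the Koenigs map *)

Section Contraction.
Context {R : realType}.
Local Notation C := R[i].

(* Abel summation: with [Y m] the sum of the [y n], [n >= m], the right-hand side is
   [kap 0 * |Y 0|^2] plus the sum of [(kap m - kap m.-1) * |Y m|^2]. *)
Lemma abel_psd N (kap : nat -> R) (y : nat -> C) :
  (forall n, 0 <= kap n) -> (forall n, kap n <= kap n.+1) ->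
  kap 0%N * cm (\sum_(n < N) y n) ^+ 2 <= \sum_(n < N) kap n * cm (y n) ^+ 2 +
    \sum_(n < N) \sum_(m < n) 2 * kap m * re (conjc (y m) * y n).
Proof.
elim: N kap y => [|N IH] kap y k0 kS; first by rewrite !big_ord0 cm0 expr0n/= mulr0 addr0.
have := IH (fun n => kap n.+1) (fun n => y n.+1) (fun n => k0 _) (fun n => kS _).
set T1 := \sum_(n < N) _ * _; set T2 := \sum_(n < N) \sum_(m < n) _.
set Y := \sum_(n < N) y n.+1 => IH'.
rewrite !big_ord_recl/= big_ord0 add0r.
have -> : \sum_(i < N) y (bump 0 i) = Y by apply: eq_bigr => i _.
have -> : \sum_(i < N) kap (bump 0 i) * cm (y (bump 0 i)) ^+ 2 = T1.
  by apply: eq_bigr => i _.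
have -> : \sum_(i < N) \sum_(m < bump 0 i) 2 * kap m * re (conjc (y m) * y (bump 0 i)) =
   2 * kap 0%N * re (conjc (y 0%N) * Y) + T2.
  rewrite /Y mulr_sumr re_sum mulr_sumr -big_split/=; apply: eq_bigr => i _.
  by rewrite /bump/= add1n big_ord_recl/=.
have h : cm (y 0%N + Y) ^+ 2 = cm (y 0%N) ^+ 2 + 2 * re (conjc (y 0%N) * Y) + cm Y ^+ 2.
  by rewrite !cm_sq; case: (y 0%N) => a b; case: (Y) => c d /=; ring.
rewrite h; have := kS 0%N; have := k0 0%N; have := sqr_ge0 (cm Y).
move: IH'; set X := cm Y ^+ 2; move=> IH' X0 ka kb.
have : kap 0%N * X <= kap 1%N * X by rewrite ler_wpM2r.
lra.
Qed.

Lemma dirichlet_pointwise (a : nat -> C) N (z : C) : 0 <= re z ->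
  cm (\sum_(n < N) a n * dn n z) ^+ 2 <= \sum_(n < N) cm (a n) ^+ 2 +
    re (\sum_(n < N) \sum_(m < n) (2 * (conjc (a m) * a n)) *
         ex (- (lnS n - lnS m)%:C * z)).
Proof.
move=> z0; pose kap n := expR (2 * lnS n * re z).
have := @abel_psd N kap (fun n => a n * dn n z).
have -> : kap 0%N = 1 by rewrite /kap lnS0 mulr0 mul0r expR0.
rewrite mul1r => H; apply: le_trans (H _ _) _ => {H}.
- by move=> n; exact: expR_ge0.
- move=> n; rewrite /kap ler_expR; apply: ler_wpM2r => //.
  by rewrite ler_pM2l//; apply: ltW; exact: lnS_incr.
rewrite re_sum; apply: le_refl_eq; congr (_ + _).
  apply: eq_bigr => n _; rewrite cmM exprMn mulrCA cm_dn /kap -expRM_natl -expRD.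
  have -> : 2 * lnS n * re z + 2%:R * - (lnS n * re z) = 0 by ring.
  by rewrite expR0 mulr1.
apply: eq_bigr => n _; rewrite re_sum; apply: eq_bigr => m _.
have dm : (kap m)%:C * conjc (dn m z) = ex ((lnS m)%:C * z).
  apply: (mulfI (ex_neq0 (- ((lnS m)%:C * z)))).
  rewrite -[ex (- _)]/(dn m z) mulrCA mulcj cm_dn -rmorphM -[dn m z]/(ex _) -exD addNr ex0.
  rewrite /kap -expRM_natl -expRD.
  have -> : 2 * lnS m * re z + 2%:R * - (lnS m * re z) = 0 by ring.
  by rewrite expR0.
have -> : ex (- (lnS n - lnS m)%:C * z) = (kap m)%:C * conjc (dn m z) * dn n z.
  rewrite dm -[dn n z]/(ex _) -exD; congr ex; rewrite rmorphB; ring.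
rewrite cjM.
have -> : 2 * (conjc (a m) * a n) * ((kap m)%:C * conjc (dn m z) * dn n z) =
  (2 * kap m)%:C * (conjc (a m) * conjc (dn m z) * (a n * dn n z)).
  by rewrite rmorphM (rmorph_nat (real_complex R)); ring.
by rewrite reMr.
Qed.

Variables (u th : C -> C).
Hypothesis th_App : forall x, 0 < x -> DApp x th.
Hypothesis uE : forall s, 0 < re s -> u s = s + th s.
Hypothesis u_inj : forall s t, 0 < re s -> 0 < re t -> u s = u t -> s = t.

Variables (x1 x2 : R) (v : C -> C).
Hypothesis x1_ge5 : 5 <= x1.
Hypothesis x1x2 : x1 <= x2.
Hypothesis v_App : DApp x2 (fun s => v s - s).
Hypothesis uv : forall s, x2 < re s -> x1 < re (v s) /\ u (v s) = s.
Variable E : nat -> nat -> C.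
Hypothesis E_coef : forall l y, 1 <= y -> DCoef y (eu u l) (E l).
Hypothesis E_tri : forall l k, (k < l)%N -> E l k = 0.

Lemma DApp_v f : DApp x1 f -> DApp x2 (fun s => f (v s)).
Proof.
move=> af; apply: (App_ext (h := fun s => f (s + (v s - s)))).
  by move=> s _; rewrite addrC subrK.
by apply: (DApp_comp af v_App) => s xs; rewrite addrC subrK; exact: (uv xs).1.
Qed.

Lemma v_bounded : exists B, 0 <= B /\ forall s, x2 < re s -> re s - B <= re (v s).
Proof.
have [B [B0 hB]] := DApp_bounded v_App; exists B; split=> // s xs.
have := hB s xs; have := re_ge (v s - s); rewrite reB; lra.
Qed.

(* [\sum_l b l * l^(-w) * E l k], the [k]-th coefficient of [g (u + w)] for [g] with
   coefficients [b]. *)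
Definition Sw (b : nat -> C) (w : C) (k : nat) : C :=
  \sum_(l < k.+1) b l * dn l w * E l k.

Lemma Sw_coef g b w : DCoef x2 g b ->
  exists y, [/\ 1 <= y, forall s, y < re s -> x2 < re (u s + w) &
    DCoef y (fun s => g (u s + w)) (Sw b w)].
Proof.
move=> cg; have [B [B0 hB]] := u_bounded_shift th_App uE ltr01.
pose y := Num.max 1 (x2 + B + cm w).
have y1 : 1 <= y by rewrite le_max lexx.
have y2 : x2 + B + cm w <= y by rewrite le_max lexx orbT.
have hy s : y < re s -> x2 < re (u s + w).
  move=> ys; have s1 : 1 < re s by lra.
  have := hB s s1; have := re_ge (u s - s); have := re_ge w.
  rewrite reB [re (u s + w)]reD; lra.
by exists y; split=> //; apply: Coef_translate cg y1 hy.
Qed.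

Lemma low_coef_v f a b K : DCoef x1 f a -> DCoef x2 (fun s => f (v s)) b ->
  (forall k, (k < K)%N -> a k = 0) -> forall k, (k < K)%N -> b k = 0.
Proof.
move=> cf cb a0 k kK.
have [M [M0 hM]] := DApp_bounded (Coef_App cf); have aM := DCoef_bound cf hM.
have [B [B0 hB]] := v_bounded.
apply: (@DCoef_low R x2 _ b (lnS K) (M * 2 * expR (lnS K * (x1 + 3 + B)))
   (x2 + x1 + B + 4) cb (lnS_ge0 K)); last exact: lnS_incr.
have x13 := x1_ge5; have x12 := x1x2; move=> s xs; have x2s : x2 < re s by lra.
have vs := hB s x2s.
have := @DCoef_tail R x1 f a M K (v s) cf M0 aM ltac:(lra).
rewrite big1 ?subr0 => [h|i _]; last by rewrite a0// mul0r.
apply: le_trans h _; rewrite -!mulrA; apply: ler_wpM2l => //; apply: ler_wpM2l => //.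
rewrite -expRD ler_expR.
have := ler_wpM2l (lnS_ge0 K) vs; lra.
Qed.

Variable w : C.
Hypothesis w_shift : forall s, 0 < re s -> exists z, 0 < re z /\ u z = u s + w.

(* The self-map [u^-1 (u + w)] of the right half-plane. *)
Lemma shift_map : exists phi : C -> C,
  [/\ forall s, 0 < re s -> 0 < re (phi s) /\ u (phi s) = u s + w,
      forall s, 0 < re s -> exists d, SD phi s d &
      exists B X, forall s, X <= re s -> 0 < re s -> re s - B <= re (phi s)].
Proof.
have /choice[V hV] : forall y, exists z, (exists z0, 0 < re z0 /\ u z0 = y) ->
    0 < re z /\ u z = y.
  move=> y; have [[z0 hz]|n] := pselect (exists z0, 0 < re z0 /\ u z0 = y).
    by exists z0.
  by exists 0.
have VK z : 0 < re z -> V (u z) = z.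
  move=> z0; have [|h1 h2] := hV (u z); first by exists z.
  exact: u_inj.
have hphi s : 0 < re s -> 0 < re (V (u s + w)) /\ u (V (u s + w)) = u s + w.
  by move=> s0; apply: hV; exact: w_shift.
exists (fun s => V (u s + w)); split=> //.
  move=> s s0; have [p0 pE] := hphi s s0.
  have [d [hd d0]] := u_SD_neq0 th_App uE u_inj p0.
  have [d' hd'] := u_SD th_App uE s0.
  have r0 : 0 < re (V (u s + w)) / 2 by lra.
  have := @SD_inverse R u V (fun z => 0 < re z) _ d _ hd d0 r0 _ VK.
  move=> H; have {H} sv : SD V (u s + w) d^-1.
    rewrite -pE; apply: H => z hz; have := re_ge (z - V (u s + w)); rewrite reB; lra.
  exists (d^-1 * (d' + 0)).
  exact: (SD_comp (g := fun s => u s + w) (SD_add hd' (SD_cst w s)) sv).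
have [B [B0 hB]] := u_bounded_shift th_App uE ltr01.
have [B' [B'0 hB']] := v_bounded.
exists (B + cm w + B'), (x2 + B + cm w + 2) => s xs s0.
have us : re s - B - cm w <= re (u s + w).
  have x13 := x1_ge5; have x12 := x1x2; have s1 : 1 < re s by have := cm_ge0 w; lra.
  have := hB s s1; have := re_ge (u s - s); have := re_ge w.
  rewrite reB [re (u s + w)]reD; lra.
have x2s : x2 < re (u s + w) by lra.
have [v1 v2] := uv x2s.
have -> : V (u s + w) = v (u s + w) by rewrite -{1}v2 VK//; have := x1_ge5; lra.
by have := hB' _ x2s; lra.
Qed.

Lemma Sw_contract_pol (a : nat -> C) N b :
  DCoef x2 (fun s => \sum_(n < N) a n * dn n (v s)) b ->
  forall K, \sum_(k < K) cm (Sw b w k) ^+ 2 <= \sum_(n < N) cm (a n) ^+ 2.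
Proof.
move=> cb; have [phi [hphi sphi [B [X phiB]]]] := shift_map.
have [y [y1 hy cS]] := Sw_coef w cb.
pose f s := \sum_(n < N) a n * dn n (phi s).
have [Bv [Bv0 hBv]] := v_bounded.
have cf : DCoef y f (Sw b w).
  apply: Coef_ext cS => s ys; apply: eq_bigr => n _; congr (_ * dn n _).
  have s0 : 0 < re s by rewrite /HP in ys; lra.
  have [p0 pE] := hphi s s0; have [v1 v2] := uv (hy s ys).
  by have x13 := x1_ge5; apply: u_inj => //; [lra|rewrite v2 pE].
pose q s := \sum_(n < N) \sum_(m < n) (2 * (conjc (a m) * a n)) *
         ex (- (lnS n - lnS m)%:C * phi s).
apply: (@bessel_half_plane R y f (Sw b w) _ (\sum_(n < N) cm (a n)) q) cf _ _.
- move=> s s0; apply: (SD_sum N (F := fun n s => a n * dn n (phi s))) => n.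
  have [d hd] := sphi s s0; have [d' hd'] := @SD_ebase R lnS n (phi s).
  exists (a n * (d' * d)); apply: SD_scal; exact: (SD_comp hd hd').
- move=> s s0; apply: le_trans (cm_sum _ _ _) _; apply: ler_sum => n _.
  rewrite cmM cm_dn ler_piMr ?cm_ge0// expR_le1 oppr_le0 mulr_ge0 ?lnS_ge0//.
  by have [h _] := hphi s s0; exact: ltW.
- move=> x x0; apply: (null_sum (F := fun n s => \sum_(m < n) (2 * (conjc (a m) * a n)) *
         ex (- (lnS n - lnS m)%:C * phi s))) => n _.
  apply: (null_sum (F := fun m s => (2 * (conjc (a m) * a n)) *
         ex (- (lnS n - lnS m)%:C * phi s))) => m mn.
  apply: null_scal.
  have d0 : 0 < lnS n - lnS m :> R by rewrite subr_gt0 lnS_incr.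
  have bE s : cm (ex (- (lnS n - lnS m)%:C * phi s)) = expR (- ((lnS n - lnS m) * re (phi s))).
    by rewrite cm_ex -rmorphN reMr mulNr.
  apply: (null_decay x0).
  + move=> s s0; have [d hd] := sphi s s0.
    have [d' hd'] := SD_exl (- (lnS n - lnS m)%:C) (phi s).
    by exists (d' * d); apply: (SD_comp hd hd').
  + move=> X'; exists 1 => s /andP[xs _]; rewrite bE expR_le1 oppr_le0.
    have [h _] := hphi s (lt_le_trans x0 xs).
    by apply: mulr_ge0; exact: ltW.
  + move=> e e0; have [Y hY] := expR_small d0 e0.
    exists (Num.max (Num.max X 1) (Y + B)) => s; rewrite !ge_max => /andP[/andP[Xs s1] Ys].
    rewrite bE; apply: hY; have := phiB s Xs ltac:(lra); lra.
- move=> s s0; apply: dirichlet_pointwise.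
  by have [h _] := hphi s s0; exact: ltW.
Qed.

Lemma Sw_contract f a b A : DCoef x1 f a -> DCoef x2 (fun s => f (v s)) b ->
  (forall K, \sum_(k < K) cm (a k) ^+ 2 <= A) ->
  forall K, \sum_(k < K) cm (Sw b w k) ^+ 2 <= A.
Proof.
move=> cf cb aA K.
pose aK k := if (k < K)%N then a k else 0.
have saK : supp aK K by move=> k; rewrite /aK leqNgt => /negbTE->.
pose fK s := \sum_(k < K) aK k * dn k s.
have cfK : DCoef x1 fK aK := Coef_pol (HP x1) dn (wgt_ge0 x1) saK.
have [bK cbK] := DApp_coef (DApp_v (Coef_App cfK)).
have bb k : (k < K)%N -> b k = bK k.
  move=> kK; apply/eqP; rewrite -subr_eq0; apply/eqP.
  apply: (low_coef_v (Coef_sub (wgt_ge0 x1) cf cfK) (Coef_sub (wgt_ge0 x2) cb cbK)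
     (K := K)) => // j jK.
  by rewrite /aK jK subrr.
have <- : \sum_(k < K) cm (Sw bK w k) ^+ 2 = \sum_(k < K) cm (Sw b w k) ^+ 2.
  apply: eq_bigr => k _; congr (cm _ ^+ 2); apply: eq_bigr => l _.
  rewrite bb//; have kK := ltn_ord k; exact: leq_ltn_trans (leq_ord l) kK.
apply: le_trans (aA K); apply: le_trans (Sw_contract_pol cbK K) _.
by apply: ler_sum => k _; rewrite /aK ltn_ord.
Qed.

End Contraction.

(** * Square-summable sequences *)

Section Pairing.
Context {R : realType}.
Local Notation C := R[i].

Definition l2 (a : nat -> C) (A : R) := forall K, \sum_(k < K) cm (a k) ^+ 2 <= A.

Definition pairN (a z : nat -> C) n := \sum_(k < n) a k * conjc (z k).

Lemma l2_ge0 a A : l2 a A -> 0 <= A.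
Proof. by move=> /(_ 0%N); rewrite big_ord0. Qed.

Lemma tail_small (x : nat -> R) (A e : R) : (forall k, 0 <= x k) ->
  (forall K, \sum_(k < K) x k <= A) -> 0 < e ->
  exists N, forall n, \sum_(N <= k < n) x k <= e.
Proof.
move=> x0 xA e0; pose S := [set y | exists K : nat, y = \sum_(k < K) x k].
have hS : has_sup S.
  split; first by exists (\sum_(k < 0) x k), 0%N.
  by exists A => _ [K ->].
have [_ [N ->] hN] := sup_adherent e0 hS.
exists N => n; have [Nn|/ltnW nN] := leqP N n; last by rewrite big_geq// ltW.
have : \sum_(k < n) x k <= sup S by apply: (sup_upper_bound hS); exists n.
rewrite -(big_mkord xpredT x) (@big_cat_nat _ _ _ N)//= big_mkord; lra.
Qed.

Lemma l2_seg (a : nat -> C) A m n : l2 a A -> \sum_(m <= k < n) cm (a k) ^+ 2 <= A.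
Proof.
move=> la; apply: le_trans (la n); rewrite -(big_mkord xpredT (fun k => cm (a k) ^+ 2)).
have [mn|/ltnW nm] := leqP m n; last first.
  by rewrite (big_geq nm); apply: sumr_ge0 => k _; exact: sqr_ge0.
by rewrite [leRHS](@big_cat_nat _ _ _ m)//= lerDr sumr_ge0// => k _; exact: sqr_ge0.
Qed.

(* Weighted AM-GM replaces the Cauchy-Schwarz inequality. *)
Lemma pair_seg (a z : nat -> C) (t X Y : R) m n : 0 < t ->
  \sum_(m <= k < n) cm (a k) ^+ 2 <= X -> \sum_(m <= k < n) cm (z k) ^+ 2 <= Y ->
  cm (\sum_(m <= k < n) a k * conjc (z k)) <= (t * X + Y / t) / 2.
Proof.
move=> t0 hX hY; apply: le_trans (cm_sum _ _ _) _.
apply: (@le_trans _ _ (\sum_(m <= k < n) (t / 2 * cm (a k) ^+ 2 + (2 * t)^-1 * cm (z k) ^+ 2))).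
  apply: ler_sum => k _; rewrite cmM cmcj.
  have := sqr_ge0 (t * cm (a k) - cm (z k)).
  have -> : t / 2 * cm (a k) ^+ 2 + (2 * t)^-1 * cm (z k) ^+ 2 =
    (t ^+ 2 * cm (a k) ^+ 2 + cm (z k) ^+ 2) / (2 * t) by field; rewrite gt_eqF.
  by rewrite ler_pdivlMr ?mulr_gt0//; lra.
rewrite big_split/= -!mulr_sumr.
have h1 : t / 2 * \sum_(m <= k < n) cm (a k) ^+ 2 <= t / 2 * X.
  by apply: ler_wpM2l => //; apply: ltW; rewrite divr_gt0.
have h2 : (2 * t)^-1 * \sum_(m <= k < n) cm (z k) ^+ 2 <= (2 * t)^-1 * Y.
  by apply: ler_wpM2l => //; rewrite invr_ge0 mulr_ge0// ltW.
apply: le_trans (lerD h1 h2) _; apply: le_refl_eq; field; rewrite gt_eqF//.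
Qed.

Lemma pair_tail (z : nat -> C) A B e : 0 <= A -> l2 z B -> 0 < e ->
  exists N, forall a, l2 a A -> forall n m, (N <= m)%N ->
    cm (\sum_(m <= k < n) a k * conjc (z k)) <= e.
Proof.
move=> A0 lz e0; pose t := e / (A + 1).
have A1 : 0 < A + 1 by lra.
have t0 : 0 < t by rewrite divr_gt0.
have [N hN] := tail_small (fun k => sqr_ge0 (cm (z k))) lz (mulr_gt0 e0 t0).
exists N => a la n m Nm.
have zm : \sum_(m <= k < n) cm (z k) ^+ 2 <= e * t.
  have [mn|/ltnW nm] := leqP m n; last by rewrite big_geq// mulr_ge0// ltW.
  apply: le_trans (hN n); rewrite [leRHS](@big_cat_nat _ _ _ m)//= lerDr.
  by apply: sumr_ge0 => k _; exact: sqr_ge0.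
apply: le_trans (pair_seg t0 (l2_seg m n la) zm) _.
rewrite mulfK ?gt_eqF//.
have : t * A <= e by rewrite /t mulrAC ler_pdivrMr//; nra.
lra.
Qed.

Lemma pairN_cat a z m n : (m <= n)%N ->
  pairN a z n = pairN a z m + \sum_(m <= k < n) a k * conjc (z k).
Proof.
move=> mn; rewrite /pairN -!(big_mkord xpredT (fun k => a k * conjc (z k))).
by rewrite (@big_cat_nat _ _ _ m).
Qed.

Lemma pair_unif (z : nat -> C) A B e : 0 <= A -> l2 z B -> 0 < e ->
  exists N, forall a d, l2 a A -> tends (pairN a z) d ->
   forall n, (N <= n)%N -> cm (d - pairN a z n) <= e.
Proof.
move=> A0 lz e0; have [N hN] := pair_tail A0 lz e0; exists N => a d la td n Nn.
apply: (@tends_le _ (fun m => pairN a z m - pairN a z n)).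
  move=> e' e0'; have [M hM] := td e' e0'; exists M => m /hM.
  by rewrite opprB addrA subrK.
exists n => m nm; rewrite (pairN_cat _ _ nm) addrAC subrr add0r; exact: hN.
Qed.

Lemma pair_tends a z A B : l2 a A -> l2 z B -> exists d, tends (pairN a z) d.
Proof.
move=> la lz; apply: cauchy_tends => e e0.
have [N hN] := pair_tail (l2_ge0 la) lz e0.
by exists N => n m Nn nm; rewrite (pairN_cat _ _ nm) addrAC subrr add0r; exact: hN.
Qed.

Lemma pairN_bound a z A B n : l2 a A -> l2 z B -> cm (pairN a z n) <= (A + B) / 2.
Proof.
move=> la lz; rewrite /pairN -(big_mkord xpredT (fun k => a k * conjc (z k))).
apply: le_trans (pair_seg ltr01 (l2_seg _ _ la) (l2_seg _ _ lz)) _.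
by rewrite mul1r divr1.
Qed.

Lemma tendsD (f g : nat -> C) a b : tends f a -> tends g b ->
  tends (fun n => f n + g n) (a + b).
Proof.
move=> hf hg e e0; have e20 : 0 < e / 2 by lra.
have [N hN] := hf _ e20; have [M hM] := hg _ e20.
exists (maxn N M) => n; rewrite geq_max => /andP[Nn Mn].
rewrite opprD addrACA; apply: le_trans (cmD _ _) _.
have := hN n Nn; have := hM n Mn; lra.
Qed.

Lemma tendsZ c (f : nat -> C) a : tends f a -> tends (fun n => c * f n) (c * a).
Proof.
move=> hf e e0; have c0 := cm_ge0 c; have c1 : 0 < cm c + 1 by lra.
have [N hN] := hf _ (divr_gt0 e0 c1); exists N => n Nn.
rewrite -mulrBr cmM; have := hN n Nn; rewrite ler_pdivlMr//.
have := cm_ge0 (f n - a); nra.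
Qed.

Lemma tends_cst (c : C) : tends (fun=> c) c.
Proof. by move=> e e0; exists 0%N => n _; rewrite subrr cm0 ltW. Qed.

Lemma tends_sum m (f : 'I_m -> nat -> C) a : (forall i, tends (f i) (a i)) ->
  tends (fun n => \sum_i f i n) (\sum_i a i).
Proof.
move=> hf; suff H (s : seq 'I_m) : tends (fun n => \sum_(i <- s) f i n) (\sum_(i <- s) a i).
  by have := H (index_enum 'I_m).
elim: s => [|i s IH].
  by move=> e e0; exists 0%N => n _; rewrite !big_nil subrr cm0 ltW.
move=> e e0; have [N hN] := tendsD (hf i) IH e0; exists N => n /hN.
by rewrite !big_cons.
Qed.

Lemma tends_ext (f g : nat -> C) a : (forall n, f n = g n) -> tends f a -> tends g a.
Proof. by move=> fg hf e /hf[N hN]; exists N => n /hN; rewrite fg. Qed.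

Lemma sum_tri (F : nat -> nat -> C) K : (forall l k, (k < l)%N -> F l k = 0) ->
  \sum_(k < K) \sum_(l < k.+1) F l k = \sum_(l < K) \sum_(k < K) F l k.
Proof.
move=> F0; rewrite exchange_big/=; apply: eq_bigr => k _.
by rewrite -(@sum_vanish _ (fun l => F l k) k.+1 K)// => l kl; rewrite F0.
Qed.

(* [\sum_k (\sum_l b l * l^(-w) * E l k) * conj (z k)], summed over [k] first. *)
Lemma pair_Sw E b z w (x M Z : R) (p : nat -> C) d :
  (forall l, l2 (E l) 1) -> (forall l k, (k < l)%N -> E l k = 0) -> 0 <= M ->
  (forall l, cm (b l) <= wgt x l * M) -> l2 z Z -> x + 4 <= re w ->
  (forall l, tends (pairN (E l) z) (p l)) -> tends (pairN (Sw E b w) z) d ->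
  tends (fun n => \sum_(l < n) b l * dn l w * p l) d.
Proof.
move=> lE E0 M0 bM lz xw hp hd e e0.
pose Q := (1 + Z) / 2 * M * 2; have Z0 := l2_ge0 lz.
have Q0 : 0 <= Q by rewrite !mulr_ge0 ?invr_ge0//; lra.
have Q1 : 0 < Q + 1 by lra.
have [N hN] := expR_lnS_small ltr01 (divr_gt0 e0 Q1).
exists N => n Nn; rewrite cmBC.
apply: (@tends_le _ (fun K => pairN (Sw E b w) z K - \sum_(l < n) b l * dn l w * pairN (E l) z K)).
  apply: (@tends_ext (fun K => pairN (Sw E b w) z K +
      \sum_(l < n) (- (b l * dn l w)) * pairN (E l) z K)).
    by move=> K; rewrite -sumrN; congr (_ + _); apply: eq_bigr => l _; rewrite mulNr.
  have -> : d - \sum_(l < n) b l * dn l w * p l =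
     d + \sum_(l < n) (- (b l * dn l w)) * p l.
    by rewrite -sumrN; congr (_ + _); apply: eq_bigr => l _; rewrite mulNr.
  apply: tendsD => //; apply: (tends_sum (f := fun l K => - (b l * dn l w) * pairN (E l) z K)).
  by move=> l; exact: tendsZ.
exists n => K nK.
have -> : pairN (Sw E b w) z K = \sum_(l < K) b l * dn l w * pairN (E l) z K.
  rewrite /pairN /Sw; under eq_bigr do rewrite mulr_suml.
  rewrite (sum_tri (F := fun l k => b l * dn l w * E l k * conjc (z k))) => [|l k kl]; last first.
    by rewrite E0// mulr0 mul0r.
  apply: eq_bigr => l _; rewrite mulr_sumr; apply: eq_bigr => k _; ring.
rewrite -!(big_mkord xpredT (fun l => b l * dn l w * pairN (E l) z K)).
rewrite (@big_cat_nat _ _ _ n)//= addrAC subrr add0r.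
apply: le_trans (cm_sum _ _ _) _.
apply: (@le_trans _ _ (\sum_(n <= l < K) (1 + Z) / 2 * M * (wgt x l * expR (- (lnS l * re w))))).
  apply: ler_sum => l _; rewrite !cmM cm_dn.
  have X0 := expR_ge0 (- (lnS l * re w)).
  apply: le_trans (ler_pM _ (cm_ge0 _) (ler_wpM2r X0 (bM l)) (pairN_bound K (lE l) lz)) _.
    by rewrite mulr_ge0 ?cm_ge0.
  by apply: le_refl_eq; ring.
rewrite -mulr_sumr.
have xw3 : x + 3 <= re w by lra.
have c0 : 0 <= (1 + Z) / 2 * M by rewrite mulr_ge0//; lra.
apply: le_trans (ler_wpM2l c0 (wgt_tail n K xw3)) _.
have h : expR (- (lnS n * (re w - x - 3))) <= e / (Q + 1).
  apply: le_trans (hN n Nn); rewrite ler_expR lerN2; apply: ler_wpM2l; first exact: lnS_ge0.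
  lra.
rewrite mulrA -/Q; apply: le_trans (ler_wpM2l Q0 h) _.
by rewrite mulrA ler_pdivrMr//; nra.
Qed.

Lemma dirichlet_vanish (B : nat -> C) (c : C) (x M : R) k0 : 0 < re c -> 0 <= M ->
  (forall l, cm (B l) <= wgt x l * M) ->
  (forall k, (k0 <= k)%N -> tends (fun n => \sum_(l < n) B l * dn l (k%:R * c)) 0) ->
  forall l, B l = 0.
Proof.
move=> c0 M0 BM hB; elim/ltn_ind => l IH; apply: cm_eps0 => e e0.
pose P := M * 2 * expR (lnS l.+1 * (x + 3)); have P0 : 0 <= P.
  by rewrite !mulr_ge0 ?expR_ge0.
have P1 : 0 < P + 1 by lra.
have d0 : 0 < lnS l.+1 - lnS l :> R by rewrite subr_gt0 lnS_incr.
have [X hX] := expR_small d0 (divr_gt0 e0 P1).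
have [k1 [_ hk1]] := nat_ge ((Num.max X (x + 3)) / re c).
pose k := maxn k0 k1; have kk0 : (k0 <= k)%N := leq_maxl _ _.
pose t := k%:R * re c.
have tX : Num.max X (x + 3) <= t.
  rewrite -ler_pdivrMr//; apply: le_trans hk1 _; rewrite ler_nat; exact: leq_maxr.
move: tX; rewrite ge_max => /andP[Xt xt].
have rek : re (k%:R * c) = t := re_nat k c.
have cl : cm (B l * dn l (k%:R * c)) <= M * (2 * expR (- (lnS l.+1 * (t - x - 3)))).
  apply: (@tends_le _ (fun n => B l * dn l (k%:R * c) - \sum_(j < n) B j * dn j (k%:R * c))).
    have := tendsD (tends_cst (B l * dn l (k%:R * c))) (tendsZ (-1) (hB k kk0)).
    rewrite mulr0 addr0; apply: tends_ext => n; by rewrite mulN1r.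
  exists l.+1 => n ln.
  rewrite -(big_mkord xpredT (fun j => B j * dn j (k%:R * c))) (@big_cat_nat _ _ _ l.+1)//=.
  rewrite big_mkord big_ord_recr/= big1 ?add0r => [|j _]; last by rewrite IH// mul0r.
  rewrite opprD addrA subrr add0r cmN.
  apply: le_trans (cm_sum _ _ _) _.
  apply: (@le_trans _ _ (\sum_(l.+1 <= j < n) M * (wgt x j * expR (- (lnS j * t))))).
    apply: ler_sum => j _; rewrite cmM cm_dn rek.
    by rewrite mulrA [M * _]mulrC ler_wpM2r ?expR_ge0.
  by rewrite -mulr_sumr; apply: ler_wpM2l => //; exact: wgt_tail.
rewrite cmM cm_dn rek in cl.
have : cm (B l) <= P * expR (- ((lnS l.+1 - lnS l) * t)).
  rewrite -(ler_pM2r (expR_gt0 (- (lnS l * t)))); apply: le_trans cl _.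
  apply: le_refl_eq; rewrite /P -!mulrA -!expRD; congr (_ * (_ * expR _)); ring.
move=> h; apply: le_trans h _; have := hX t Xt; rewrite ler_pdivlMr// => h2.
have := expR_ge0 (- ((lnS l.+1 - lnS l) * t)); nra.
Qed.

(* Analytic continuation along the positive axis, then the limit at 0. *)
Lemma continuation (F : C -> C) (Om : C -> Prop) (t0 : R) :
  (forall t : R, 0 < t -> exists r, 0 < r /\ forall z, cm z < r -> Om (t%:C + z)) ->
  (forall e, 0 < e -> exists N (p : nat -> C), forall w, Om w \/ w = 0 ->
     cm (F w - \sum_(k < N) p k * dn k w) <= e) ->
  (forall t : R, t0 <= t -> F t%:C = 0) -> F 0 = 0.
Proof.
move=> hOm hF F0.
pose S := [set t : R | 0 < t /\ forall t', t <= t' -> F t'%:C = 0].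
have S0 : S (Num.max 1 t0).
  split; first by rewrite lt_max ltr01.
  by move=> t'; rewrite ge_max => /andP[_]; exact: F0.
have hS : has_inf S.
  by split; [exists (Num.max 1 t0)|exists 0 => t [/ltW]].
pose tau := inf S.
have tau0 : 0 <= tau by apply: lb_le_inf => [|t [/ltW]//]; exact: hS.1.
have above t : tau < t -> F t%:C = 0.
  by move=> tt; have [s [_ hs] st] := inf_lt hS.1 tt; apply: hs; exact: ltW.
have tau_eq0 : tau = 0.
  apply/eqP; rewrite eq_le tau0 andbT leNgt; apply/negP => tau1.
  have [r [r0 hr]] := hOm tau tau1.
  have aF : App (disc r) pw (fun z => F (tau%:C + z)).
    apply: App_disc => e /hF[N [p hp]]; exists N, p => z zr; apply: hp; left; exact: hr.
  have [s [a [M P]]] := PS_App r0 aF.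
  have a0 : forall k, a k = 0.
    apply: (PS_coef0 P ltr01) => t t1 _; rewrite -rmorphD; apply: above; lra.
  have Fz z : cm z <= s / 2 -> F (tau%:C + z) = 0.
    by move=> zs; rewrite (PS_zero P) ?a0// => k _; exact: a0.
  have [s0 _ _ _] := P.
  pose t := tau - Num.min (s / 2) (tau / 2).
  have m0 : 0 < Num.min (s / 2) (tau / 2) by rewrite lt_min !divr_gt0.
  have m1 : Num.min (s / 2) (tau / 2) <= s / 2 by rewrite ge_min lexx.
  have m2 : Num.min (s / 2) (tau / 2) <= tau / 2 by rewrite ge_min lexx orbT.
  have : S t.
    split=> [|t' tt']; first by rewrite /t; lra.
    have [tt|tt] := ltP tau t'; first exact: above.
    have -> : t'%:C = tau%:C + (t' - tau)%:C by rewrite -rmorphD addrC subrK.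
    by apply: Fz; rewrite cm_real ler0_norm; rewrite /t in tt'; lra.
  move=> /(ge_inf hS.2); rewrite -/tau /t; lra.
apply: cm_eps0 => e e0; have e30 : 0 < e / 3 by lra.
have [N [p hp]] := hF _ e30; pose G z := \sum_(k < N) p k * dn k z.
have [d hd] := @SD_epol R lnS p N 0.
have [r [r0 hr]] := SD_cont hd e30.
have cr : cm r%:C = r by rewrite cm_real gtr0_norm.
have [q [q0 hq]] := hOm r r0.
have h1 : cm (F 0 - G 0) <= e / 3 := hp 0 (or_intror erefl).
have h2 : cm (F r%:C - G r%:C) <= e / 3.
  by apply: hp; left; have := hq 0; rewrite cm0 addr0; apply.
have h3 : cm (G r%:C - G 0) <= e / 3 by apply: hr; rewrite subr0 cr.
rewrite above ?tau_eq0// sub0r cmN in h2.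
have -> : F 0 = (F 0 - G 0) - (G r%:C - G 0) + G r%:C by ring.
apply: le_trans (cmD _ _) _; have := cmB (F 0 - G 0) (G r%:C - G 0); lra.
Qed.

End Pairing.

(** * Operators on [H2] *)

Section Bridge.
Context {R : realType}.
Local Notation C := R[i].
Local Notation CC := (Cplx R).

Lemma normCE (z : CC) : `|z| = (cm z)%:C. Proof. by []. Qed.

Lemma tends_cvg (f : nat -> C) l : tends f l -> (f : nat -> CC) @ \oo --> (l : CC).
Proof.
move=> hf; apply/cvgrPdist_le => e e0.
have [re0 im0] : 0 < re e /\ e = (re e)%:C.
  by case: e e0 => a b; rewrite ltcE /= => /andP[/eqP-> h].
have [N hN] := hf _ re0; exists N => // n /hN.
by rewrite cmBC normCE im0 lecR.
Qed.

Lemma tends_limn (f : nat -> C) l : tends f l -> limn (f : nat -> CC) = l.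
Proof. by move=> /tends_cvg/cvg_lim; apply; exact: norm_hausdorff. Qed.

Lemma open_disc (A : set CC) w : open A -> A w ->
  exists r : R, 0 < r /\ forall z : C, cm z < r -> A (w + z).
Proof.
move=> oA Aw; have : nbhs w A by apply: open_nbhs_nbhs.
move=> /nbhs_ballP[e /= e0 he].
have [re0 im0] : 0 < re e /\ e = (re e)%:C.
  by case: e e0 {he} => a b; rewrite ltcE /= => /andP[/eqP-> h].
exists (re e); split=> // z zr; apply: he; rewrite -ball_normE /ball_/=.
by rewrite opprD addrA subrr sub0r normrN normCE im0 ltcR.
Qed.

Lemma shift_preimage (u : CC -> CC) w : koenigs_shifts u w ->
  forall s : C, 0 < re s -> exists z : C, 0 < re z /\ u z = u s + w.
Proof.
move=> [_ hw] s s0; have : (u @` half_plane 0) (w + u s).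
  apply: hw; exists (u s) => //; apply: subset_closure; exists s => //.
by case=> z z0 uz; exists z; split=> //; rewrite uz addrC.
Qed.

Lemma sqnormE (a : nat -> CC) : sqnorm a = (\sum_(k <oo) (cm (a k) ^+ 2)%:E)%E.
Proof. by []. Qed.

Lemma l2_sqnorm (x : H2 R) : l2 x (fine (sqnorm x)).
Proof.
move=> K; rewrite -lee_fin fineK; last first.
  by rewrite ge0_fin_numE ?sqnorm_ge0//; exact: (coefsP x).
rewrite sqnormE -sumEFin -(big_mkord xpredT (fun k => (cm (x k) ^+ 2)%:E)).
by apply: nneseries_lim_ge => k _ _; rewrite lee_fin sqr_ge0.
Qed.

Lemma sqnorm_le (a : nat -> CC) A : l2 a A -> (sqnorm a <= A%:E)%E.
Proof.
move=> la; rewrite sqnormE; apply: lime_le.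
  by apply: is_cvg_nneseries => k _ _; rewrite lee_fin sqr_ge0.
by apply: nearW => n; rewrite big_mkord sumEFin lee_fin; exact: la.
Qed.

Lemma mkH2 (a : nat -> C) A : l2 a A -> exists x : H2 R, forall k, x k = a k.
Proof.
move=> la; have h : (a : nat -> CC) \in square_summable.
  by rewrite inE; apply: le_lt_trans (sqnorm_le la) _; exact: ltry.
by exists (HardyDirichlet h).
Qed.

Lemma H2_ext (x y : H2 R) : (forall k, x k = y k) -> x = y.
Proof. by move=> h; apply/val_inj/funext. Qed.

Lemma H2_addE (x y : H2 R) k : (x + y) k = x k + y k.
Proof. by rewrite -[coefs (x + y)]/(val (x + y)) raddfD. Qed.

Lemma H2_scaleE (l : CC) (x : H2 R) k : (l *: x) k = l * x k.
Proof. by []. Qed.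

Lemma opZ (T : bounded_op (H2 R)) (l : CC) (x : H2 R) : T (l *: x) = l *: T x.
Proof. exact: linearZZ. Qed.

Lemma opB (T : bounded_op (H2 R)) (x y : H2 R) : T (x - y) = T x - T y.
Proof. exact: raddfB. Qed.

Lemma op_sum (T : bounded_op (H2 R)) (I : Type) (r : seq I) (F : I -> H2 R) :
  T (\sum_(i <- r) F i) = \sum_(i <- r) T (F i).
Proof. exact: raddf_sum. Qed.

Lemma H2_0E k : (0 : H2 R) k = 0.
Proof. by rewrite -[coefs 0]/(val 0) raddf0. Qed.

Lemma H2_sumE (I : Type) (r : seq I) (F : I -> H2 R) k :
  (\sum_(i <- r) F i) k = \sum_(i <- r) F i k.
Proof.
by elim: r => [|i r IH]; rewrite ?big_nil ?H2_0E// !big_cons H2_addE IH.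
Qed.

Lemma op_l2 (T : bounded_op (H2 R)) :
  exists M : R, 0 <= M /\ forall (x : H2 R) A, l2 x A -> l2 (T x) (M * A).
Proof.
have [M0 hM] := op_bounded T; pose M := `|re M0|.
exists (M ^+ 2); split; first exact: sqr_ge0.
move=> x A la K; have A0 := l2_ge0 la.
apply: le_trans (l2_sqnorm (T x) K) _.
have sA : fine (sqnorm x) <= A.
  rewrite -lee_fin fineK ?sqnorm_le//.
  by rewrite ge0_fin_numE ?sqnorm_ge0//; exact: (coefsP x).
have s0 : 0 <= fine (sqnorm x) by rewrite fine_ge0// sqnorm_ge0.
have t0 : 0 <= fine (sqnorm (T x)) by rewrite fine_ge0// sqnorm_ge0.
have := hM x; rewrite -[`|T x|]/((Num.sqrt (fine (sqnorm (T x))))%:C).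
rewrite -[`|x|]/((Num.sqrt (fine (sqnorm x)))%:C) => h.
have {}h : Num.sqrt (fine (sqnorm (T x))) <= M * Num.sqrt (fine (sqnorm x)).
  move: h; rewrite lecE => /andP[_]; rewrite reM /= mulr0 subr0 => h.
  by apply: le_trans h _; apply: ler_wpM2r; [exact: sqrtr_ge0|exact: ler_norm].
have : Num.sqrt (fine (sqnorm (T x))) ^+ 2 <= (M * Num.sqrt (fine (sqnorm x))) ^+ 2.
  by rewrite lerXn2r ?nnegrE ?mulr_ge0 ?sqrtr_ge0 ?normr_ge0.
rewrite exprMn !sqr_sqrtr// => h2; apply: le_trans h2 _.
by apply: ler_wpM2l; first exact: sqr_ge0.
Qed.

Lemma H2dot_tends (x y : H2 R) : tends (pairN x y) (H2dot x y).
Proof.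
have [d hd] := pair_tends (l2_sqnorm x) (l2_sqnorm y).
suff -> : H2dot x y = d by [].
by rewrite /H2dot; exact: tends_limn hd.
Qed.

Lemma H2dotDl (x y z : H2 R) : H2dot (x + y) z = H2dot x z + H2dot y z.
Proof.
apply: tends_unique (H2dot_tends _ _) _.
apply: tends_ext (tendsD (H2dot_tends x z) (H2dot_tends y z)) => n.
rewrite /pairN -big_split; apply: eq_bigr => k _; cbv beta.
by rewrite (H2_addE x y k) mulrDl.
Qed.

Lemma H2dotZl (c : CC) (x z : H2 R) : H2dot (c *: x) z = c * H2dot x z.
Proof.
apply: tends_unique (H2dot_tends _ _) _.
apply: tends_ext (tendsZ c (H2dot_tends x z)) => n.
by rewrite /pairN mulr_sumr; apply: eq_bigr => k _; rewrite (H2_scaleE c x k) mulrA.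
Qed.

Lemma H2_subE (x y : H2 R) k : (x - y) k = x k - y k.
Proof. by []. Qed.

Lemma H2dotBl (x y z : H2 R) : H2dot (x - y) z = H2dot x z - H2dot y z.
Proof.
apply: tends_unique (H2dot_tends _ _) _; rewrite -mulN1r.
apply: tends_ext (tendsD (H2dot_tends x z) (tendsZ (-1) (H2dot_tends y z))) => n.
rewrite /pairN mulN1r -sumrB; apply: eq_bigr => k _; cbv beta.
by rewrite (H2_subE x y k) mulrBl.
Qed.

Lemma H2dot0l (z : H2 R) : H2dot 0 z = 0.
Proof. by have := H2dotZl 0 0 z; rewrite scale0r mul0r. Qed.

Lemma H2dot_suml (I : Type) (r : seq I) (F : I -> H2 R) z :
  H2dot (\sum_(i <- r) F i) z = \sum_(i <- r) H2dot (F i) z.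
Proof.
by elim: r => [|i r IH]; rewrite ?big_nil ?H2dot0l// !big_cons H2dotDl IH.
Qed.

Lemma l2_delta n : l2 (fun k => (k == n)%:R : C) 1.
Proof.
move=> K; apply: (@le_trans _ _ (\sum_(k < K | k == n :> nat) 1)).
  rewrite [leRHS]big_mkcond/=; apply: ler_sum => k _.
  by case: eqP => _; rewrite ?cm1 ?cm0 ?expr1n// expr0n.
have [nK|Kn] := ltnP n K.
  by rewrite (big_pred1 (Ordinal nK)) => // k; rewrite -val_eqE.
rewrite big_pred0 ?ler01// => k; apply/negbTE; rewrite neq_ltn.
by rewrite (leq_trans (ltn_ord k) Kn).
Qed.

Lemma riesz (T : bounded_op (H2 R)) (y : H2 R) : exists (z : nat -> C) B, l2 z B /\
  forall x : H2 R, tends (pairN x z) (H2dot (T x) y).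
Proof.
have [M [M0 hM]] := op_l2 T.
have /choice[dl hdl] : forall n, exists x : H2 R, forall k, x k = (k == n)%:R.
  by move=> n; exact: mkH2 (l2_delta n).
pose z n : C := conjc (H2dot (T (dl n)) y).
pose Y := fine (sqnorm y); have lY : l2 y Y := l2_sqnorm y.
have Y0 := l2_ge0 lY.
pose tr (a : nat -> C) n : H2 R := \sum_(k < n) (a k : CC) *: dl k.
have trE a n k : tr a n k = if (k < n)%N then a k else 0.
  rewrite /tr H2_sumE; under eq_bigr do rewrite H2_scaleE hdl.
  case: ltnP => kn; last first.
    rewrite big1// => i _; case: eqP => [E|]; rewrite ?mulr0//.
    by have := ltn_ord i; rewrite -E ltnNge kn.
  rewrite (bigD1 (Ordinal kn))//= eqxx mulr1 big1 ?addr0// => i ik.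
  by rewrite eq_sym (_ : (i == k :> nat) = false) ?mulr0//; apply/negbTE.
have Ltr a n : H2dot (T (tr a n)) y = pairN a z n.
  rewrite /tr op_sum H2dot_suml /pairN; apply: eq_bigr => k _.
  by rewrite opZ H2dotZl /z conjcK.
have Lbd (x : H2 R) A t : 0 < t -> l2 x A -> cm (H2dot (T x) y) <= (t * (M * A) + Y / t) / 2.
  move=> t0 lx; apply: (tends_le (H2dot_tends _ _)); exists 0%N => n _.
  rewrite /pairN -(big_mkord xpredT (fun k => T x k * conjc (y k))).
  exact: pair_seg t0 (l2_seg _ _ (hM x A lx)) (l2_seg _ _ lY).
have M1 : 0 < M + 1 by lra.
exists z, (Y * (M + 1)); split.
  move=> n; set S := \sum_(k < n) _.
  have S0 : 0 <= S by apply: sumr_ge0 => k _; exact: sqr_ge0.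
  have lt : l2 (tr z n) S.
    move=> K; apply: (@le_trans _ _ (\sum_(k < maxn K n) cm (tr z n k) ^+ 2)).
      rewrite -!(big_mkord xpredT (fun k => cm (tr z n k) ^+ 2)).
      rewrite [leRHS](@big_cat_nat _ _ _ K)//= ?leq_maxl// lerDl.
      by apply: sumr_ge0 => k _; exact: sqr_ge0.
    rewrite (sum_vanish (F := fun k => cm (tr z n k) ^+ 2) (N := n)) ?leq_maxr//.
      by apply: ler_sum => k _; rewrite trE ltn_ord.
    by move=> k nk; rewrite trE ltnNge nk cm0 expr0n.
  have t0 : 0 < (M + 1)^-1 by rewrite invr_gt0.
  have := Lbd _ _ _ t0 lt; rewrite Ltr.
  have -> : pairN z z n = S%:C.
    by rewrite /pairN /S rmorph_sum; apply: eq_bigr => k _; exact: mulcj.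
  rewrite cm_real ger0_norm// invrK.
  have : (M + 1)^-1 * (M * S) <= S.
    by rewrite ler_pdivrMl//; nra.
  lra.
move=> x e e0; pose t := (Y + 1) / e.
have t0 : 0 < t by rewrite divr_gt0//; lra.
have e10 : 0 < e / (t * (M + 1)) by rewrite divr_gt0// mulr_gt0.
have [N hN] := tail_small (fun k => sqr_ge0 (cm (x k))) (l2_sqnorm x) e10.
exists N => n Nn; rewrite -Ltr cmBC.
have -> : H2dot (T x) y - H2dot (T (tr x n)) y = H2dot (T (x - tr x n)) y.
  by rewrite opB H2dotBl.
have lx : l2 (x - tr x n) (e / (t * (M + 1))).
  move=> K; rewrite -(big_mkord xpredT (fun k => cm ((x - tr x n) k) ^+ 2)).
  have E k : cm ((x - tr x n) k) ^+ 2 = if (k < n)%N then 0 else cm (x k) ^+ 2.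
    rewrite H2_subE trE; case: ltnP => _.
      by rewrite subrr cm0 expr0n.
    by rewrite subr0.
  under eq_bigr do rewrite E.
  apply: le_trans (hN (maxn K n)).
  apply: (@le_trans _ _ (\sum_(0 <= k < maxn K n) (if (k < n)%N then 0 else cm (x k) ^+ 2))).
    rewrite [leRHS](@big_cat_nat _ _ _ K)//= ?leq_maxl// lerDl.
    by apply: sumr_ge0 => k _; case: ifP => // _; exact: sqr_ge0.
  rewrite (@big_cat_nat _ _ _ n)//= ?leq_maxr// big_nat big1 ?add0r => [|k /andP[_ ->]//].
  rewrite [leRHS](@big_cat_nat _ _ _ n)//= ?leq_maxr//.
  rewrite [in leLHS]big_nat; under eq_bigr => k /andP[nk _] do rewrite ltnNge nk/=.
  by rewrite -big_nat lerDr; apply: sumr_ge0 => k _; exact: sqr_ge0.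
apply: le_trans (Lbd _ _ _ t0 lx) _.
have h1 : t * (M * (e / (t * (M + 1)))) <= e.
  have -> : t * (M * (e / (t * (M + 1)))) = e * (M / (M + 1)).
    by field; rewrite !gt_eqF.
  rewrite mulrA ler_pdivrMr//; nra.
have h2 : Y / t <= e.
  rewrite ler_pdivrMr// /t mulrC divfK ?gt_eqF//; lra.
lra.
Qed.

End Bridge.

(** * Eigenvectors and the commutant *)

Section Eigenvectors.
Context {R : realType}.
Local Notation C := R[i].
Local Notation CC := (Cplx R).

Lemma H2_coef_bound (x : H2 R) : exists M : R, 0 <= M /\ forall k, cm (x k) <= M.
Proof.
exists (1 + fine (sqnorm x)); have lx := l2_sqnorm x; have s0 := l2_ge0 lx.
split=> [|k]; first lra.
have : cm (x k) ^+ 2 <= fine (sqnorm x).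
  apply: le_trans (lx k.+1); rewrite big_ord_recr/= lerDr.
  by apply: sumr_ge0 => j _; exact: sqr_ge0.
have := sqr_ge0 (cm (x k) - 1); have := cm_ge0 (x k); nra.
Qed.

Lemma H2_series_tends (x : H2 R) (s : C) : 2 < re s ->
  tends (fun N => \sum_(k < N) x k * dn k s) (dirichlet_series x s).
Proof.
move=> s2; have [M [M0 hM]] := H2_coef_bound x.
have [l hl] : exists l, tends (fun N => \sum_(k < N) x k * dn k s) l.
  apply: cauchy_tends => e e0.
  have K0 : 0 < M * 2 + 1 by lra.
  have s20 : 0 < re s - 2 by lra.
  have [N hN] := expR_lnS_small s20 (divr_gt0 e0 K0).
  exists N => n m Nn nm; rewrite -!(big_mkord xpredT (fun k => x k * dn k s)).
  rewrite (@big_cat_nat _ _ _ n)//= addrAC subrr add0r.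
  apply: le_trans (cm_sum _ _ _) _.
  apply: (@le_trans _ _ (\sum_(n <= k < m) M * (wgt (-1) k * expR (- (lnS k * re s))))).
    apply: ler_sum => k _; rewrite cmM cm_dn /wgt addNr mulr0 expR0 mul1r.
    by apply: ler_wpM2r; [exact: expR_ge0|exact: hM].
  rewrite -mulr_sumr.
  have s3 : -1 + 3 <= re s by lra.
  apply: le_trans (ler_wpM2l M0 (wgt_tail n m s3)) _.
  have -> : re s - -1 - 3 = re s - 2 by ring.
  have := hN n Nn; rewrite ler_pdivlMr//.
  have := expR_ge0 (- (lnS n * (re s - 2))); nra.
suff -> : dirichlet_series x s = l by [].
by rewrite /dirichlet_series; exact: tends_limn hl.
Qed.

Lemma H2_DCoef (x : H2 R) : DCoef 2 (dirichlet_series x) x.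
Proof.
have [M [M0 hM]] := H2_coef_bound x.
by apply: (DCoef_series M0 hM) => s; exact: H2_series_tends.
Qed.

Lemma DCoef_shift x g (b : nat -> C) (w : C) : 0 <= re w -> DCoef x g b ->
  DCoef x (fun s => g (s + w)) (fun l => b l * dn l w).
Proof.
move=> w0 cg e e0; have [N [p [sp hp ap]]] := cg e e0.
exists N, (fun l => p l * dn l w); split.
- by move=> k Nk; rewrite sp// mul0r.
- move=> s xs; have := hp (s + w); rewrite /HP reD => /(_ _)/wrap[].
    by rewrite /HP in xs; lra.
  apply: le_trans; apply: le_refl_eq; congr (cm (_ - _)); apply: eq_bigr => k _.
  by rewrite dnD [dn k s * _]mulrC mulrA.
- move=> k; rewrite -mulrBl cmM; apply: le_trans (ap k); apply: ler_piMr; first exact: cm_ge0.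
  by rewrite cm_dn expR_le1 oppr_le0 mulr_ge0 ?lnS_ge0.
Qed.

Variables (u th phi : C -> C) (c1 : C) (x1 x2 : R) (v : C -> C) (E : nat -> nat -> C).
Variable A : bounded_op (H2 R).
Hypothesis th_App : forall x, 0 < x -> DApp x th.
Hypothesis uE : forall s, 0 < re s -> u s = s + th s.
Hypothesis u_inj : forall s t, 0 < re s -> 0 < re t -> u s = u t -> s = t.
Hypothesis x1_ge5 : 5 <= x1.
Hypothesis x1x2 : x1 <= x2.
Hypothesis v_App : DApp x2 (fun s => v s - s).
Hypothesis uv : forall s, x2 < re s -> x1 < re (v s) /\ u (v s) = s.
Hypothesis E_coef : forall l y, 1 <= y -> DCoef y (eu u l) (E l).
Hypothesis E_l2 : forall l, l2 (E l) 1.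
Hypothesis E_tri : forall l k, (k < l)%N -> E l k = 0.
Hypothesis phi_re : forall s, 0 < re s -> re s <= re (phi s).
Hypothesis u_phi : forall s, 0 < re s -> u (phi s) = u s + c1.
Hypothesis c1_pos : 0 < re c1.
Hypothesis A_comp : forall (f : H2 R) (s : C), 2^-1 < re s ->
  dirichlet_series (A f) s = dirichlet_series f (phi s).

(* Coefficients of [f \o u^-1] far to the right. *)
Definition beta (f : H2 R) (b : nat -> C) := DCoef x2 (fun s => dirichlet_series f (v s)) b.

Lemma beta_ex f : exists b, beta f b.
Proof.
apply: DApp_coef; apply: (DApp_v v_App uv).
apply: DApp_le (Coef_App (H2_DCoef f)); have := x1_ge5; lra.
Qed.

Lemma beta_uniq f b b' : beta f b -> beta f b' -> forall l, b l = b' l.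
Proof. exact: DCoef_uniq. Qed.

Lemma v_shift s w : x2 < re s -> 0 < re w -> 0 < re s -> x2 < re (s + w).
Proof. by move=> xs w0 s0; rewrite reD; lra. Qed.

Lemma iter_phi k s : 0 < re s -> re s <= re (iter k phi s) /\ u (iter k phi s) = u s + k%:R * c1.
Proof.
move=> s0; elim: k => [|k [IH1 IH2]]; first by rewrite mul0r addr0.
have p0 : 0 < re (iter k phi s) by apply: lt_le_trans IH1.
rewrite iterS; split; first by apply: le_trans IH1 _; exact: phi_re.
by rewrite u_phi// IH2 -natr1; ring.
Qed.

Lemma iter_A k f s : 2^-1 < re s ->
  dirichlet_series (iter k A f) s = dirichlet_series f (iter k phi s).
Proof.
elim: k f s => [//|k IH] f s s0; rewrite iterS A_comp// IH ?iterSr//.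
have := phi_re (s := s); lra.
Qed.

Lemma coef_iter_A f b k : beta f b -> forall j, iter k A f j = Sw E b (k%:R * c1) j.
Proof.
move=> bf; have [y [y1 hy cS]] := Sw_coef th_App uE E_coef E_tri (k%:R * c1) bf.
have ym : y <= Num.max y 2 by rewrite le_max lexx.
have y2 : 2 <= Num.max y 2 by rewrite le_max lexx orbT.
apply: (DCoef_uniq (DCoef_le y2 (H2_DCoef (iter k A f)))).
apply: Coef_ext (DCoef_le ym cS) => s; rewrite /HP gt_max => /andP[ys s2].
have s0 : 0 < re s by lra.
rewrite iter_A; last by rewrite -[2^-1]mul1r; lra.
have [i1 i2] := iter_phi k s0; have [v1 v2] := uv (hy s ys).
congr (dirichlet_series f _); have := x1_ge5.
by move=> x15; apply: u_inj; [lra|lra|rewrite v2 i2].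
Qed.

Lemma coef_beta f b : beta f b -> forall j, f j = Sw E b 0 j.
Proof. by move=> bf j; have := coef_iter_A 0 bf j; rewrite mul0r. Qed.

Lemma beta_A f b : beta f b -> beta (A f) (fun l => b l * dn l c1).
Proof.
move=> bf; apply: Coef_ext (DCoef_shift (ltW c1_pos) bf) => s; rewrite /HP => xs.
have [v1 v2] := uv xs; have x15 := x1_ge5; have x12 := x1x2.
have s1 : x2 < re (s + c1) by apply: v_shift => //; lra.
have [w1 w2] := uv s1.
have vs0 : 0 < re (v s) by lra.
rewrite A_comp; last by lra.
congr (dirichlet_series f _); apply: u_inj; [lra| |].
  have := phi_re vs0; lra.
by rewrite w2 u_phi// v2.
Qed.

Lemma eigenvectors : exists e : nat -> H2 R, [/\ forall l k, e l k = E l k,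
  forall l, beta (e l) (fun k => (k == l)%:R) & forall l, A (e l) = (dn l c1 : CC) *: e l].
Proof.
have /choice[e he] : forall l, exists x : H2 R, forall k, x k = E l k.
  by move=> l; exact: mkH2 (E_l2 l).
have es l s : 4 < re s -> dirichlet_series (e l) s = eu u l s.
  move=> s4; apply: (@tends_unique R (fun K => \sum_(k < K) e l k * dn k s)).
    by apply: H2_series_tends; lra.
  apply: (@tends_ext R (fun K => \sum_(k < K) E l k * dn k s)).
    by move=> n; apply: eq_bigr => k _; rewrite he.
  by apply: DCoef_tends (E_coef l (lexx _)) _; lra.
exists e; split=> // l.
  have sp : supp (fun k => (k == l)%:R : C) l.+1.
    by move=> k lk; rewrite gtn_eqF.
  apply: Coef_ext (Coef_pol (HP x2) dn (wgt_ge0 x2) sp) => s xs.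
  have [v1 v2] := uv xs; have x15 := x1_ge5.
  rewrite es; last lra.
  rewrite /eu v2 big_ord_recr/= eqxx mul1r big1 ?add0r// => i _.
  by rewrite ltn_eqF ?mul0r.
apply: H2_ext => k; rewrite H2_scaleE he.
have y2 : (2 : R) <= 4 by lra.
have y1 : (1 : R) <= 4 by lra.
have h2 : DCoef 4 (fun s => dn l c1 * eu u l s) (A (e l)).
  apply: Coef_ext (DCoef_le y2 (H2_DCoef (A (e l)))) => s.
  rewrite /HP => s4; have s0 : 0 < re s by lra.
  rewrite A_comp; last by rewrite -[2^-1]mul1r; lra.
  rewrite es; last by have := phi_re s0; lra.
  by rewrite /eu u_phi// dnD mulrC.
exact: (DCoef_uniq h2 (Coef_scal (wgt_ge0 4) (dn l c1) (E_coef l y1)) k).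
Qed.

Lemma dn_c1_inj l k : dn l c1 = dn k c1 -> l = k.
Proof.
move=> /(congr1 cm); rewrite !cm_dn => /expR_inj/oppr_inj h.
have {}h : lnS l = lnS k :> R by apply: (mulIf _ h); rewrite gt_eqF.
by case: (ltngtP l k) => // /(@lnS_incr R); rewrite h ltxx.
Qed.

Lemma commuting_eigen (T : bounded_op (H2 R)) (e : nat -> H2 R) :
  (forall l k, e l k = E l k) -> (forall l, A (e l) = (dn l c1 : CC) *: e l) ->
  (forall x, T (A x) = A (T x)) -> forall l, exists lam : CC, T (e l) = lam *: e l.
Proof.
move=> eE eA TA l; have [b hb] := beta_ex (T (e l)).
have b0 k : k != l -> b k = 0.
  move=> kl; have := beta_A hb; rewrite -TA eA opZ => h1.
  have h2 : beta ((dn l c1 : CC) *: T (e l)) (fun k => dn l c1 * b k).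
    apply: Coef_ext (Coef_scal (wgt_ge0 x2) (dn l c1) hb) => s xs.
    have [v1 v2] := uv xs; have x15 := x1_ge5.
    have s2 : 2 < re (v s) by lra.
    apply: tends_unique (H2_series_tends _ s2).
    apply: tends_ext (tendsZ (dn l c1) (H2_series_tends (T (e l)) s2)) => n.
    by rewrite mulr_sumr; apply: eq_bigr => j _; rewrite H2_scaleE mulrA.
  have := beta_uniq h1 h2 k; rewrite mulrC => /eqP.
  rewrite -subr_eq0 -mulrBl mulf_eq0 subr_eq0 => /orP[/eqP/dn_c1_inj kl'|/eqP//].
  by rewrite kl' eqxx in kl.
exists (b l); apply: H2_ext => k; rewrite H2_scaleE (coef_beta hb) eE /Sw.
have dn0 j : dn j 0 = 1 :> C by rewrite /dn /ebase mulr0 oppr0 ex0.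
have [lk|kl] := leqP l k.
  rewrite (bigD1 (Ordinal (lk : (l < k.+1)%N)))//= dn0 mulr1 big1 ?addr0// => i il.
  by rewrite b0 ?mul0r.
rewrite E_tri// mulr0 big1// => i _; rewrite b0 ?mul0r//.
by rewrite neq_ltn (leq_ltn_trans (leq_ord i) kl).
Qed.

Variable Om : C -> Prop.
Hypothesis Om_shift : forall w, Om w ->
  forall s, 0 < re s -> exists z, 0 < re z /\ u z = u s + w.
Hypothesis Om_disc : forall t : R, 0 < t ->
  exists r, 0 < r /\ forall z, cm z < r -> Om (t%:C + z).

Lemma annihilator (T : bounded_op (H2 R)) m (x y : 'I_m -> H2 R) (al : 'I_m -> C) :
  (forall z, T (A z) = A (T z)) ->
  (forall k, \sum_i al i * H2dot (iter k A (x i)) (y i) = 0) ->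
  \sum_i al i * H2dot (T (x i)) (y i) = 0.
Proof.
move=> TA ann; have [e [eE eb eA]] := eigenvectors.
have /choice[lam hlam] := commuting_eigen eE eA TA.
have /choice[b hb] : forall i, exists b, beta (x i) b by move=> i; exact: beta_ex.
have /choice[z hz] : forall i, exists zB : (nat -> C) * R, l2 zB.1 zB.2 /\
   forall f : H2 R, tends (pairN f zB.1) (H2dot (T f) (y i)).
  by move=> i; have [z [B [h1 h2]]] := riesz T (y i); exists (z, B).
have /choice[M hM] : forall i, exists M : R, 0 <= M /\ forall l, cm (b i l) <= wgt x2 l * M.
  move=> i; have [M [M0 hM]] := DApp_bounded (Coef_App (hb i)); exists M; split=> //.
  exact: DCoef_bound (hb i) hM.
pose B l := \sum_i al i * (b i l * H2dot (e l) (y i)).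
have le l : l2 (e l) 1 by move=> K; under eq_bigr do rewrite eE; exact: E_l2.
have B0 : forall l, B l = 0.
  pose ly i := l2_sqnorm (y i).
  pose Q := \sum_i cm (al i) * (M i * ((1 + fine (sqnorm (y i))) / 2)).
  have Q0 : 0 <= Q.
    apply: sumr_ge0 => i _; rewrite mulr_ge0 ?cm_ge0// mulr_ge0 ?(hM i).1//.
    by have := l2_ge0 (ly i); lra.
  have [k0 [_ hk0]] := nat_ge ((x2 + 4) / re c1).
  apply: (dirichlet_vanish (k0 := k0) c1_pos Q0 (x := x2)) => [l|k kk].
    apply: le_trans (cm_sum _ _ _) _; rewrite /Q mulr_sumr; apply: ler_sum => i _.
    rewrite !cmM [leRHS]mulrCA; apply: ler_wpM2l; first exact: cm_ge0.
    rewrite [leRHS]mulrA; apply: ler_pM (cm_ge0 _) (cm_ge0 _) ((hM i).2 l) _.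
    apply: (tends_le (H2dot_tends _ _)); exists 0%N => n _.
    exact: pairN_bound (le l) (ly i).
  apply: (@tends_ext R (fun n => \sum_i al i *
      \sum_(l < n) b i l * dn l (k%:R * c1) * H2dot (e l) (y i))).
    move=> n; rewrite /B; under [RHS]eq_bigr do rewrite mulr_suml.
    rewrite exchange_big/=; apply: eq_bigr => i _; rewrite mulr_sumr.
    by apply: eq_bigr => l _; ring.
  apply: (eq_ind (\sum_i al i * H2dot (iter k A (x i)) (y i)) (tends _) _ _ (ann k)).
  refine (@tends_sum R m (fun i n => al i *
      \sum_(l < n) b i l * dn l (k%:R * c1) * H2dot (e l) (y i)) _ _) => i.
  apply: tendsZ; apply: (pair_Sw (E := E) (p := fun l => H2dot (e l) (y i)) (z := y i) (x := x2) (M := M i)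
     (Z := fine (sqnorm (y i)))) => //.
  - exact: (hM i).1.
  - exact: (hM i).2.
  - rewrite re_nat -ler_pdivrMr//.
    by apply: le_trans hk0 _; rewrite ler_nat.
  - move=> l; apply: tends_ext (H2dot_tends (e l) (y i)) => n.
    by apply: eq_bigr => j _; rewrite eE.
  - apply: tends_ext (H2dot_tends (iter k A (x i)) (y i)) => n.
    by apply: eq_bigr => j _; rewrite (coef_iter_A k (hb i)).
pose Xi i := fine (sqnorm (x i)).
have lx i : l2 (x i) (Xi i) := l2_sqnorm (x i).
have dom w : Om w \/ w = 0 -> forall i, l2 (Sw E (b i) w) (Xi i).
  move=> [ow|->] i K.
    have cx : DCoef x1 (dirichlet_series (x i)) (x i).
      by apply: DCoef_le (H2_DCoef (x i)); have := x1_ge5; lra.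
    apply: (Sw_contract th_App uE u_inj x1_ge5 x1x2 v_App uv E_coef E_tri
      (Om_shift ow) cx (hb i) (lx i)).
  by under eq_bigr do rewrite -(coef_beta (hb i)); exact: lx.
have /choice[D hD] : forall iw : 'I_m * C, exists d, (Om iw.2 \/ iw.2 = 0) ->
     tends (pairN (Sw E (b iw.1) iw.2) (z iw.1).1) d.
  move=> [i w] /=; have [ow|no] := pselect (Om w \/ w = 0); last by exists 0.
  by have [d hd] := pair_tends (dom w ow i) (hz i).1; exists d.
pose F w := \sum_i al i * D (i, w).
have F0 : F 0 = \sum_i al i * H2dot (T (x i)) (y i).
  apply: eq_bigr => i _; congr (_ * _).
  apply: tends_unique (hD (i, 0) (or_intror erefl)) _.
  apply: tends_ext ((hz i).2 (x i)) => n.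
  by apply: eq_bigr => k _; rewrite (coef_beta (hb i)).
rewrite -F0; apply: (@continuation R F Om (Num.max (x2 + 4) 1)) => //.
- move=> eps e0; pose S := \sum_i cm (al i); have S0 : 0 <= S.
    by apply: sumr_ge0 => i _; exact: cm_ge0.
  have S1 : 0 < S + 1 by lra.
  have /choice[N hN] : forall i, exists N, forall a d, l2 a (Xi i) -> tends (pairN a (z i).1) d ->
     forall n, (N <= n)%N -> cm (d - pairN a (z i).1 n) <= eps / (S + 1).
    move=> i; apply: pair_unif (l2_ge0 (lx i)) (hz i).1 _; exact: divr_gt0.
  pose K := \max_i N i.
  exists K, (fun l => \sum_i al i * (b i l * \sum_(k < K) E l k * conjc ((z i).1 k))) => w ow.
  have -> : \sum_(l < K) (\sum_i al i * (b i l * \sum_(k < K) E l k * conjc ((z i).1 k))) * dn l w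
     = \sum_i al i * pairN (Sw E (b i) w) (z i).1 K.
    under eq_bigr do rewrite mulr_suml.
    rewrite exchange_big/=; apply: eq_bigr => i _.
    under eq_bigr do rewrite -mulrA; rewrite -mulr_sumr; congr (_ * _).
    rewrite /pairN /Sw; under [RHS]eq_bigr do rewrite mulr_suml.
    rewrite (sum_tri (F := fun l k => b i l * dn l w * E l k * conjc ((z i).1 k))); last first.
      by move=> l k kl; rewrite E_tri// mulr0 mul0r.
    apply: eq_bigr => l _; rewrite mulrAC mulr_sumr; apply: eq_bigr => k _; ring.
  rewrite /F -sumrB; apply: le_trans (cm_sum _ _ _) _.
  apply: (@le_trans _ _ (\sum_i cm (al i) * (eps / (S + 1)))).
    apply: ler_sum => i _; rewrite -mulrBr cmM; apply: ler_wpM2l; first exact: cm_ge0.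
    apply: hN; [exact: dom|exact: (hD (i, w))|exact: leq_bigmax].
  rewrite -mulr_suml -/S mulrA ler_pdivrMr//; nra.
- move=> t; rewrite ge_max => /andP[tx t1].
  have t0 : 0 < t by lra.
  have ot : Om t%:C by have [r [r0 hr]] := Om_disc t0; have := hr 0; rewrite cm0 addr0; apply.
  apply: (@tends_unique R (fun n => \sum_i al i *
      \sum_(l < n) b i l * dn l t%:C * (lam l * H2dot (e l) (y i)))); last first.
    apply: (@tends_ext R (fun=> 0)); last exact: tends_cst.
    move=> n; transitivity (\sum_(l < n) dn l t%:C * lam l * B l).
      by rewrite big1// => l _; rewrite B0 mulr0.
    rewrite /B; under eq_bigr do rewrite mulr_sumr.
    rewrite exchange_big/=; apply: eq_bigr => i _; rewrite mulr_sumr.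
    by apply: eq_bigr => l _; ring.
  refine (@tends_sum R m (fun i n => al i *
      \sum_(l < n) b i l * dn l t%:C * (lam l * H2dot (e l) (y i))) _ _) => i.
  apply: tendsZ; apply: (pair_Sw (E := E) (p := fun l => lam l * H2dot (e l) (y i)) (z := (z i).1) (x := x2) (M := M i)
     (Z := (z i).2)) => //.
  - exact: (hM i).1.
  - exact: (hM i).2.
  - exact: (hz i).1.
  - move=> l; rewrite -H2dotZl -hlam; apply: tends_ext ((hz i).2 (e l)) => n.
    by apply: eq_bigr => j _; rewrite eE.
  - by apply: (hD (i, t%:C)); left.
Qed.

End Eigenvectors.

(** * Symbols with characteristic one *)

Section Symbols.
Context {R : realType}.
Local Notation C := R[i].
Local Notation CC := (Cplx R).

Lemma unif_dirichletP (c : nat -> CC) (psi : CC -> CC) : unif_dirichlet c psi ->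
  forall x e : R, 0 < x -> 0 < e -> exists N0, forall N s, (N0 <= N)%N -> x < re s ->
    cm (psi s - \sum_(k < N) c k * dn k s) <= e.
Proof.
move=> h x e x0 e0; have := h x x0.
have ee : 0 < (e%:C : C) by rewrite ltcR.
move=> /(_ [set g | forall s, half_plane x s -> ball (psi s) (e%:C) (g s)]).
case.
  apply/uniform_nbhs; exists [set xy | ball xy.1 (e%:C : C) xy.2]; split.
    by exists (e%:C : C).
  by move=> g hg s xs; apply: hg.
move=> N0 _ hN; exists N0 => N s /hN H /H.
by rewrite -ball_normE /ball_/= normCE ltcR => /ltW.
Qed.

Lemma unif_dirichlet_DCoef (c : nat -> CC) (psi : CC -> CC) : unif_dirichlet c psi ->
  forall x, 0 < x -> DCoef x psi c.
Proof.
move=> h x x0 e e0; have e20 : 0 < e / 2 by lra.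
have [N hN] := unif_dirichletP h x0 e20.
exists N, (fun k => if (k < N)%N then c k else 0); split.
- by move=> k Nk; rewrite ltnNge Nk.
- move=> s xs; under eq_bigr do rewrite ltn_ord.
  by apply: le_trans (hN N s (leqnn _) xs) _; lra.
move=> k; case: ltnP => kN; first by rewrite subrr cm0 mulr_ge0 ?wgt_ge0// ltW.
rewrite subr0; pose s : C := (x + 1)%:C.
have xs : x < re s by rewrite /s/=; lra.
have h1 := hN _ s kN xs; have h2 := hN _ s (leqW kN) xs.
have : cm (c k * dn k s) <= e.
  have -> : c k * dn k s = (psi s - \sum_(j < k) c j * dn j s) -
     (psi s - \sum_(j < k.+1) c j * dn j s) by rewrite big_ord_recr/=; ring.
  by apply: le_trans (cmB _ _) _; lra.
rewrite cmM cm_dn /wgt expRN /s /= => h3.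
by rewrite mulrC -ler_pdivrMr ?expR_gt0.
Qed.

Lemma unif_dirichlet_cst (c : nat -> CC) (psi : CC -> CC) : unif_dirichlet c psi ->
  (forall k, (0 < k)%N -> c k = 0) -> forall s, 0 < re s -> psi s = c 0%N.
Proof.
move=> h c0 s s0; have s20 : 0 < re s / 2 by lra.
apply: cm_eps_eq => e e0.
have [N hN] := unif_dirichletP h s20 e0.
have := hN N.+1 s (leqnSn _); rewrite big_ord_recl big1 => [|i _]; last by rewrite c0 ?mul0r.
by rewrite dn_one mulr1 addr0; apply; lra.
Qed.

Lemma rotate_neg (a : C) : exists t : R, re a * cos t + im a * sin t <= - (cm a / 2).
Proof.
have [h1|h1] := leP (re a) (- (cm a / 2)); first by exists 0; rewrite cos0 sin0; lra.
have [h2|h2] := leP (- re a) (- (cm a / 2)); first by exists pi; rewrite cospi sinpi; lra.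
have [h3|h3] := leP (im a) (- (cm a / 2)).
  by exists (pi / 2); rewrite cos_pihalf sin_pihalf; lra.
exists (- (pi / 2)); rewrite cosN sinN cos_pihalf sin_pihalf.
have : `|re a| < cm a / 2 by rewrite ltr_norml; lra.
have [b0|b0] := leP 0 (im a); have := cm_le a; last by rewrite (ltr0_norm b0); lra.
by rewrite (ger0_norm b0); lra.
Qed.

(* If [re (c 0)] were nonpositive, then far to the right the next nonzero term
   would take the real part of [psi] to negative values. *)
Lemma re_coef0_gt0 x (psi : C -> C) (c : nat -> C) : DCoef x psi c ->
  (forall s, 0 < re s -> 0 < re (psi s)) -> (exists k, (0 < k)%N /\ c k != 0) ->
  0 < re (c 0%N).
Proof.
move=> cpsi psi0 [k [k0 ck]]; rewrite ltNge; apply/negP => c0.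
have ex_m : exists m, (0 < m)%N && (c m != 0) by exists k; rewrite k0.
have [m /andP[m0 cm_m] min_m] := ex_minnP ex_m.
have E z : \sum_(j < m.+1) c j * dn j z = c 0%N + c m * dn m z.
  rewrite big_ord_recr/=; congr (_ + _); case: m m0 min_m {cm_m} => // m _ min_m.
  rewrite big_ord_recl big1 ?addr0 ?dn_one ?mulr1// => i _.
  have [->|ci] := eqVneq (c (lift ord0 i)) 0; first by rewrite mul0r.
  have := min_m (lift ord0 i); rewrite ci => /(_ isT).
  by rewrite lift0 ltnS leqNgt ltn_ord.
have [M [M0 hM]] := DApp_bounded (Coef_App cpsi); have cM := DCoef_bound cpsi hM.
have [t ht] := rotate_neg (c m).
have lm : 0 < lnS m :> R by have := @lnS_incr R 0 m m0; rewrite lnS0.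
pose d : R := lnS m.+1 - lnS m; have d0 : 0 < d by rewrite subr_gt0 lnS_incr.
pose L : R := lnS m.+1 * (x + 3); pose D := 4 * (M + 1) * expR L.
have D0 : 0 < D by rewrite !mulr_gt0 ?expR_gt0//; lra.
have a0 : 0 < cm (c m) by rewrite cm_gt0.
have [X hX] := expR_small d0 (divr_gt0 a0 D0).
pose y := `|X| + `|x| + 4; have yX : X <= y by rewrite /y; have := ler_norm X; have := normr_ge0 x; lra.
have yx : x + 3 <= y by rewrite /y; have := ler_norm x; have := normr_ge0 X; lra.
have y0 : 0 < y by rewrite /y; have := normr_ge0 x; have := normr_ge0 X; lra.
pose s : C := y +i* (t / lnS m).
have tl := @DCoef_tail _ _ _ _ _ m.+1 s cpsi M0 cM yx.
have rE : re (c m * dn m s) = expR (- (lnS m * y)) * (re (c m) * cos t + im (c m) * sin t).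
  have lt : lnS m * (t / lnS m) = t by rewrite mulrC divfK// gt_eqF.
  rewrite reM /dn /ebase /ex /s /= !mul0r subr0 addr0 lt cosN sinN.
  ring.
have p0 := psi0 s y0.
have e0 := expR_gt0 (- (lnS m * y)).
have b1 : M * (2 * expR (- (lnS m.+1 * (y - x - 3)))) <= cm (c m) / 2 * expR (- (lnS m * y)).
  have -> : expR (- (lnS m.+1 * (y - x - 3))) = expR (- (lnS m * y)) * (expR (- (d * y)) * expR L).
    by rewrite -!expRD; congr expR; rewrite /d /L; ring.
  have := hX y yX; rewrite ler_pdivlMr// /D => h.
  have : M * (2 * (expR (- (d * y)) * expR L)) <= cm (c m) / 2.
    have f0 := expR_ge0 (- (d * y)); have l0 := expR_ge0 L; have := mulr_ge0 f0 l0; nra.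
  move=> {}h; nra.
have := re_le (psi s - \sum_(j < m.+1) c j * dn j s).
rewrite E reB reD rE => h.
have : expR (- (lnS m * y)) * (re (c m) * cos t + im (c m) * sin t) <=
   expR (- (lnS m * y)) * (- (cm (c m) / 2)) by rewrite ler_pM2l.
move: tl; rewrite E [re s]/=; lra.
Qed.

Lemma koenigs_inj (u th phi : C -> C) (c1 : C) :
  (forall x, 0 < x -> DApp x th) ->
  (forall s, 0 < re s -> u s = s + th s) ->
  (forall s, 0 < re s -> re s <= re (phi s)) ->
  (forall s, 0 < re s -> u (phi s) = u s + c1) -> 0 < re c1 ->
  (forall s t, 0 < re s -> 0 < re t -> phi s = phi t -> s = t) ->
  forall s t, 0 < re s -> 0 < re t -> u s = u t -> s = t.
Proof.
move=> th_App uE phi_re u_phi c1_pos phi_inj s t s0 t0 ust.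
have [y1 [y11 hy]] := DApp_contract (th_App _ ltr01).
pose x := Num.min (re s) (re t) / 2.
have x0 : 0 < x by rewrite divr_gt0// lt_min s0 t0.
have [xs xt] : x < re s /\ x < re t.
  have : x * 2 <= re s by rewrite /x divfK// ge_min lexx.
  have : x * 2 <= re t by rewrite /x divfK// ge_min lexx orbT.
  by lra.
have [B [B0 hB]] := u_bounded_shift th_App uE x0.
have itk k r : 0 < re r -> re r <= re (iter k phi r) /\ u (iter k phi r) = u r + k%:R * c1.
  exact: (iter_phi phi_re u_phi).
have far r k : x < re r -> (`|y1 + B - re (u r)| + 1) / re c1 <= k%:R -> y1 < re (iter k phi r).
  move=> xr; rewrite ler_pdivrMr// => hk; have r0 : 0 < re r by lra.
  have [h1 h2] := itk k r r0; have := hB (iter k phi r) (lt_le_trans xr h1).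
  have := re_le (u (iter k phi r) - iter k phi r); rewrite reB h2 reD.
  rewrite re_nat; have := ler_norm (y1 + B - re (u r)); lra.
have [k [_ hk]] := nat_ge ((`|y1 + B - re (u s)| + 1) / re c1).
have fs := far s k xs hk; have ft : y1 < re (iter k phi t) by apply: far; rewrite // -ust.
have E : iter k phi s = iter k phi t.
  have [h1 h2] := itk k s s0; have [h3 h4] := itk k t t0.
  move: h2; rewrite ust -h4 uE ?uE; [|lra|lra] => h.
  apply/eqP; rewrite -subr_eq0 -cm_eq0 eq_le cm_ge0 andbT.
  have := hy _ (lexx _) _ _ ft fs.
  have -> : th (iter k phi t) - th (iter k phi s) = iter k phi s - iter k phi t.
    by rewrite -[th (iter k phi t)](addKr (iter k phi t)) -h; ring.
  rewrite cmBC; have : (2^-1 : R) = 1 / 2 by rewrite mul1r.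
  by move=> ->; rewrite [cm (iter k phi t - _)]cmBC; lra.
elim: k E {hk fs ft} => //= k IH /phi_inj h; apply: IH; apply: h.
  by have := (itk k s s0).1; lra.
by have := (itk k t t0).1; lra.
Qed.

End Symbols.

Lemma row_span_or_annihilator (F : fieldType) m (v : nat -> 'rV[F]_m) (t : 'rV[F]_m) :
  (forall a : 'cV[F]_m, (forall k, v k *m a = 0) -> t *m a = 0) ->
  exists K (d : nat -> F), t = \sum_(k < K) d k *: v k.
Proof.
move=> ht; pose V K := \matrix_(k < K) v k.
have exr : exists r, `[< exists K, \rank (V K) = r >] by exists (\rank (V 0%N)); apply/asboolP; exists 0%N.
have ler : forall r, `[< exists K, \rank (V K) = r >] -> (r <= m)%N.
  by move=> r /asboolP[K <-]; exact: rank_leq_col.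
have [r /asboolP[K rK] maxr] := ex_maxnP exr ler.
have vV k : (v k <= V K)%MS.
  pose K' := maxn K k.+1; have kK' : (k < K')%N by rewrite leq_maxr.
  have VV : (V K <= V K')%MS.
    apply/row_subP => i; rewrite rowK.
    have iK' : (i < K')%N := leq_trans (ltn_ord i) (leq_maxl _ _).
    by have := row_sub (Ordinal iK') (V K'); rewrite rowK.
  apply: submx_trans (_ : v k <= V K')%MS _.
    by have := row_sub (Ordinal kK') (V K'); rewrite rowK.
  rewrite -(mxrank_leqif_sup VV) rK eqn_leq maxr ?andbT; last by apply/asboolP; exists K'.
  by rewrite -rK mxrankS.
have /submxP[d ->] : (t <= V K)%MS.
  rewrite submxE; apply/eqP/matrixP => i j.
  have /matrixP/(_ i 0) : t *m (cokermx (V K) *m delta_mx j (0 : 'I_1)) = 0.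
    by apply: ht => k; move: (vV k); rewrite submxE mulmxA => /eqP->; rewrite mul0mx.
  by rewrite mulmxA -colE !mxE.
exists K, (fun k => if insub k is Some i then d 0 i else 0).
by rewrite mulmx_sum_row; apply: eq_bigr => k _; rewrite rowK valK.
Qed.

(** * The weak operator topology *)

Section OperatorTopology.
Context {K : numFieldType} {H : normedModType K}.
Implicit Types A T : @bounded_op K H.

Lemma iter_op_bounded A i : exists M : K, forall x, `|iter i A x| <= M * `|x|.
Proof.
elim: i => [|i [M hM]]; first by exists 1 => x; rewrite mul1r.
have [N hN] := op_bounded A; exists (`|N| * M) => x; rewrite iterS -mulrA.
have h := hN (iter i A x).
have E : N * `|iter i A x| = `|N| * `|iter i A x|.
  by rewrite -[LHS]ger0_norm ?normrM ?normr_id//; exact: le_trans h.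
by apply: le_trans h _; rewrite E; apply: ler_wpM2l.
Qed.

Lemma poly_op A (d : nat -> K) n : exists T, op_alg A T /\
  forall x, T x = \sum_(i < n) d i *: iter i A x.
Proof.
pose f (x : H) := \sum_(i < n) d i *: iter i A x.
have itl i a x y : iter i A (a *: x + y) = a *: iter i A x + iter i A y.
  by elim: i => // i IH; rewrite !iterS IH linearP.
have lf : linear f.
  move=> a x y; rewrite /f scaler_sumr -big_split/=; apply: eq_bigr => i _.
  by rewrite itl scalerDr scalerA [d i * a]mulrC -scalerA.
pose L : {linear H -> H} := HB.pack f (GRing.isLinear.Build K H H *:%R f lf).
have bf : exists M : K, forall x, `|L x| <= M * `|x|.
  have /choice[M hM] := iter_op_bounded A.
  exists (\sum_(i < n) `|d i| * M i) => x; rewrite mulr_suml.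
  apply: le_trans (ler_norm_sum _ _ _) _; apply: ler_sum => i _.
  by rewrite normrZ -mulrA; apply: ler_wpM2l.
exists (BoundedOp bf); split; last by [].
exists (\poly_(i < n) d i) => x; rewrite /= /f.
rewrite (big_ord_widen n (fun i => (\poly_(i < n) d i)`_i *: iter i A x)) ?size_poly//.
rewrite [RHS]big_mkcond/=; apply: eq_bigr => i _; rewrite coef_poly ltn_ord.
case: ltnP => // h; have := nth_default 0 h; rewrite coef_poly ltn_ord => ->.
by rewrite scale0r.
Qed.

Variable dot : H -> H -> K.

Lemma matrix_coef_continuous x y :
  continuous ((fun T => dot (T x) y) : wot dot -> K^o).
Proof.
move=> T; have c1 : continuous (matrix_coef dot : wot dot -> {ptws H * H -> K^o}).
  exact: initial_continuous.
have c2 := @proj_continuous (H * H)%type (fun=> K^o) (x, y).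
exact: (continuous_comp (c1 T) (c2 _)).
Qed.

Lemma wot_nbhs_finite T (U : set (wot dot)) : nbhs (T : wot dot) U ->
  exists s : seq (H * H), forall S : @bounded_op K H,
    {in s, forall z, dot (S z.1) z.2 = dot (T z.1) z.2} -> U S.
Proof.
rewrite nbhsE => -[B [[V oV <-] VT] VU].
pose agree (s : seq (H * H)) := [set g : {ptws H * H -> K^o} |
  forall z, z \in s -> g z = matrix_coef dot T z].
pose G := filter_from setT agree.
have FG : Filter G.
  apply: filter_fromT_filter; first by exists [::].
  move=> s t; exists (s ++ t) => g hg; split=> z zs; apply: hg.
    by rewrite mem_cat zs.
  by rewrite mem_cat zs orbT.
have : {ptws, G --> matrix_coef dot T}.
  apply/pointwise_cvgP => z W /nbhs_singleton Wz.
  exists [:: z] => // g hg /=; rewrite hg ?mem_head//.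
move=> /(_ V)[|s _ hs]; first exact: open_nbhs_nbhs.
by exists s => S hS; apply: VU; apply: hs => z zs; exact: hS.
Qed.

End OperatorTopology.

Section MinimalCommutant.
Context {R : realType}.
Local Notation C := R[i].
Local Notation CC := (Cplx R).
Variable A : bounded_op (H2 R).

Lemma closure_op_alg_sub :
  closure (op_alg A : set (wot H2dot)) `<=` (commutant A : set (bounded_op (H2 R))).
Proof.
move=> T clT x; apply: H2_ext => k.
have [dl hdl] := mkH2 (l2_delta (R := R) k).
have dotdl (f : H2 R) : H2dot f dl = f k.
  apply: tends_unique (H2dot_tends f dl) _ => e e0; exists k.+1 => n kn.
  rewrite /pairN (bigD1 (Ordinal kn))//= hdl eqxx conjc1 mulr1 big1 => [|i ik].
    by rewrite addr0 subrr cm0 ltW.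
  by rewrite hdl (_ : (i == k :> nat) = false) ?conjc0 ?mulr0//; apply/negbTE.
have [z [B [lz hz]]] := riesz A dl; have [z' hz'] := mkH2 lz.
have dotA (f : H2 R) : H2dot (A f) dl = H2dot f z'.
  apply: tends_unique (hz f) _; apply: tends_ext (H2dot_tends f z') => n.
  by apply: eq_bigr => i _; rewrite hz'.
pose g (S : wot H2dot) : CC := H2dot ((S : bounded_op (H2 R)) (A x)) dl -
  H2dot ((S : bounded_op (H2 R)) x) z'.
have cg : continuous g.
  by move=> S; exact: (cvgB (@matrix_coef_continuous _ _ H2dot (A x) dl S)
    (@matrix_coef_continuous _ _ H2dot x z' S)).
have cl0 : closed [set (0 : CC)].
  by apply: accessible_closed_set1; apply: hausdorff_accessible; exact: norm_hausdorff.
have : g T = 0.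
  apply: (@preimage_closed _ _ g _ (fun S _ => cg S) cl0 T).
  apply: closureS clT => S [p hp] /=.
  apply/eqP; rewrite subr_eq0 -dotA; apply/eqP; congr (H2dot _ _); rewrite !hp.
  by rewrite op_sum; apply: eq_bigr => i _; rewrite opZ -iterSr iterS.
by rewrite /g -dotA !dotdl => /eqP; rewrite subr_eq0 => /eqP.
Qed.

Lemma commutant_sub_closure :
  (forall (T : bounded_op (H2 R)) m (x y : 'I_m -> H2 R) (al : 'I_m -> C),
    (forall z, T (A z) = A (T z)) ->
    (forall k, \sum_i al i * H2dot (iter k A (x i)) (y i) = 0) ->
    \sum_i al i * H2dot (T (x i)) (y i) = 0) ->
  (commutant A : set (bounded_op (H2 R))) `<=` closure (op_alg A : set (wot H2dot)).
Proof.
move=> ann T TA U /wot_nbhs_finite[s hs].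
pose x (i : 'I_(size s)) := (tnth (in_tuple s) i).1.
pose y (i : 'I_(size s)) := (tnth (in_tuple s) i).2.
pose v k : 'rV[CC]_(size s) := \row_i H2dot (iter k A (x i)) (y i).
pose t : 'rV[CC]_(size s) := \row_i H2dot (T (x i)) (y i).
have [a ha|n [d hd]] := @row_span_or_annihilator _ _ v t.
  apply/matrixP => i1 j1; rewrite (ord1 i1) (ord1 j1) !mxE.
  under eq_bigr do rewrite mxE mulrC.
  apply: ann TA _ => k; have /matrixP/(_ 0 0) := ha k; rewrite !mxE => E.
  by rewrite -[RHS]E; apply: eq_bigr => i _; rewrite mxE mulrC.
have [S [aS hS]] := poly_op A d n; exists S; split=> //; apply: hs => z zs.
have [i ->] : exists i, z = (x i, y i).
  have /tnthP[i zi] : z \in in_tuple s by [].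
  by exists i; rewrite /x /y -zi; case: (z).
rewrite hS H2dot_suml /=; have /matrixP/(_ 0 i) := hd; rewrite summxE !mxE => ->.
by apply: eq_bigr => k _; rewrite H2dotZl !mxE.
Qed.

End MinimalCommutant.

Theorem theorem7p1 (R : realType) (phi psi u : Cplx R -> Cplx R)
    (c : nat -> Cplx R) (Cphi : bounded_op (H2 R))
    (phi_G : GordonHedenmalm 1 c psi phi)
    (phi_univalent : univalent phi)
    (psi_nonconstant : nonconstant psi)
    (u_koenigs : koenigs_map (c 0%N) phi u)
    (u_G : G_pos u)
    (Omega_open : open (koenigs_shifts u))
    (Omega_reals : forall t : R, 0 < t -> koenigs_shifts u t%:C)
    (Cphi_comp : composition_operator phi Cphi) :
  minimal_commutant H2dot Cphi.
Proof.
have [_ phiE cpsi psi_half] := phi_G.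
have psi_pos s : 0 < re s -> 0 < re (psi s).
  case: psi_half => [[tau h]|h]; last exact: h.
  by case: psi_nonconstant; exists (tau *i).
have phi_re s : 0 < re s -> re s <= re (phi s).
  by move=> s0; rewrite phiE// mul1r reD lerDl ltW// psi_pos.
have [[_ _ [cu [th [uth uE']]]] u_phi] := u_koenigs.
have uE s : 0 < re s -> u s = s + th s by move=> s0; rewrite uE'// mul1r.
have th_App x : 0 < x -> DApp x th by move=> x0; exact: Coef_App (unif_dirichlet_DCoef uth x0).
have u_pos s : 0 < re s -> 0 < re (u s).
  move=> s0; have [d [c' [psi' [d1 -> // _ h]]]] := u_G.
  rewrite reD re_nat; apply: ltr_wpDr.
    by case: h => [[tau ->//]|/(_ s s0)/ltW//]; rewrite /= mul0r mulr0 mul1r subr0.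
  by rewrite mulr_gt0// ltr0n.
have c1_pos : 0 < re (c 0%N).
  apply: (re_coef0_gt0 (unif_dirichlet_DCoef cpsi ltr01) psi_pos).
  apply: contrapT => nk; apply: psi_nonconstant; exists (c 0%N).
  apply: (unif_dirichlet_cst cpsi) => k k0; apply: contrapT => /eqP ck.
  by apply: nk; exists k.
have u_inj : forall s t, 0 < re s -> 0 < re t -> u s = u t -> s = t.
  apply: (koenigs_inj th_App uE phi_re u_phi c1_pos) => s t s0 t0.
  exact: phi_univalent.2 (mem_set s0) (mem_set t0).
have [x1 [x2 [v [x15 x12 v_App uv]]]] := far_inverse th_App uE.
have [E [E_coef E_l2 E_tri]] := eu_coef th_App uE u_pos.
apply/seteqP; split; first exact: closure_op_alg_sub.
apply: commutant_sub_closure => T m x y al TA.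
apply: (annihilator th_App uE u_inj x15 x12 v_App uv E_coef E_l2 E_tri phi_re
  u_phi c1_pos Cphi_comp (Om := koenigs_shifts u)) => //.
- by move=> w; exact: shift_preimage.
- by move=> t t0; exact: (open_disc Omega_open (Omega_reals t t0)).
Qed.
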